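(* Let $D$ be a $2$-dimensional regular local ring and let $\mathcal{S}$ be a nonempty subset of $Q^*(D)$. The following are equivalent: 1. $\mathcal{S}$ is a Noetherian topological space in the Zariski topology. 2. $\mathcal{S}$ has only finitely many irreducible components (in the Zariski topology). 3. There are valuation rings $V_1,\dots,V_n$ in $Q^*(D)$ such that $\mathcal{S}\subseteq \downarrow^*\{V_1,\dots,V_n\}$. 4. The Zariski closure of $\mathcal{S}$ in $Q^*(D)$ is a Noetherian space. If moreover $\mathcal{S}\subseteq Q(D)$, then items 1–4 are also equivalent to: 5. The Zariski closure of $\mathcal{S}$ in $Q(D)$ is a Noetherian space.
   Context: $D$ is a $2$-dimensional regular local ring with maximal ideal $\mathfrak{m}_D$ and quotient field $F$. A local ring $R$ with $D\subseteq R\subseteq F$ birationally dominates $D$ if $\mathfrak{m}_R\cap D=\mathfrak{m}_D$; $L(D)$ denotes the set of all such local rings. For $x_1,\dots,x_n\in F$ let $\mathcal{U}(x_1,\dots,x_n)=\{R\in L(D): x_1,\dots,x_n\in R\}$. The Zariski topology on $L(D)$ is the topology with basis of open sets the sets $\mathcal{U}(x_1,\dots,x_n)$; subsets of $L(D)$ carry the subspace topology. $Q(D)$ is the set of all $2$-dimensional regular local rings $\alpha$ with $D\subseteq\alpha\subseteq F$ (all of these dominate $D$). $Q^*(D)$ is the union of $Q(D)$ and the set of all valuation rings in $L(D)$. For a subset $\mathcal{S}\subseteq Q^*(D)$, $\downarrow^*\mathcal{S}=\{\alpha\in Q^*(D):\alpha\subseteq\beta\text{ for some }\beta\in\mathcal{S}\}$.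 *)

(* Defs.v *)
From mathcomp Require Import all_boot all_algebra.
Set Implicit Arguments. Unset Strict Implicit. Unset Printing Implicit Defensive.
Import GRing.Theory.
Local Open Scope ring_scope.

Section Defs.
Variable F : fieldType.

(* subsets of F, and "points" of the spaces (= subrings of F) *)
Definition sub (A B : F -> Prop) := forall x, A x -> B x.
Definition psub (A B : (F -> Prop) -> Prop) := forall R, A R -> B R.

Definition is_subring (R : F -> Prop) :=
  [/\ R 1, (forall x y, R x -> R y -> R (x - y)) & (forall x y, R x -> R y -> R (x * y))].

Definition is_ideal (R I : F -> Prop) :=
  [/\ sub I R, I 0, (forall x y, I x -> I y -> I (x + y))
    & (forall r x, R r -> I x -> I (r * x))].

Definition gen_ideal (R : F -> Prop) (s : seq F) : F -> Prop :=
  fun x => exists r : nat -> F, (forall i, R (r i)) /\ x = \sum_(i < size s) r i * s`_i.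

Definition noetherian_ring (R : F -> Prop) :=
  is_subring R /\
  forall I, is_ideal R I ->
    exists s : seq F, (forall x, x \in s -> R x) /\ (forall x, I x <-> gen_ideal R s x).

Definition is_prime (R P : F -> Prop) :=
  [/\ is_ideal R P, ~ P 1 & forall a b, R a -> R b -> P (a * b) -> P a \/ P b].

Definition strict_sub (A B : F -> Prop) := sub A B /\ ~ sub B A.

Definition krull_dim2 (R : F -> Prop) :=
  (exists P0 P1 P2, [/\ is_prime R P0, is_prime R P1, is_prime R P2,
      strict_sub P0 P1 & strict_sub P1 P2]) /\
  ~ (exists P0 P1 P2 P3, [/\ is_prime R P0, is_prime R P1, is_prime R P2,
      is_prime R P3 & [/\ strict_sub P0 P1, strict_sub P1 P2 & strict_sub P2 P3]]).

Definition unit_in (R : F -> Prop) (x : F) := [/\ x != 0, R x & R x^-1].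
Definition max_ideal (R : F -> Prop) : F -> Prop := fun x => R x /\ ~ unit_in R x.

Definition local_ring (R : F -> Prop) := is_subring R /\ is_ideal R (max_ideal R).

Definition regular_local2 (R : F -> Prop) :=
  [/\ local_ring R, noetherian_ring R, krull_dim2 R
    & exists x y, [/\ R x, R y &
        forall z, max_ideal R z <-> exists a b, [/\ R a, R b & z = a * x + b * y]]].

Definition quotient_field_of (D : F -> Prop) :=
  forall z, exists a b, [/\ D a, D b, b != 0 & z = a / b].

Definition in_L (D R : F -> Prop) :=
  [/\ local_ring R, sub D R & forall x, D x -> (max_ideal R x <-> max_ideal D x)].

Definition valuation_ring (V : F -> Prop) :=
  is_subring V /\ forall x, x != 0 -> V x \/ V x^-1.

Definition in_Q (D : F -> Prop) (a : F -> Prop) := regular_local2 a /\ sub D a.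

Definition in_Qstar (D : F -> Prop) (a : F -> Prop) :=
  in_Q D a \/ (in_L D a /\ valuation_ring a).

Definition downstar (D : F -> Prop) (S : (F -> Prop) -> Prop) : (F -> Prop) -> Prop :=
  fun a => in_Qstar D a /\ exists b, S b /\ sub a b.

(* Zariski topology: basic open sets U(x_1,...,x_n) *)
Definition basicU (xs : seq F) (R : F -> Prop) := forall x, x \in xs -> R x.

Definition open_in (X O : (F -> Prop) -> Prop) :=
  psub O X /\
  forall R, O R -> exists xs, basicU xs R /\ forall R', X R' -> basicU xs R' -> O R'.

Definition closed_in (X C : (F -> Prop) -> Prop) :=
  psub C X /\ open_in X (fun R => X R /\ ~ C R).

Definition noetherian_space (X : (F -> Prop) -> Prop) :=
  forall C : nat -> ((F -> Prop) -> Prop),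
    (forall n, closed_in X (C n)) -> (forall n, psub (C n.+1) (C n)) ->
    exists N, forall n, (N <= n)%N -> C n = C N.

Definition irreducible_in (X Z : (F -> Prop) -> Prop) :=
  [/\ psub Z X, (exists R, Z R) &
    forall O1 O2, open_in X O1 -> open_in X O2 ->
      (exists R, Z R /\ O1 R) -> (exists R, Z R /\ O2 R) ->
      exists R, [/\ Z R, O1 R & O2 R]].

Definition irreducible_component (X Z : (F -> Prop) -> Prop) :=
  irreducible_in X Z /\ forall Z', irreducible_in X Z' -> psub Z Z' -> psub Z' Z.

Definition finitely_many_components (X : (F -> Prop) -> Prop) :=
  exists (n : nat) (c : nat -> ((F -> Prop) -> Prop)),
    forall Z, irreducible_component X Z -> exists i, (i < n)%N /\ Z = c i.

Definition closure_in (Y S : (F -> Prop) -> Prop) : (F -> Prop) -> Prop :=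
  fun P => Y P /\ forall xs, basicU xs P -> exists R, S R /\ basicU xs R.

End Defs.

(* Main.v *)
Require Import Defs.
From mathcomp Require Import all_boot all_algebra.
From mathcomp Require Import boolp classical_sets.
From mathcomp Require Import ring zify.
Set Implicit Arguments. Unset Strict Implicit. Unset Printing Implicit Defensive.
Import GRing.Theory.
Local Open Scope ring_scope.

(** A ring [E] of the considered type with parameters [x, y] is blown up by adjoining [t = y / x]
    and localizing. Since [E] is integrally closed, a polynomial over [E] vanishing at [t] has all
    its coefficients in the maximal ideal (Seidenberg); hence every [z] is
    [x ^ (p - q) * A(t) / B(t)] with [A, B] nonzero modulo the maximal ideal, which gives the order
    valuation of [E], and a two-dimensional regular [R] dominating [E] that contains neither [t] nor
    [1 / t] equals [E] (Abhyankar's factorization theorem). Following a valuation ring [V], the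
    iterated transforms either reach a ring whose order valuation ring is [V] or have union [V]. In
    the second case the points below [V] form a chain of type at most omega + 1. In the first case
    they form, up to finitely many of them, a family of fibres over the points of a projective line,
    an open set omits only finitely many fibres, and each fibre lies below a composite valuation of
    the second kind. So the points below [V] form a Noetherian space, which gives 3 => 4. For 2 => 3,
    the union of the rings of an irreducible set is a local ring dominating [D], hence is dominated
    by a valuation ring. *)

(** * Krull's intersection theorem and regular pairs *)

(** Of the regularity hypothesis only a regular pair is kept: the chain condition and two generators
    of the maximal ideal, the second a nonzerodivisor modulo the first. Dimension two enters once,
    to produce such a pair, and the property passes directly to the transforms. Value groups do not
    appear: orders are exponents of one parameter [x] in front of quotients of polynomials in [t].
    Noetherian spaces are treated through sequences of points and basic open sets, because the
    resulting condition passes to subsets and finite unions. The obstacle below an order valuation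
    ring is that [V] does not dominate the local rings of the fibres, so its own transforms give no
    chain there. Composing [V] with the discrete valuation ring of such a local ring modulo [x]
    restores domination, and the composite is of order type over none of the rings that it
    dominates, so the chain argument applies to it. *)

Section Subrings.
Variable F : fieldType.
Implicit Types (R E I J V : F -> Prop) (a b c x y z : F).

Lemma subring1 R : is_subring R -> R 1. Proof. by case. Qed.
Lemma subringB R x y : is_subring R -> R x -> R y -> R (x - y).
Proof. by case=> _ + _; apply. Qed.
Lemma subringM R x y : is_subring R -> R x -> R y -> R (x * y).
Proof. by case=> _ _; apply. Qed.
Lemma subring0 R : is_subring R -> R 0.
Proof. by move=> h; rewrite -(subrr 1); apply: subringB => //; apply: subring1. Qed.
Lemma subringN R x : is_subring R -> R x -> R (- x).
Proof. by move=> h hx; rewrite -sub0r; apply: subringB => //; apply: subring0. Qed.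
Lemma subringD R x y : is_subring R -> R x -> R y -> R (x + y).
Proof. by move=> h hx hy; rewrite -(opprK y); apply: subringB => //; apply: subringN. Qed.
Lemma subringX R x n : is_subring R -> R x -> R (x ^+ n).
Proof.
move=> h hx; elim: n => [|n IH]; first by rewrite expr0; apply: subring1.
by rewrite exprS; apply: subringM.
Qed.
Lemma subring_sum R n (f : nat -> F) :
  is_subring R -> (forall i, (i < n)%N -> R (f i)) -> R (\sum_(i < n) f i).
Proof.
by move=> h hf; apply: big_ind => [||i _]; [apply: subring0|move=> *; apply: subringD|apply: hf].
Qed.

Lemma ideal_sub R I x : is_ideal R I -> I x -> R x. Proof. by case=> + _ _ _; apply. Qed.
Lemma ideal0 R I : is_ideal R I -> I 0. Proof. by case. Qed.
Lemma idealD R I x y : is_ideal R I -> I x -> I y -> I (x + y).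
Proof. by case=> _ _ + _; apply. Qed.
Lemma idealMl R I x y : is_ideal R I -> R x -> I y -> I (x * y).
Proof. by case=> _ _ _; apply. Qed.
Lemma idealMr R I x y : is_ideal R I -> I x -> R y -> I (x * y).
Proof. by move=> h hx hy; rewrite mulrC; apply: (idealMl h). Qed.
Lemma idealN R I x : is_subring R -> is_ideal R I -> I x -> I (- x).
Proof.
move=> hR h hx; rewrite -mulN1r; apply: (idealMl h) => //.
by apply: subringN => //; apply: subring1.
Qed.
Lemma idealB R I x y : is_subring R -> is_ideal R I -> I x -> I y -> I (x - y).
Proof. by move=> hR h hx hy; apply: (idealD h) => //; apply: (idealN hR h). Qed.
Lemma ideal_sum R I n (f : nat -> F) :
  is_ideal R I -> (forall i, (i < n)%N -> I (f i)) -> I (\sum_(i < n) f i).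
Proof.
by move=> h hf; apply: big_ind => [||i _]; 
  [apply: (ideal0 h)|move=> x y *; apply: (idealD h)|apply: hf].
Qed.

Section Local.
Variable R : F -> Prop.
Hypothesis hR : local_ring R.
Let sR : is_subring R := proj1 hR.
Let iM : is_ideal R (max_ideal R) := proj2 hR.

Lemma max_sub a : max_ideal R a -> R a. Proof. by case. Qed.
Lemma max0 : max_ideal R 0. Proof. exact: (ideal0 iM). Qed.
Lemma maxD a b : max_ideal R a -> max_ideal R b -> max_ideal R (a + b).
Proof. exact: (idealD iM). Qed.
Lemma maxN a : max_ideal R a -> max_ideal R (- a). Proof. exact: (idealN sR iM). Qed.
Lemma maxB a b : max_ideal R a -> max_ideal R b -> max_ideal R (a - b).
Proof. exact: (idealB sR iM). Qed.
Lemma maxMl a b : R a -> max_ideal R b -> max_ideal R (a * b).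
Proof. exact: (idealMl iM). Qed.
Lemma maxMr a b : max_ideal R a -> R b -> max_ideal R (a * b).
Proof. exact: (idealMr iM). Qed.
Lemma max1N : ~ max_ideal R 1.
Proof. by case=> r1 []; split; rewrite ?oner_eq0 ?invr1. Qed.
Lemma max_unit a : R a -> ~ max_ideal R a -> unit_in R a.
Proof. by move=> Ra; apply: contra_notP => n; split. Qed.
Lemma unit_max a : unit_in R a -> ~ max_ideal R a.
Proof. by move=> u [_]. Qed.
Lemma unitM a b : unit_in R a -> unit_in R b -> unit_in R (a * b).
Proof.
case=> a0 ra ra' [b0 rb rb']; split; first by rewrite mulf_neq0.
  exact: subringM.
by rewrite invfM; apply: subringM.
Qed.
Lemma max_prime a b : R a -> R b -> max_ideal R (a * b) -> max_ideal R a \/ max_ideal R b.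
Proof.
move=> ra rb h; apply: contrapT => /not_orP[na nb].
by case: (unit_max (unitM (max_unit ra na) (max_unit rb nb))).
Qed.
Lemma unit_addm a b : unit_in R a -> max_ideal R b -> unit_in R (a + b).
Proof.
move=> ua mb; have ra : R a by case: ua.
apply: max_unit; first by apply: subringD => //; apply: max_sub.
by move=> h; apply: (unit_max ua); rewrite -(addrK b a); apply: maxB.
Qed.
End Local.

(** The chain form of Noetherianity, which passes directly to [adj] and to localizations. *)
Definition acc R := forall I : nat -> F -> Prop,
  (forall n, is_ideal R (I n)) -> (forall n, sub (I n) (I n.+1)) ->
  exists N, forall n, (N <= n)%N -> sub (I n) (I N).

Lemma chain_le (I : nat -> F -> Prop) : (forall n, sub (I n) (I n.+1)) ->
  forall m n, (m <= n)%N -> sub (I m) (I n).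
Proof.
move=> h m n; elim: n => [|n IH]; first by rewrite leqn0 => /eqP->.
by rewrite leq_eqVlt => /orP[/eqP->//|/IH hh x /hh]; apply: h.
Qed.

Lemma noetherian_acc R : noetherian_ring R -> acc R.
Proof.
move=> [sR fg] I iI mI; have mono := chain_le mI.
pose U x := exists n, I n x.
have iU : is_ideal R U.
  split.
  - by move=> x [n] /(ideal_sub (iI n)).
  - by exists 0%N; apply: (ideal0 (iI _)).
  - move=> x y [n hx] [k hy]; exists (maxn n k); apply: (idealD (iI _)).
      exact: mono (leq_maxl _ _) _ hx.
    exact: mono (leq_maxr _ _) _ hy.
  - by move=> r x hr [n hx]; exists n; apply: (idealMl (iI _)).
have [s [_ hs]] := fg _ iU.
have [N hN] : exists N, forall i, (i < size s)%N -> I N s`_i.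
  suff: forall k, (k <= size s)%N -> exists N, forall i, (i < k)%N -> I N s`_i by apply.
  elim=> [|k IH] hk; first by exists 0%N.
  have [N hN] := IH (ltnW hk).
  have [M hM] : U s`_k.
    apply/hs; exists (fun i => (i == k)%:R); split.
      by move=> i; case: eqP => _; [apply: subring1|apply: subring0].
    rewrite (bigD1 (Ordinal hk)) //= eqxx mul1r big1 ?addr0 // => i /eqP ne.
    by case: eqP => [e|_]; [case: ne; apply: val_inj|rewrite mul0r].
  exists (maxn N M) => i; rewrite ltnS leq_eqVlt => /orP[/eqP->|/hN].
    by apply: mono hM; rewrite leq_maxr.
  by apply: mono; rewrite leq_maxl.
exists N => n _ x hx; have /hs[r [hr ->]] : U x by exists n.
by apply: (@ideal_sum R _ _ (fun i => r i * s`_i)) => // i hi;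
   apply: (idealMl (iI _)) => //; apply: hN.
Qed.

(* Krull's intersection theorem for a principal ideal. Writing [a = j n + z ^+ n * r n],
   the elements [r n] satisfy [r n = z * r n.+1] modulo the stable value [Q] of [(J : z ^+ n)],
   so the ideals [Q + R * r n] increase and eventually [r n \in Q] by Nakayama. *)
Lemma krull R J z a : local_ring R -> acc R -> is_ideal R J -> max_ideal R z ->
  (forall n, exists j r, [/\ J j, R r & a = j + z ^+ n * r]) -> J a.
Proof.
move=> lR aR iJ mz h; have sR := proj1 lR; have Rz := max_sub mz.
have /choice[r hr] : forall n, exists r, R r /\ J (a - z ^+ n * r).
  by move=> n; have [j [r [Jj Rr ->]]] := h n; exists r; rewrite addrK.
pose Q n x := R x /\ J (z ^+ n * x).
have iQ n : is_ideal R (Q n).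
  split.
  - by move=> x [].
  - by split; [apply: subring0|rewrite mulr0; apply: (ideal0 iJ)].
  - by move=> x y [? ?] [? ?]; split; [apply: subringD|rewrite mulrDr; apply: (idealD iJ)].
  - move=> c x Rc [Rx Jx]; split; first exact: subringM.
    by rewrite mulrCA; apply: (idealMl iJ).
have mQ n : sub (Q n) (Q n.+1).
  by move=> x [Rx Jx]; split => //; rewrite exprS -mulrA; apply: (idealMl iJ).
have [N hN] := aR _ iQ mQ.
have step n : (N <= n)%N -> Q N (r n - z * r n.+1).
  move=> Nn; apply: hN Nn _ _; split.
    by apply: subringB => //; [have [] := hr n|apply: subringM => //; have [] := hr n.+1].
  have -> : z ^+ n * (r n - z * r n.+1)
    = (a - z ^+ n.+1 * r n.+1) - (a - z ^+ n * r n) by rewrite exprSr; ring.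
  by apply: (idealB sR iJ); [have [] := hr n.+1|have [] := hr n].
pose K n x := exists q c, [/\ Q N q, R c & x = q + c * r (N + n)%N].
have iK n : is_ideal R (K n).
  split.
  - move=> x [q [c [[Rq _] Rc ->]]]; apply: subringD => //; apply: subringM => //.
    by have [] := hr (N + n)%N.
  - by exists 0, 0; split; rewrite ?mul0r ?addr0 //; [apply: (ideal0 (iQ N))|apply: subring0].
  - move=> x y [q [c [Qq Rc ->]]] [q' [c' [Qq' Rc' ->]]].
    exists (q + q'), (c + c'); split; [exact: (idealD (iQ N))|exact: subringD|ring].
  - move=> d x Rd [q [c [Qq Rc ->]]].
    exists (d * q), (d * c); split; [exact: (idealMl (iQ N))|exact: subringM|ring].
have mK n : sub (K n) (K n.+1).
  move=> x [q [c [Qq Rc ->]]].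
  exists (q + c * (r (N + n)%N - z * r (N + n).+1)), (c * z); split.
  - by apply: (idealD (iQ N)) => //; apply: (idealMl (iQ N)) => //; apply: step; rewrite leq_addr.
  - exact: subringM.
  - by rewrite addnS; ring.
have [M hM] := aR _ iK mK.
have [q [c [Qq Rc e]]] : K M (r (N + M.+1)%N).
  apply: (hM M.+1 (leqnSn _)); exists 0, 1; split; rewrite ?mul1r ?add0r //.
    exact: (ideal0 (iQ N)).
  exact: subring1.
have {}e : (1 - c * z) * r (N + M.+1)%N = q + c * (r (N + M)%N - z * r (N + M.+1)%N).
  by rewrite {1}mulrBl mul1r {1}e; ring.
have [u0 _ Ru] : unit_in R (1 - c * z).
  apply: unit_addm => //; last by apply: maxN => //; apply: maxMl.
  by split; rewrite ?oner_eq0 ?invr1 //; apply: subring1.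
have : Q N (r (N + M.+1)%N).
  rewrite -[r (N + M.+1)%N](mulKf u0) e; apply: (idealMl (iQ N)) => //.
  apply: (idealD (iQ N)) => //; apply: (idealMl (iQ N)) => //.
  by rewrite addnS; apply: step; rewrite leq_addr.
move=> [Rr Jr]; have [_ J2] := hr (N + M.+1)%N.
rewrite -[a](subrK (z ^+ (N + M.+1) * r (N + M.+1)%N)); apply: (idealD iJ) => //.
by rewrite [X in z ^+ X]addnC exprD -mulrA; apply: (idealMl iJ) => //; apply: subringX.
Qed.

Definition princ R a : F -> Prop := fun z => exists2 b, R b & z = a * b.

Lemma princ_ideal R a : is_subring R -> R a -> is_ideal R (princ R a).
Proof.
move=> sR Ra; split.
- by move=> _ [b Rb ->]; apply: subringM.
- by exists 0; [apply: subring0|rewrite mulr0].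
- by move=> _ _ [b Rb ->] [c Rc ->]; exists (b + c); [apply: subringD|rewrite mulrDr].
- by move=> r _ Rr [b Rb ->]; exists (r * b); [apply: subringM|rewrite mulrCA].
Qed.

Definition pair_gen R a b : F -> Prop := fun z => exists c d, [/\ R c, R d & z = a * c + b * d].

Lemma pair_ideal R a b : is_subring R -> R a -> R b -> is_ideal R (pair_gen R a b).
Proof.
move=> sR Ra Rb; split.
- by move=> _ [c [d [Rc Rd ->]]]; apply: subringD => //; apply: subringM.
- by exists 0, 0; rewrite !mulr0 addr0; split=> //; apply: subring0.
- move=> _ _ [c [d [Rc Rd ->]]] [c' [d' [Rc' Rd' ->]]]; exists (c + c'), (d + d').
  by split; [apply: subringD|apply: subringD|ring].
- move=> r _ Rr [c [d [Rc Rd ->]]]; exists (r * c), (r * d).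
  by split; [apply: subringM|apply: subringM|ring].
Qed.

Definition two_gen R x y := [/\ local_ring R, acc R, max_ideal R x, max_ideal R y &
  forall z, max_ideal R z -> exists a b, [/\ R a, R b & z = a * x + b * y]].

(** [R / x] is local with maximal ideal generated by [y]; by [krull], division by [y] stops at a
    unit for every element outside [x R]. *)
Lemma modx_form R x y a : two_gen R x y -> R a -> ~ princ R x a ->
  exists u i b, [/\ unit_in R u, R b & a = u * y ^+ i + x * b].
Proof.
move=> [lR aR mx my mE] Ra na; have sR := proj1 lR.
have Rx := max_sub mx; have Ry := max_sub my.
apply: contrapT => nh; apply: na; apply: (krull lR aR (princ_ideal sR Rx) my).
elim=> [|n [j [r [[b Rb ->] Rr e]]]].
  exists 0, a; split; rewrite ?expr0 ?mul1r ?add0r //.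
  by exists 0; rewrite ?mulr0 //; apply: subring0.
have mr : max_ideal R r.
  apply: contrapT => nr; apply: nh; exists r, n, b; split => //; first exact: max_unit.
  by rewrite e addrC [r * _]mulrC.
have [c [d [Rc Rd er]]] := mE _ mr.
exists (x * (b + y ^+ n * c)), d; split => //.
  by exists (b + y ^+ n * c) => //; apply: subringD => //; apply: subringM => //; apply: subringX.
by rewrite e er exprSr; ring.
Qed.

(* An ideal on which [x] is a nonzerodivisor modulo the ideal is generated by any of its elements
   with the least order in the discrete quotient [R / x]. *)
Lemma saturated_principal R x y I : two_gen R x y -> is_ideal R I ->
  (forall b, R b -> I (x * b) -> I b) ->
  exists p, I p /\ forall z, I z -> princ R p z.
Proof.
move=> gR iI sat; have [lR aR mx my _] := gR; have sR := proj1 lR.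
have Rx := max_sub mx; have Ry := max_sub my.
have iter p : I p -> (forall z, I z -> exists c b, [/\ R c, I b & z = p * c + x * b]) ->
    forall z, I z -> princ R p z.
  move=> Ip hp z Iz; apply: (krull lR aR (princ_ideal sR (ideal_sub iI Ip)) mx) => n.
  suff [c [b [Rc Ib ->]]] : exists c b, [/\ R c, I b & z = p * c + x ^+ n * b].
    by exists (p * c), b; split; [exists c|apply: ideal_sub iI Ib|].
  elim: n => [|n [c [b [Rc Ib ->]]]].
    by exists 0, z; rewrite mulr0 add0r expr0 mul1r; split => //; apply: subring0.
  have [c' [b' [Rc' Ib' ->]]] := hp _ Ib.
  exists (c + x ^+ n * c'), b'; split => //; last by rewrite exprSr; ring.
  by apply: subringD => //; apply: subringM => //; apply: subringX.
have [allx|] := EM (forall z, I z -> princ R x z).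
  exists 0; split; first exact: (ideal0 iI).
  apply: iter; first exact: (ideal0 iI).
  move=> z Iz; have [b Rb e] := allx _ Iz.
  by exists 0, b; split; rewrite ?mul0r ?add0r //; [apply: subring0|apply: sat; rewrite -?e].
move=> /existsNP[z0 /not_implyP[Iz0 nz0]].
pose P i := `[<exists p u b, [/\ I p, unit_in R u, R b & p = u * y ^+ i + x * b]>].
have exP : exists i, P i.
  have [u [i [b [uu Rb e]]]] := modx_form gR (ideal_sub iI Iz0) nz0.
  by exists i; apply/asboolP; exists z0, u, b.
case: (ex_minnP exP) => i /asboolP[p [u [b [Ip uu Rb ep]]]] imin.
have [u0 Ru Ru'] := uu.
exists p; split => //; apply: iter => // z Iz.
have [[c Rc e]|nz] := EM (princ R x z).
  exists 0, c; split; rewrite ?mulr0 ?add0r //; first exact: subring0.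
  by apply: sat; rewrite -?e.
have [v [j [c [uv Rc ez]]]] := modx_form gR (ideal_sub iI Iz) nz.
have ij : (i <= j)%N by apply: imin; apply/asboolP; exists z, v, c.
have Rv : R v by case: uv.
have Rw : R (v * u^-1 * y ^+ (j - i)).
  by apply: subringM => //; [apply: subringM|apply: subringX].
have ee : z - p * (v * u^-1 * y ^+ (j - i)) = x * (c - b * (v * u^-1 * y ^+ (j - i))).
  rewrite ez ep -{1}(subnK ij) exprD; field; exact: u0.
exists (v * u^-1 * y ^+ (j - i)), (c - b * (v * u^-1 * y ^+ (j - i))); split => //.
  apply: sat; first by apply: subringB => //; apply: subringM.
  rewrite -ee; apply: (idealB sR iI) => //; exact: (idealMr iI).
by rewrite -ee; ring.
Qed.

(** A regular sequence generating the maximal ideal; with the chain condition it stands for a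
    two-dimensional regular local ring. *)
Definition regular_pair R x y :=
  [/\ two_gen R x y, x != 0 & forall a, R a -> princ R x (y * a) -> princ R x a].

(** Such a [P] is generated by one element [p = a x + b y], so [p ^ n] lies in [(x, y ^ n)]. If [x]
    divided [y ^ n], it would divide [p ^ n]; as [x] is not in [P], the factors [p] cancel one by
    one and [x] would divide [1]. *)
Lemma prime_powN R x y P : two_gen R x y -> is_prime R P -> (exists2 a, P a & a != 0) ->
  ~ P x -> forall n, ~ princ R x (y ^+ n).
Proof.
move=> gR [iP P1 Pp] [a0 Pa0 nza0] nPx n [s0 Rs0 es0].
have [lR aR mx my mE] := gR; have sR := proj1 lR.
have Rx := max_sub mx; have Ry := max_sub my.
have [b Rb|p [Pp0 hp]] := saturated_principal gR iP (x := x).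
  by move=> /Pp[].
have Rp := ideal_sub iP Pp0.
have pn0 : p != 0.
  by apply: contra_neq nza0 => e; have [b _ ->] := hp _ Pa0; rewrite e mul0r.
have mp : max_ideal R p.
  split=> // -[_ _ Rp']; apply: P1.
  by rewrite -(mulVf pn0); apply: (idealMl iP).
have [a [b [Ra Rb ep]]] := mE _ mp.
have [s Rs es] : princ R x (p ^+ n).
  suff [c [d [Rc Rd ->]]] : exists c d, [/\ R c, R d & p ^+ n = x * c + y ^+ n * d].
    exists (c + s0 * d); [by apply: subringD => //; apply: subringM|by rewrite es0; ring].
  elim: {es0} n => [|n [c [d [Rc Rd e]]]].
    exists 0, 1; rewrite !expr0 mulr0 add0r mulr1; split => //; [exact: subring0|exact: subring1].
  exists (c * p + y ^+ n * d * a), (d * b); split.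
  - apply: subringD => //; first exact: subringM.
    by apply: subringM => //; apply: subringM => //; apply: subringX.
  - exact: subringM.
  - by rewrite exprSr e {2}ep exprSr ep; ring.
have : forall s, R s -> p ^+ n = x * s -> False; last by move/(_ s Rs es).
elim: {es es0} n => [|n IH] {s Rs} s Rs es.
  apply: (max1N (R := R)) => //; move: es; rewrite expr0 => ->; exact: maxMr.
have : P (x * s) by rewrite -es exprS; apply: (idealMr iP) => //; apply: subringX.
move=> /(Pp _ _ Rx Rs)[//|/hp[c Rc ec]]; apply: (IH c Rc).
by apply: (mulfI pn0); rewrite -exprS es ec; ring.
Qed.

Lemma two_genC R x y : two_gen R x y -> two_gen R y x.
Proof.
case=> lR aR mx my mE; split=> // z /mE[a [b [Ra Rb ->]]].
by exists b, a; rewrite addrC.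
Qed.

Lemma regular_pairC R x y : regular_pair R x y -> regular_pair R y x.
Proof.
case=> gR x0 reg; have [lR aR mx my _] := gR; have sR := proj1 lR.
have y0 : y != 0.
  apply/eqP => y0; have := reg 1 (subring1 sR).
  rewrite y0 mul0r => h; case: h => [|b Rb e]; first by exists 0; rewrite ?mulr0 //; apply: subring0.
  by apply: (max1N (R := R)); rewrite e; apply: maxMr.
split=> //; first exact: two_genC.
move=> a Ra [b Rb e]; have [|c Rc ec] := reg b Rb; first by exists a.
by exists c => //; apply: (mulfI x0); rewrite e ec; ring.
Qed.

(** The middle prime [P1] of a chain is nonzero and misses one of the generators, say [x]. If [y b]
    were in [x R] with [b] outside, [modx_form] would put a power of [y] in [x R], against
    [prime_powN]. *)
Lemma regular_local2_pair R : regular_local2 R -> exists x y, regular_pair R x y.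
Proof.
move=> [lR nR [[P0 [P1 [P2 [pr0 pr1 pr2 s01 s12]]]] _] [x [y [Rx Ry mE]]]].
have sR := proj1 lR; have aR := noetherian_acc nR.
have g : two_gen R x y.
  split=> //; first 1 last.
  - by apply/mE; exists 0, 1; rewrite mul0r add0r mul1r; split=> //; [apply: subring0|apply: subring1].
  - by move=> z /mE.
  - by apply/mE; exists 1, 0; rewrite mul0r addr0 mul1r; split=> //; [apply: subring1|apply: subring0].
have [a Pa na] : exists2 a, P1 a & a != 0.
  apply: contrapT => nh; case: s01 => _; apply => z Pz.
  have [->|nz] := eqVneq z 0; first by case: pr0 => /ideal0.
  by case: nh; exists z.
have wl x' y' : two_gen R x' y' -> ~ P1 x' -> exists x y, regular_pair R x y.
  move=> g' nPx; exists x', y'; split=> //.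
    by apply: contra_not_neq nPx => ->; case: pr1 => /ideal0.
  move=> b Rb [c Rc e]; apply: contrapT => nb.
  have [lR' _ mx' my' _] := g'.
  have [u [i [d [[u0 Ru Ru'] Rd eb]]]] := modx_form g' Rb nb.
  apply: (@prime_powN R x' y' P1 g' pr1 _ nPx i.+1); first by exists a.
  exists (u^-1 * (c - y' * d)).
    apply: subringM => //; apply: subringB => //; apply: subringM => //; exact: max_sub.
  have -> : x' * (u^-1 * (c - y' * d)) = u^-1 * (x' * c - x' * y' * d) by ring.
  by rewrite -e eb exprS; field.
have [Px|] := EM (P1 x); last exact: wl g.
have [Py|] := EM (P1 y); last exact: wl (two_genC g).
case: s12 => _ []; move=> z P2z.
have [a' [b' [Ra' Rb' ->]]] : exists a b, [/\ R a, R b & z = a * x + b * y].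
  apply/mE; split; first by case: pr2 => /ideal_sub h _ _; apply: h.
  case: pr2 => i2 n2 _ [z0 Rz Rz']; apply: n2; rewrite -(mulVf z0); exact: (idealMl i2).
by case: pr1 => i1 _ _; apply: (idealD i1); apply: (idealMl i1).
Qed.
End Subrings.

(** * Integral closedness and Seidenberg's lemma *)

Section IntegrallyClosed.
Variable F : fieldType.
Implicit Types (R E I J V : F -> Prop) (a b c x y z s t : F).

Lemma regular_pow R x y i a : regular_pair R x y -> R a -> princ R x (y ^+ i * a) -> princ R x a.
Proof.
move=> [gR _ reg]; have [lR _ _ /max_sub Ry _] := gR; have sR := proj1 lR.
move=> Ra; elim: i => [|i IH]; first by rewrite expr0 mul1r.
by rewrite exprS -mulrA => /reg h; apply: IH; apply: h; apply: subringM => //; apply: subringX.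
Qed.

(** The nonzero elements of [R / x] are units times powers of the nonzerodivisor [y]. *)
Lemma regular_prime R x y a b : regular_pair R x y -> R a -> R b ->
  princ R x (a * b) -> princ R x a \/ princ R x b.
Proof.
move=> rR Ra Rb [c Rc e]; have [gR _ _] := rR; have [lR _ mx my _] := gR.
have sR := proj1 lR; have Rx := max_sub mx.
have [|na] := EM (princ R x a); [by left|right].
have [u [i [d [[u0 Ru Ru'] Rd ea]]]] := modx_form gR Ra na.
apply: (regular_pow (i := i) rR) => //; exists (u^-1 * (c - d * b)).
  by apply: subringM => //; apply: subringB => //; apply: subringM.
have -> : x * (u^-1 * (c - d * b)) = u^-1 * (x * c - x * d * b) by ring.
by rewrite -e ea; field.
Qed.

Lemma regular_primeX R x y a n : regular_pair R x y -> R a -> princ R x (a ^+ n) -> princ R x a.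
Proof.
move=> rR Ra; have [gR _ _] := rR; have [lR _ mx _ _] := gR; have sR := proj1 lR.
elim: n => [|n IH].
  rewrite expr0 => -[b Rb e]; case: (max1N (R := R)); rewrite e; exact: maxMr.
by rewrite exprS => /(regular_prime rR Ra)[]//; apply: subringX.
Qed.

Lemma regular_factor R x y p a : regular_pair R x y -> max_ideal R p -> R a -> a != 0 ->
  exists j b, [/\ R b, ~ princ R p b & a = p ^+ j * b].
Proof.
move=> [[lR aR _ _ _] _ _] mp Ra a0; have sR := proj1 lR.
apply: contrapT => nh; case/eqP: a0.
suff : princ R 0 a by case=> b _ ->; rewrite mul0r.
apply: (krull lR aR (princ_ideal sR (subring0 sR)) mp).
move=> n; suff [r Rr ->] : exists2 r, R r & a = p ^+ n * r.
  by exists 0, r; rewrite add0r; split=> //; exists 0; rewrite ?mul0r //; apply: subring0.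
elim: n => [|n [r Rr er]]; first by exists a; rewrite // expr0 mul1r.
have [b Rb eb] : princ R p r by apply: contrapT => nr; apply: nh; exists n, r.
by exists b => //; rewrite er eb exprSr; ring.
Qed.

Definition int_closed R := forall s n (r : nat -> F), (forall i, R (r i)) ->
  s ^+ n = \sum_(i < n) r i * s ^+ i -> R s.

(** The ideal of denominators of [b / a] is saturated with respect to [x], since [x] is prime and
    does not divide [a]; hence it is principal. *)
Lemma regular_den R x y a b : regular_pair R x y -> R a -> R b -> ~ princ R x a -> a != 0 ->
  exists p, [/\ R p, R (p * (b / a)), p != 0 & forall r, R r -> R (r * (b / a)) -> princ R p r].
Proof.
move=> rR Ra Rb na a0; have [gR x0 _] := rR; have [lR _ mx _ _] := gR.
have sR := proj1 lR; have Rx := max_sub mx.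
pose I r := R r /\ R (r * (b / a)).
have iI : is_ideal R I.
  split.
  - by move=> r [].
  - by split; rewrite ?mul0r; apply: subring0.
  - by move=> r q [? ?] [? ?]; split; rewrite ?mulrDl; apply: subringD.
  - by move=> r q Rr [? ?]; split; rewrite -?mulrA; apply: subringM.
have [c Rc [_ h]|p [[Rp Rpb] hp]] := saturated_principal gR iI (x := x).
  split=> //; have Rcb : R (c * b) by apply: subringM.
  have /(regular_prime rR Ra h)[//|[e Re ee]] : princ R x (a * (x * c * (b / a))).
    by exists (c * b) => //; field.
  suff -> : c * (b / a) = e by [].
  by apply: (mulfI x0); rewrite -ee; ring.
exists p; split=> //; last by move=> r Rr Rrb; apply: hp.
have [|e Re ea] := hp a; first by split=> //; rewrite mulrC divfK.
by apply: contra_neq a0 => p0; rewrite ea p0 mul0r.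
Qed.

(** For suitable [j], the fraction [s' = x ^ j * s] has a principal ideal of denominators [p R], and
    membership of [(p * s') ^ k * s'] in [R] descends from [k + 1] to [k]. The power [x ^ j] is then
    removed one factor at a time, [x] being prime. *)
Lemma regular_int_closed R x y : regular_pair R x y -> quotient_field_of R -> int_closed R.
Proof.
move=> rR qR s n r Rr es; have [gR x0 _] := rR; have [lR _ mx _ _] := gR.
have sR := proj1 lR; have Rx := max_sub mx.
have [b [a [Rb Ra a0 esab]]] := qR s.
have [j [a' [Ra' na' ea]]] := regular_factor rR mx Ra a0.
have a'0 : a' != 0 by apply: contra_neq a0 => e; rewrite ea e mulr0.
have Rs' : R (x ^+ j * s).
  have -> : x ^+ j * s = b / a' by rewrite esab ea; field; rewrite a'0 expf_neq0.
  have [p [Rp]] := regular_den rR Ra' Rb na' a'0.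
  have -> : b / a' = x ^+ j * s by rewrite esab ea; field; rewrite a'0 expf_neq0.
  set s' := x ^+ j * s => Rps' p0 hp.
  have key k : R ((p * s') ^+ k * s') -> R s'.
    elim: k => [|k IH]; first by rewrite expr0 mul1r.
    move=> /(hp _ (subringX _ sR Rps')) [d Rd ed]; apply: IH.
    suff -> : (p * s') ^+ k * s' = d by [].
    by apply: (mulfI p0); rewrite -ed exprSr; ring.
  case: n es => [|m] es; first by move/eqP: es; rewrite expr0 big_ord0 oner_eq0.
  apply: (key m).
  have -> : (p * s') ^+ m * s' = p ^+ m * x ^+ j ^+ m.+1 * s ^+ m.+1.
    by rewrite /s' !exprMn !exprSr; ring.
  rewrite es big_distrr /=.
  apply: (@subring_sum _ R _ (fun i => p ^+ m * x ^+ j ^+ m.+1 * (r i * s ^+ i))) => // i hi.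
  have -> : p ^+ m * x ^+ j ^+ m.+1 * (r i * s ^+ i)
     = r i * p ^+ (m - i) * x ^+ j ^+ (m.+1 - i) * (p * s') ^+ i.
    have e1 : p ^+ m = p ^+ (m - i) * p ^+ i by rewrite -exprD; congr (_ ^+ _); lia.
    have e2 : x ^+ j ^+ m.+1 = x ^+ j ^+ (m.+1 - i) * x ^+ j ^+ i.
      by rewrite -exprD; congr (_ ^+ _); lia.
    by rewrite e1 e2 /s' !exprMn; ring.
  apply: subringM => //; last exact: subringX.
  apply: subringM => //; last by apply: subringX => //; apply: subringX.
  by apply: subringM => //; apply: subringX.
elim: j {ea} Rs' => [|j IH]; first by rewrite expr0 mul1r.
set c := x ^+ j.+1 * s => Rc; apply: IH.
have [||d Rd ed] := @regular_primeX R x y c n rR; first by [].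
  have -> : c ^+ n = x ^+ j.+1 ^+ n * s ^+ n by rewrite /c exprMn.
  rewrite es big_distrr /=.
  apply: (@ideal_sum _ R _ _ (fun i => x ^+ j.+1 ^+ n * (r i * s ^+ i))) => [|i hi].
    exact: princ_ideal.
  exists (x ^+ j * x ^+ j.+1 ^+ (n - i).-1 * (r i * c ^+ i)).
    apply: subringM => //; last by apply: subringM => //; apply: subringX.
    by apply: subringM => //; [apply: subringX|apply: subringX => //; apply: subringX].
  have -> : x ^+ j.+1 ^+ n = x ^+ j.+1 * x ^+ j.+1 ^+ (n - i).-1 * x ^+ j.+1 ^+ i.
    by rewrite -exprS -exprD; congr (_ ^+ _); lia.
  by rewrite /c !exprMn exprS; ring.
suff -> : x ^+ j * s = d by [].
by apply: (mulfI x0); rewrite -ed /c exprS; ring.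
Qed.

(* Multiplying the equation by a power of its leading coefficient [c] shows that [c * t] is
   integral; it cannot be a unit since [t^-1] is not in [R], so it can be absorbed in the next
   coefficient. *)
Lemma seidenberg_sum R t : local_ring R -> int_closed R -> ~ R t -> ~ R t^-1 ->
  forall n (c : nat -> F), (forall i, R (c i)) -> \sum_(i < n.+1) c i * t ^+ i = 0 ->
  forall i, (i <= n)%N -> max_ideal R (c i).
Proof.
move=> lR icR nt nt'; have sR := proj1 lR; elim=> [|n IH] c Rc.
  rewrite big_ord1 expr0 mulr1 => c0 i; rewrite leqn0 => /eqP->; rewrite c0; exact: max0.
move=> e; set d := c n.+1.
have Rdt : R (d * t).
  apply: (icR _ n.+1 (fun i => - c i * d ^+ (n - i))).
    by move=> i; apply: subringM => //; [apply: subringN|apply: subringX => //; apply: Rc].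
  move: e; rewrite big_ord_recr /= -/d => /eqP; rewrite addrC addr_eq0 => /eqP e.
  have -> : (d * t) ^+ n.+1 = d ^+ n * (d * t ^+ n.+1) by rewrite exprMn exprSr; ring.
  rewrite e mulrN big_distrr /= -sumrN; apply: eq_bigr => i _.
  have -> : d ^+ n = d ^+ (n - i) * d ^+ i by rewrite -exprD subnK // -ltnS ltn_ord.
  by rewrite exprMn; ring.
have t0 : t != 0 by apply: contra_not_neq nt => ->; apply: subring0.
have mdt : max_ideal R (d * t).
  apply: contrapT => /(max_unit Rdt)[dt0 _ Rdt']; apply: nt'.
  have d0 : d != 0 by apply: contra_neq dt0 => ->; rewrite mul0r.
  have -> : t^-1 = d * (d * t)^-1 by field; rewrite t0 d0.
  by apply: subringM => //; apply: Rc.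
have mc i : (i <= n)%N -> max_ideal R (if i == n then c i + d * t else c i).
  apply: (IH (fun i => if i == n then c i + d * t else c i)).
    by move=> k; case: eqP => // _; apply: subringD.
  move: e; rewrite !big_ord_recr /= eqxx -/d => e0; rewrite -[RHS]e0.
  rewrite -addrA mulrDl; congr (_ + (_ + _)); last by rewrite exprS; ring.
  by apply: eq_bigr => k _; rewrite ltn_eqF.
move=> i; rewrite leq_eqVlt => /orP[/eqP->|]; last first.
  rewrite ltnS => hi; have := mc i hi; case: eqP => // _ h.
  by rewrite -(addrK (d * t) (c i)); apply: maxB.
apply: contrapT => /(max_unit (Rc _))[d0 _ Rd']; apply: nt.
rewrite -[t](mulKf d0); exact: subringM.
Qed.
End IntegrallyClosed.

(** * Polynomials over a subring and their reduction modulo the maximal ideal *)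

Section PolyOver.
Variable F : fieldType.
Implicit Types (R E I J V : F -> Prop) (a b c x y z s t : F) (P Q A B : {poly F}).

Definition polyover R P := forall i, R P`_i.

Section OverRing.
Variable R : F -> Prop.
Hypothesis sR : is_subring R.

Lemma over0 : polyover R 0. Proof. by move=> i; rewrite coef0; apply: subring0. Qed.
Lemma overC c : R c -> polyover R c%:P.
Proof. by move=> Rc i; rewrite coefC; case: ifP => // _; apply: subring0. Qed.
Lemma overX : polyover R 'X.
Proof. by move=> i; rewrite coefX; case: eqP => _; [apply: subring1|apply: subring0]. Qed.
Lemma overD P Q : polyover R P -> polyover R Q -> polyover R (P + Q).
Proof. by move=> hP hQ i; rewrite coefD; apply: subringD. Qed.
Lemma overN P : polyover R P -> polyover R (- P).
Proof. by move=> hP i; rewrite coefN; apply: subringN. Qed.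
Lemma overB P Q : polyover R P -> polyover R Q -> polyover R (P - Q).
Proof. by move=> hP hQ; apply: overD => //; apply: overN. Qed.
Lemma overZ c P : R c -> polyover R P -> polyover R (c *: P).
Proof. by move=> hc hP i; rewrite coefZ; apply: subringM. Qed.
Lemma overM P Q : polyover R P -> polyover R Q -> polyover R (P * Q).
Proof.
move=> hP hQ i; rewrite coefM.
by apply: (@subring_sum _ R _ (fun j => P`_j * Q`_(i - j))) => // j _; apply: subringM.
Qed.
Lemma over1 : polyover R 1. Proof. by apply: overC; apply: subring1. Qed.
Lemma overXn n : polyover R 'X^n.
Proof. by move=> i; rewrite coefXn; case: eqP => _; [apply: subring1|apply: subring0]. Qed.
Lemma overE P n : polyover R P -> polyover R (P ^+ n).
Proof. by move=> hP; elim: n => [|n IH]; [apply: over1|rewrite exprS; apply: overM]. Qed.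
End OverRing.

Lemma over_sub R R' P : sub R R' -> polyover R P -> polyover R' P.
Proof. by move=> s h i; apply: s. Qed.

Lemma over_horner R P t : is_subring R -> polyover R P -> R t -> R P.[t].
Proof.
move=> sR hP Rt; rewrite horner_coef.
by apply: (@subring_sum _ R _ (fun i => P`_i * t ^+ i)) => // i _;
   apply: subringM => //; apply: subringX.
Qed.

Notation mover R := (polyover (max_ideal R)).

Lemma over_idealM R I P Q : is_ideal R I -> polyover R P -> polyover I Q -> polyover I (P * Q).
Proof.
move=> iI hP hQ i; rewrite coefM.
by apply: (@ideal_sum _ R _ _ (fun j => P`_j * Q`_(i - j))) => // j _; apply: (idealMl iI).
Qed.

Lemma over_idealD R I P Q : is_ideal R I -> polyover I P -> polyover I Q -> polyover I (P + Q).
Proof. by move=> iI hP hQ i; rewrite coefD; apply: (idealD iI). Qed.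

Lemma over_idealB R I P Q : is_subring R -> is_ideal R I ->
  polyover I P -> polyover I Q -> polyover I (P - Q).
Proof. by move=> sR iI hP hQ i; rewrite coefB; apply: (idealB sR iI). Qed.

(** Gauss's argument: if [P] and [Q] both had unit coefficients, the first ones, in degrees [i] and
    [j], would make the coefficient of the product in degree [i + j] a unit. *)
Lemma moverM R P Q : local_ring R -> polyover R P -> polyover R Q -> mover R (P * Q) ->
  mover R P \/ mover R Q.
Proof.
move=> lR hP hQ h; have sR := proj1 lR; apply: contrapT => /not_orP[nP nQ].
have first A : ~ mover R A -> polyover R A ->
    exists i, unit_in R A`_i /\ forall j, (j < i)%N -> max_ideal R A`_j.
  move=> /existsNP ex hA; have ex' : exists i, `[<~ max_ideal R A`_i>].
    by have [i ni] := ex; exists i; apply/asboolP.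
  case: (ex_minnP ex') => i /asboolP ni imin; exists i; split; first exact: max_unit.
  move=> j ji; apply: contrapT => nj; have := imin j.
  by rewrite leqNgt ji => f; suff : false by []; apply: f; apply/asboolP.
have [i [ui mi]] := first P nP hP; have [j [uj mj]] := first Q nQ hQ.
have ij : (i < (i + j).+1)%N by lia.
have := h (i + j)%N; rewrite coefM (bigD1 (Ordinal ij)) //= addKn.
apply: unit_max; apply: (unit_addm lR); first exact: (unitM lR).
apply: big_ind => [|a b|k /eqP nk]; [exact: max0|exact: maxD|].
have {}nk : (k : nat) <> i by move=> e; apply: nk; apply: val_inj.
have [ki|ki] := ltnP k i; first by apply: maxMr => //; apply: mi.
by apply: maxMl => //; apply: mj; have := ltn_ord k; lia.
Qed.

Lemma seidenberg R t P : local_ring R -> int_closed R -> ~ R t -> ~ R t^-1 ->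
  polyover R P -> P.[t] = 0 -> mover R P.
Proof.
move=> lR ic nt nt' hP; rewrite (@horner_coef_wide _ (size P).+1) // => e i.
have [hi|hi] := ltnP (size P) i; last first.
  exact: (seidenberg_sum lR ic nt nt' (c := fun i => P`_i) hP e).
by rewrite nth_default ?(ltnW hi) //; apply: max0.
Qed.

Definition adj R t z := exists2 P, polyover R P & z = P.[t].

Lemma adj_subring R t : is_subring R -> is_subring (adj R t).
Proof.
move=> sR; split.
- by exists 1; [apply: over1|rewrite hornerC].
- by move=> _ _ [P hP ->] [Q hQ ->]; exists (P - Q); [apply: overB|rewrite !hornerE].
- by move=> _ _ [P hP ->] [Q hQ ->]; exists (P * Q); [apply: overM|rewrite !hornerE].
Qed.

Lemma adj_base R t : is_subring R -> sub R (adj R t).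
Proof. by move=> sR c Rc; exists c%:P; [apply: overC|rewrite hornerC]. Qed.

Lemma adj_gen R t : is_subring R -> adj R t t.
Proof. by move=> sR; exists 'X; [apply: overX|rewrite hornerX]. Qed.
End PolyOver.
Notation mover R := (polyover (max_ideal R)).

(** * The order valuation *)

Section Order.
Variable F : fieldType.
Implicit Types (R I : F -> Prop) (a b c z s : F) (P Q A B : {poly F}).

(** The powers of the maximal ideal, generated by products without reference to parameters, so that
    their descriptions in [y / x] and in [x / y] can be compared. *)
Fixpoint mpow (E : F -> Prop) k : F -> Prop :=
  if k is k'.+1 then
    fun z => forall I, is_ideal E I -> (forall a b, max_ideal E a -> mpow E k' b -> I (a * b)) -> I z
  else E.

Lemma chartM (E : F -> Prop) (x y t : F) : regular_pair E x y -> t = y / x -> x * t = y.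
Proof. by move=> [_ x0 _] ->; rewrite mulrC divfK. Qed.

Lemma chart_notin (E : F -> Prop) (x y t : F) : regular_pair E x y -> t = y / x -> ~ E t.
Proof.
move=> rE te Et; have [[lE _ mx _ _] _ reg] := rE.
have [|b Eb e] := reg 1 (subring1 (proj1 lE)).
  by exists t => //; rewrite mulr1 (chartM rE te).
by apply: (max1N (R := E)); rewrite e; apply: maxMr.
Qed.

Variables (E : F -> Prop) (x y : F).
Hypotheses (rE : regular_pair E x y) (qE : quotient_field_of E).
Variable t : F.
Hypothesis te : t = y / x.

Let gE : two_gen E x y. Proof. by case: rE. Qed.
Let lE : local_ring E. Proof. by case: gE. Qed.
Let aE : acc E. Proof. by case: gE. Qed.
Let sE : is_subring E := proj1 lE.
Let mx : max_ideal E x. Proof. by case: gE. Qed.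
Let my : max_ideal E y. Proof. by case: gE. Qed.
Let Ex : E x := max_sub mx.
Let Ey : E y := max_sub my.
Let x0 : x != 0. Proof. by case: rE. Qed.
Let xt : x * t = y := chartM rE te.
Let nt : ~ E t := chart_notin rE te.
Let nt' : ~ E t^-1.
Proof. by rewrite te invf_div; apply: (chart_notin (regular_pairC rE)). Qed.
Let ic : int_closed E := regular_int_closed rE qE.
Let mI : is_ideal E (max_ideal E) := proj2 lE.

(** By [seidenberg], [t] behaves modulo the maximal ideal like an indeterminate. *)
Lemma mover_eq P Q : polyover E P -> mover E Q -> P.[t] = Q.[t] -> mover E P.
Proof.
move=> hP hQ e; rewrite -(subrK Q P); apply: (over_idealD mI) => //.
apply: (seidenberg lE ic nt nt'); last by rewrite !hornerE e subrr.
by apply: overB => // i; apply: max_sub.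
Qed.

Lemma mover_mulx P Q : polyover E P -> polyover E Q -> P.[t] = x * Q.[t] -> mover E P.
Proof.
move=> hP hQ e; apply: (mover_eq (Q := x *: Q)) => //; last by rewrite hornerZ.
by move=> i; rewrite coefZ; apply: maxMr.
Qed.

Lemma mover_adj P : mover E P -> exists2 Q, polyover E Q & P.[t] = x * Q.[t].
Proof.
move=> hP; suff [_ [Q hQ ->] ->] : princ (adj E t) x P.[t] by exists Q.
have sA := adj_subring t sE; rewrite horner_coef.
apply: (@ideal_sum _ (adj E t) _ _ (fun i => P`_i * t ^+ i)) => [|i _].
  by apply: princ_ideal => //; apply: adj_base.
have [_ _ _ _ /(_ _ (hP i))[a [b [Ea Eb ->]]]] := gE.
exists ((a + b * t) * t ^+ i); last by rewrite -xt; ring.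
have At := adj_gen t sE.
apply: subringM => //; last exact: subringX.
by apply: subringD => //; [|apply: subringM => //]; apply: adj_base.
Qed.

(** Forms of degree [k] in [x] and [y], dehomogenized by [y = x * t]. *)
Let J k z := exists P, [/\ polyover E P, (size P <= k.+1)%N & z = x ^+ k * P.[t]].

Let J_ideal k : is_ideal E (J k).
Proof.
split.
- move=> _ [P [hP sP ->]]; rewrite (@horner_coef_wide _ k.+1) // big_distrr /=.
  apply: (@subring_sum _ E _ (fun i => x ^+ k * (P`_i * t ^+ i))) => // i; rewrite ltnS => hi.
  have -> : x ^+ k * (P`_i * t ^+ i) = P`_i * x ^+ (k - i) * y ^+ i.
    have -> : x ^+ k = x ^+ (k - i) * x ^+ i by rewrite -exprD subnK.
    by rewrite -xt exprMn; ring.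
  by apply: subringM => //; [apply: subringM => //|]; apply: subringX.
- by exists 0; rewrite size_poly0 horner0 mulr0; split=> //; apply: over0.
- move=> _ _ [P [hP sP ->]] [Q [hQ sQ ->]]; exists (P + Q); split.
  + exact: overD.
  + by rewrite (leq_trans (size_polyD _ _)) // geq_max sP.
  + by rewrite hornerD mulrDr.
- move=> r _ Er [P [hP sP ->]]; exists (r *: P); split.
  + exact: overZ.
  + exact: leq_trans (size_scale_leq _ _) sP.
  + by rewrite hornerZ; ring.
Qed.

Lemma mpowE k z : mpow E k z <->
  exists P, [/\ polyover E P, (size P <= k.+1)%N & z = x ^+ k * P.[t]].
Proof.
elim: k z => [|k IH] z /=.
  split=> [Ez|[P [hP sP ->]]].
    by exists z%:P; rewrite hornerC expr0 mul1r size_polyC; split=> //; [apply: overC|case: eqP].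
  rewrite expr0 mul1r (size1_polyC sP) hornerC; exact: hP.
split=> [h|[P [hP sP ->]] I iI hI].
  apply: (h (J k.+1) (J_ideal k.+1)) => a b ma /IH[P [hP sP ->]].
  have [_ _ _ _ /(_ _ ma)[c [d [Ec Ed ->]]]] := gE.
  exists ((d *: 'X + c%:P) * P); split.
  - by apply: overM => //; apply: overD => //; [apply: overZ => //; apply: overX|apply: overC].
  - apply: leq_trans (size_polyMleq _ _) _.
    have : (size (d *: 'X + c%:P)%R <= 2)%N.
      rewrite (leq_trans (size_polyD _ _)) // geq_max size_polyC.
      rewrite (leq_trans (size_scale_leq _ _)) ?size_polyX //; by case: eqP.
    by lia.
  - by rewrite hornerM hornerD hornerZ hornerX hornerC -xt exprS; ring.
rewrite (@horner_coef_wide _ k.+2) // big_distrr /=.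
apply: (@ideal_sum _ E I _ (fun i => x ^+ k.+1 * (P`_i * t ^+ i))) => // i hi.
have term j : (j <= k)%N -> mpow E k (x ^+ k * (P`_i * t ^+ j)).
  move=> hj; apply/IH; exists (P`_i *: 'X^j); split; last by rewrite hornerZ hornerXn.
    by apply: overZ => //; apply: overXn.
  by rewrite (leq_trans (size_scale_leq _ _)) // size_polyXn ltnS.
have [ik|ki] := leqP i k.
  by rewrite exprS -mulrA; apply: hI => //; apply: term.
have {hi ki} -> : x ^+ k.+1 * (P`_i * t ^+ i) = y * (x ^+ k * (P`_i * t ^+ k)).
  by have -> : i = k.+1 by [lia]; rewrite -xt !exprS; ring.
by apply: hI => //; apply: term.
Qed.

Lemma mpow_ideal k : is_ideal E (mpow E k).
Proof. by have -> : mpow E k = J k by apply/predeqP => z; exact: mpowE. Qed.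

Lemma mpowS k : sub (mpow E k.+1) (mpow E k).
Proof.
move=> z /(_ _ (mpow_ideal k)); apply => a b ma hb.
by apply: (idealMl (mpow_ideal k)) => //; apply: max_sub.
Qed.

Lemma mpow_le k l : (l <= k)%N -> sub (mpow E k) (mpow E l).
Proof.
elim: k => [|k IH]; first by rewrite leqn0 => /eqP->.
by rewrite leq_eqVlt => /orP[/eqP->//|/IH h z /mpowS]; apply: h.
Qed.

(** The reduction of [P] is the initial form of [x ^ k * P.[t]]. *)
Lemma mpow_lead k P : polyover E P -> (size P <= k.+1)%N ->
  mpow E k.+1 (x ^+ k * P.[t]) <-> mover E P.
Proof.
move=> hP sP; split=> [/mpowE[Q [hQ sQ]]|mP].
  rewrite exprSr -mulrA => /(mulfI (expf_neq0 k x0)); exact: mover_mulx.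
rewrite (@horner_coef_wide _ k.+1) // big_distrr /=.
apply: (@ideal_sum _ E (mpow E k.+1) _ (fun i => x ^+ k * (P`_i * t ^+ i))) => [|i hi I iI hI].
  exact: mpow_ideal.
rewrite mulrCA; apply: hI => //; apply/mpowE; exists 'X^i; split; rewrite ?hornerXn //.
  exact: overXn.
by rewrite size_polyXn.
Qed.

(** The ideal [g E] is closed in the adic topology: the power of exponent [n + k] lies in
    [(x ^ n, y ^ k)], and Krull's theorem is used along [y] for each fixed [n], then along [x]. *)
Lemma krull_mpow g f : E g -> (forall n, exists2 e, E e & mpow E n (f - g * e)) -> princ E g f.
Proof.
move=> Eg h; apply: (krull lE aE (princ_ideal sE Eg) mx) => n.
have iK := pair_ideal sE Eg (subringX n sE Ex).
suff [a [b [Ea Eb ->]]] : pair_gen E g (x ^+ n) f by exists (g * a), b; split=> //; exists a.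
apply: (krull lE aE iK my) => k.
have [e Ee /mpowE[P [hP sP ef]]] := h (n + k)%N.
suff [a [b [Ea Eb eab]]] : pair_gen E (x ^+ n) (y ^+ k) (f - g * e).
  exists (g * e + x ^+ n * a), b; split=> //; first by exists e, a.
  by rewrite -addrA -eab; ring.
have iK2 := pair_ideal sE (subringX n sE Ex) (subringX k sE Ey).
rewrite ef (@horner_coef_wide _ (n + k).+1) // big_distrr /=.
apply: (@ideal_sum _ E (pair_gen E (x ^+ n) (y ^+ k)) _ (fun i => x ^+ (n + k) * (P`_i * t ^+ i))) => // i hi.
have -> : x ^+ (n + k) * (P`_i * t ^+ i) = P`_i * x ^+ (n + k - i) * y ^+ i.
  have -> : x ^+ (n + k) = x ^+ (n + k - i) * x ^+ i by rewrite -exprD subnK.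
  by rewrite -xt exprMn; ring.
have [ki|ik] := leqP k i.
  exists 0, (P`_i * x ^+ (n + k - i) * y ^+ (i - k)); split; first exact: subring0.
    by apply: subringM; [|apply: subringM|]; rewrite //; apply: subringX.
  have -> : y ^+ i = y ^+ (i - k) * y ^+ k by rewrite -exprD subnK.
  by ring.
exists (P`_i * x ^+ (k - i) * y ^+ i), 0; split; last 2 first.
- exact: subring0.
- by have -> : (n + k - i = n + (k - i))%N by [lia]; rewrite exprD; ring.
by apply: subringM; [|apply: subringM|]; rewrite //; apply: subringX.
Qed.

Lemma order_exists a : E a -> a != 0 ->
  exists p P, [/\ polyover E P, (size P <= p.+1)%N, ~ mover E P & a = x ^+ p * P.[t]].
Proof.
move=> Ea a0; apply: contrapT => nh; case/eqP: a0.
suff [b _ ->] : princ E 0 a by rewrite mul0r.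
apply: krull_mpow => [|n]; first exact: subring0.
exists 0; first exact: subring0.
rewrite mul0r subr0; elim: n => [//|n /mpowE[P [hP sP ea]]].
rewrite ea; apply/mpow_lead => //; apply: contrapT => nP; apply: nh.
by exists n, P.
Qed.

Lemma chart_rep z : z != 0 -> exists p q A B,
  [/\ polyover E A, polyover E B, ~ mover E A, ~ mover E B & z * (x ^+ q * B.[t]) = x ^+ p * A.[t]].
Proof.
move=> z0; have [a [b [Ea Eb b0 ez]]] := qE z.
have a0 : a != 0 by apply: contra_neq z0 => e; rewrite ez e mul0r.
have [p [A [hA _ nA eA]]] := order_exists Ea a0.
have [q [B [hB _ nB eB]]] := order_exists Eb b0.
by exists p, q, A, B; split=> //; rewrite -eA -eB ez divfK.
Qed.

(* [z] lies in [x ^+ n] times the valuation ring of the order valuation of [E]. *)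
Definition ord_ge n z :=
  exists A B, [/\ polyover E A, polyover E B, ~ mover E B & z * B.[t] = x ^+ n * A.[t]].

Lemma ord_geM n k z w : ord_ge n z -> ord_ge k w -> ord_ge (n + k) (z * w).
Proof.
move=> [A [B [hA hB nB e]]] [A' [B' [hA' hB' nB' e']]].
exists (A * A'), (B * B'); split; [exact: overM|exact: overM|by move/(moverM lE)=> -[]|].
by rewrite !hornerM exprD mulrACA e e'; ring.
Qed.

Lemma ord_geD n z w : ord_ge n z -> ord_ge n w -> ord_ge n (z + w).
Proof.
move=> [A [B [hA hB nB e]]] [A' [B' [hA' hB' nB' e']]].
exists (A * B' + A' * B), (B * B'); split.
- by apply: overD => //; apply: overM.
- exact: overM.
- by move/(moverM lE)=> -[].
- have -> : (z + w) * (B * B').[t] = z * B.[t] * B'.[t] + w * B'.[t] * B.[t].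
    by rewrite hornerM; ring.
  by rewrite e e' hornerD !hornerM; ring.
Qed.

Lemma ord_geN n z : ord_ge n z -> ord_ge n (- z).
Proof.
move=> [A [B [hA hB nB e]]]; exists (- A), B; split=> //; first exact: overN.
by rewrite mulNr e hornerN mulrN.
Qed.

Lemma ord_ge_adj n P : polyover E P -> ord_ge n (x ^+ n * P.[t]).
Proof.
move=> hP; exists P, 1; split=> //; first exact: over1.
  by move=> /(_ 0%N); rewrite coefC eqxx; apply: max1N.
by rewrite hornerC mulr1.
Qed.

Lemma ord_ge_mpow n z : E z -> ord_ge n z -> mpow E n z.
Proof.
move=> Ez [A [B [hA hB nB e]]].
have [->|z0] := eqVneq z 0; first exact: (ideal0 (mpow_ideal n)).
have [p [P [hP sP nP ez]]] := order_exists Ez z0.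
have [np|pn] := leqP n p; first by apply: mpow_le np _ _; apply/mpowE; exists P.
case: (moverM lE hP hB) => //.
apply: (mover_mulx (Q := x ^+ (n - p).-1 *: A)); first exact: overM.
  by apply: overZ => //; apply: subringX.
apply: (mulfI (expf_neq0 p x0)); rewrite hornerM mulrA -ez e hornerZ !mulrA -exprSr -exprD.
by congr (_ ^+ _ * _); lia.
Qed.

Lemma ord_ge_sep z : z != 0 -> exists n, ~ ord_ge n z.
Proof.
move=> /chart_rep[p [q [A [B [hA hB nA nB e]]]]]; exists p.+1 => -[A' [B' [hA' hB' nB' e']]].
case: (moverM lE hA hB') => //.
apply: (mover_mulx (Q := x ^+ q *: (A' * B))); first exact: overM.
  by apply: overZ; [|apply: subringX|apply: overM].
apply: (mulfI (expf_neq0 p x0)); rewrite hornerM mulrA -e.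
have -> : z * (x ^+ q * B.[t]) * B'.[t] = (z * B'.[t]) * (x ^+ q * B.[t]) by ring.
by rewrite e' hornerZ hornerM exprSr; ring.
Qed.

(** The condition on [z * B.[t] = A.[t]] covers two situations: [R] contains neither [t] nor its
    inverse, or the residue of [t] in [R] is transcendental over that of [E]. If [z = x ^ (p - q) *
    A.[t] / B.[t]] had [p < q], the nonunit [z * x ^ (q - p)] would violate it. *)
Lemma ord_ge_dom R : local_ring R -> (forall a, max_ideal E a -> max_ideal R a) ->
  (forall z A B, max_ideal R z -> polyover E A -> polyover E B -> z * B.[t] = A.[t] -> mover E A) ->
  (forall z, R z -> ord_ge 0 z) /\ (forall z, max_ideal R z -> ord_ge 1 z).
Proof.
move=> lR dom H; have sR := proj1 lR; have Rx := dom _ mx.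
have ge0 n : ord_ge n 0.
  have := @ord_ge_adj n 0 (over0 sE); by rewrite horner0 mulr0.
have step z p q A B : R z -> polyover E A -> polyover E B -> ~ mover E A ->
    z * (x ^+ q * B.[t]) = x ^+ p * A.[t] -> (q <= p)%N.
  move=> Rz hA hB nA e; rewrite leqNgt; apply/negP => pq; apply: nA.
  apply: (H (z * x ^+ (q - p)) A B) => //.
    apply: maxMl => //; rewrite -(subnSK pq) exprS; apply: maxMr => //.
    by apply: subringX => //; apply: max_sub.
  apply: (mulfI (expf_neq0 p x0)); rewrite -e.
  have -> : x ^+ q = x ^+ (q - p) * x ^+ p by rewrite -exprD subnK // ltnW.
  by ring.
split=> z hz.
  have [->//|z0] := eqVneq z 0.
  have [p [q [A [B [hA hB nA nB e]]]]] := chart_rep z0.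
  have qp := step _ _ _ _ _ hz hA hB nA e.
  exists (x ^+ (p - q) *: A), B; split=> //; first by apply: overZ => //; apply: subringX.
  apply: (mulfI (expf_neq0 q x0)).
  rewrite mulrCA e hornerZ expr0 mul1r mulrA -exprD; congr (_ ^+ _ * _); lia.
have [->//|z0] := eqVneq z 0.
have [p [q [A [B [hA hB nA nB e]]]]] := chart_rep z0.
have := step _ _ _ _ _ (max_sub hz) hA hB nA e; rewrite leq_eqVlt => /orP[/eqP qp|qp].
  case: nA; apply: (H z A B) => //.
  by apply: (mulfI (expf_neq0 p x0)); rewrite -e qp; ring.
exists (x ^+ (p - q).-1 *: A), B; split=> //; first by apply: overZ => //; apply: subringX.
apply: (mulfI (expf_neq0 q x0)).
by rewrite mulrCA e hornerZ !mulrA -exprSr -exprD; congr (_ ^+ _ * _); lia.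
Qed.
End Order.

(** * Factorization of birational extensions *)

Section Dominate.
Variable F : fieldType.

Lemma sub_antisym (A B : F -> Prop) : sub A B -> sub B A -> A = B.
Proof. by move=> h1 h2; apply/predeqP => z; split; auto. Qed.

(* [dominates E R]: the local ring [R] dominates [E]. *)
Definition dominates (E R : F -> Prop) := sub E R /\ forall a, max_ideal E a -> max_ideal R a.

Lemma dominates_max E R a : local_ring E -> dominates E R -> E a -> max_ideal R a -> max_ideal E a.
Proof.
move=> lE [sub _] Ea [_ nu]; split=> // -[a0 Ea1 Ea']; apply: nu; split=> //; exact: sub.
Qed.

Lemma dominates_mover E R P : local_ring E -> dominates E R -> polyover E P -> mover R P -> mover E P.
Proof. by move=> lE d hP mP i; apply: (dominates_max lE d). Qed.

Lemma quotient_field_sub (E R : F -> Prop) : sub E R -> quotient_field_of E -> quotient_field_of R.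
Proof. by move=> s q z; have [a [b [? ? ? ?]]] := q z; exists a, b; split; auto. Qed.
End Dominate.

Section Factorization.
Variable F : fieldType.
Implicit Types (I : F -> Prop) (a b c z w s : F) (P Q A B : {poly F}).
Variables (E R : F -> Prop) (x y t X Y : F).
Hypotheses (rE : regular_pair E x y) (qE : quotient_field_of E) (te : t = y / x).
Hypotheses (rR : regular_pair R X Y) (dER : dominates E R).
Hypotheses (nt : ~ R t) (nt' : ~ R t^-1).

Let gE : two_gen E x y. Proof. by case: rE. Qed.
Let lE : local_ring E. Proof. by case: gE. Qed.
Let sE : is_subring E := proj1 lE.
Let mx : max_ideal E x. Proof. by case: gE. Qed.
Let my : max_ideal E y. Proof. by case: gE. Qed.
Let Ex : E x := max_sub mx.
Let Ey : E y := max_sub my.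
Let x0 : x != 0. Proof. by case: rE. Qed.
Let xt : x * t = y := chartM rE te.
Let gR : two_gen R X Y. Proof. by case: rR. Qed.
Let lR : local_ring R. Proof. by case: gR. Qed.
Let sR : is_subring R := proj1 lR.
Let mR : is_ideal R (max_ideal R) := proj2 lR.
Let sER : sub E R. Proof. by case: dER. Qed.
Let mER a : max_ideal E a -> max_ideal R a. Proof. by case: dER => _; apply. Qed.
Let ic : int_closed R := regular_int_closed rR (quotient_field_sub sER qE).
Let Rx : R x := sER Ex.
Let Ry : R y := sER Ey.
Let ordge := ord_ge E x t.

Let ordge_R : (forall z, R z -> ordge 0%N z) /\ (forall z, max_ideal R z -> ordge 1%N z).
Proof.
apply: (ord_ge_dom rE) => // z A B mz hA hB e.
apply: (dominates_mover lE dER) => //.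
rewrite -(subrK (z *: B) A); apply: (over_idealD mR).
  apply: (seidenberg lR ic nt nt'); last by rewrite hornerD hornerN hornerZ e subrr.
  by apply: overB => //; [|apply: overZ => //; first exact: max_sub]; apply: (over_sub sER).
by move=> i; rewrite coefZ; apply: maxMr => //; apply: sER.
Qed.

(** The polynomial [z *: B - A] vanishes at [t], so by [seidenberg] over [R] its coefficients are
    nonunits; dividing at a unit coefficient of [B] gives the residue of [z]. *)
Let residue z : R z -> exists2 e, E e & max_ideal R (z - e).
Proof.
move=> Rz; have [A [B [hA hB nB e]]] := proj1 ordge_R z Rz.
have m : mover R (z *: B - A).
  apply: (seidenberg lR ic nt nt').
    by apply: overB => //; [apply: overZ => //|]; apply: (over_sub sER).
  by rewrite hornerD hornerN hornerZ e expr0 mul1r subrr.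
have [i /(max_unit (hB i))[b0 EB EB']] : exists i, ~ max_ideal E B`_i by apply/existsNP.
exists (A`_i * (B`_i)^-1); first exact: subringM.
have := m i; rewrite coefD coefN coefZ => mi.
have -> : z - A`_i / B`_i = (B`_i)^-1 * (z * B`_i - A`_i) by field.
by apply: maxMl => //; apply: sER.
Qed.

Let ordge_mul a b : max_ideal R a -> max_ideal R b -> ordge 2%N (a * b).
Proof. by move=> ma mb; apply: (ord_geM rE (n := 1%N) (k := 1%N)); apply: (proj2 ordge_R). Qed.

(** Replacing [a] and [b] by elements [e] and [f] of [E] with the same residues changes [a x + b y]
    by order at least two; the linear form [e + f t] must then vanish modulo the maximal ideal of
    [E]. *)
Let lin_indep a b : R a -> R b -> ordge 2%N (a * x + b * y) -> max_ideal R a /\ max_ideal R b.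
Proof.
move=> Ra Rb h; have [e Ee me] := residue Ra; have [f Ef mf] := residue Rb.
have : ordge 2%N (e * x + f * y).
  have -> : e * x + f * y = (a * x + b * y) - ((a - e) * x + (b - f) * y) by ring.
  apply: (ord_geD rE) => //; apply: (ord_geN rE).
  by apply: (ord_geD rE); apply: ordge_mul => //; apply: mER.
move=> [A [B [hA hB nB eq]]].
have hL : polyover E (f *: 'X + e%:P).
  by apply: overD => //; [apply: overZ => //; apply: overX|apply: overC].
have [L|//] : mover E (f *: 'X + e%:P) \/ mover E B.
  apply: moverM => //; apply: (mover_mulx rE qE te (Q := A)) => //; first exact: overM.
  apply: (mulfI x0); rewrite mulrA -expr2 -eq hornerM hornerD hornerZ hornerX hornerC -xt.
  by ring.
have := L 0%N; have := L 1%N; rewrite !coefD !coefZ !coefX !coefC /= mulr1 addr0 mulr0 add0r.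
by move=> /mER mf' /mER me'; split; [rewrite -(subrK e a)|rewrite -(subrK f b)]; apply: maxD.
Qed.

(* With [(x, y) = M (X, Y)], a nonunit determinant of [M] would make the rows of the adjugate
   relations of order at least two, hence all entries of [M] nonunits, hence [x] of order two. *)
Let max_gen z : max_ideal R z -> exists a b, [/\ R a, R b & z = a * x + b * y].
Proof.
have [_ _ mX mY genR] := gR.
have [a [b [Ra Rb exy]]] := genR _ (mER mx); have [c [d [Rc Rd eyy]]] := genR _ (mER my).
have Rdet : R (a * d - b * c) by apply: subringB => //; apply: subringM.
have [md|/(max_unit Rdet)[d0 _ Rd']] := EM (max_ideal R (a * d - b * c)).
  have [ma mb] : max_ideal R a /\ max_ideal R b.
    have [mc ma] : max_ideal R (- c) /\ max_ideal R a.
      apply: lin_indep => //; first exact: subringN.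
      have -> : - c * x + a * y = (a * d - b * c) * Y by rewrite exy eyy; ring.
      exact: ordge_mul.
    split=> //; have [md' mb] : max_ideal R d /\ max_ideal R (- b).
      apply: lin_indep => //; first exact: subringN.
      have -> : d * x + - b * y = (a * d - b * c) * X by rewrite exy eyy; ring.
      exact: ordge_mul.
    by rewrite -(opprK b); apply: maxN.
  have [/max1N] : max_ideal R 1 /\ max_ideal R 0; last by [].
  apply: lin_indep; [exact: subring1|exact: subring0|].
  by rewrite mul1r mul0r addr0 exy; apply: (ord_geD rE); apply: ordge_mul.
move=> /genR[e [f [Re Rf ->]]].
exists ((e * d - f * c) * (a * d - b * c)^-1), ((f * a - e * b) * (a * d - b * c)^-1); split.
- by apply: subringM => //; apply: subringB => //; apply: subringM.
- by apply: subringM => //; apply: subringB => //; apply: subringM.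
- by rewrite exy eyy; field.
Qed.

(** The residue fields of [E] and [R] agree and [x], [y] generate the maximal ideal of [R], so the
    error can be pushed into forms of any degree in [x] and [y]. *)
Let approx z n : R z ->
  exists2 e, E e & exists P, [/\ polyover R P, (size P <= n.+1)%N & z - e = x ^+ n * P.[t]].
Proof.
move=> Rz; elim: n => [|n [e Ee [P [hP sP ez]]]].
  exists 0; first exact: subring0.
  exists z%:P; rewrite hornerC subr0 expr0 mul1r size_polyC; split=> //; first exact: overC.
  by case: eqP.
pose G w := exists2 e, E e &
  exists P, [/\ polyover R P, (size P <= n.+2)%N & w - e = x ^+ n.+1 * P.[t]].
suff [f Ef hf] : G (z - e).
  by exists (e + f); [exact: subringD|rewrite opprD addrA].
rewrite ez (@horner_coef_wide _ n.+1) // big_distrr /=.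
apply: big_ind => [|u v|i _].
- exists 0; first exact: subring0.
  exists 0; rewrite horner0 mulr0 subrr size_poly0; split=> //; exact: over0.
- move=> [e1 Ee1 [P1 [hP1 sP1 ew]]] [e2 Ee2 [P2 [hP2 sP2 ew2]]].
  exists (e1 + e2); first exact: subringD.
  exists (P1 + P2); split; first exact: overD.
    by rewrite (leq_trans (size_polyD _ _)) // geq_max sP1.
  by rewrite hornerD mulrDr -ew -ew2 opprD addrACA.
have [f Ef mf] := residue (hP i); have [a [b [Ra Rb eab]]] := max_gen mf.
have hi : (i <= n)%N by rewrite -ltnS ltn_ord.
(* The coefficient is [f + a x + b y]: the part [f] joins the approximation, the rest raises the
   degree of the form by one. *)
exists (f * x ^+ (n - i) * y ^+ i).
  by apply: subringM => //; [apply: subringM => //|]; apply: subringX.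
exists ((b *: 'X + a%:P) * 'X^i); split.
- apply: overM => //; last exact: overXn.
  by apply: overD => //; [apply: overZ => //; apply: overX|apply: overC].
- apply: leq_trans (size_polyMleq _ _) _; rewrite size_polyXn.
  have : (size (b *: 'X + a%:P)%R <= 2)%N.
    rewrite (leq_trans (size_polyD _ _)) // geq_max size_polyC.
    rewrite (leq_trans (size_scale_leq _ _)) ?size_polyX //; by case: eqP.
  by move: hi; lia.
- rewrite hornerM hornerD hornerZ hornerX hornerC hornerXn.
  have -> : P`_i = f + (a * x + b * y) by rewrite -eab addrC subrK.
  have -> : x ^+ n.+1 = x * x ^+ n by rewrite exprS.
  have -> : x ^+ n = x ^+ (n - i) * x ^+ i by rewrite -exprD subnK.
  by rewrite -xt exprMn; ring.
Qed.

(** With [z = f / g], every approximation [e] of [z] makes [f - g e] an element of [E] of high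
    order, so [krull_mpow] yields that [g] divides [f] already in [E]. *)
Lemma factorization_eq : sub R E.
Proof.
move=> z Rz; have [f [g [Ef Eg g0 ez]]] := qE z.
suff [e Ee ef] : princ E g f by rewrite ez ef mulrC mulKf.
apply: (krull_mpow rE te) => // n; have [e Ee [P [hP sP ee]]] := approx n Rz.
exists e => //; apply: (ord_ge_mpow rE qE te).
  by apply: subringB => //; apply: subringM.
have -> : f - g * e = g * (z - e) by rewrite ez; field.
rewrite -[n]add0n; apply: (ord_geM rE); first by apply: (proj1 ordge_R); apply: sER.
rewrite ee horner_coef big_distrr /=; apply: big_ind => [|u v|i _].
- by have := ord_ge_adj rE t n (over0 sE); rewrite horner0 mulr0.
- exact: (ord_geD rE).
- rewrite mulrCA -[n]add0n; apply: (ord_geM rE); first by apply: (proj1 ordge_R).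
  by rewrite -(hornerXn t i); apply: (ord_ge_adj rE); apply: overXn.
Qed.
End Factorization.

(** * Quadratic transforms *)

Section Hilbert.
Variable F : fieldType.
Implicit Types (I R E : F -> Prop) (a b c z w s t : F) (P Q A B : {poly F}).

(** Hilbert's basis argument for chains, through the ideals [L n d] of leading coefficients. *)
Lemma acc_adj R t : is_subring R -> acc R -> acc (adj R t).
Proof.
move=> sR aR I iI mI; have sA := adj_subring t sR; have At := adj_gen t sR.
have mono := chain_le mI.
pose L n d c := exists P, [/\ polyover R P, (size P <= d.+1)%N, P`_d = c & I n P.[t]].
have iL n d : is_ideal R (L n d).
  split.
  - by move=> _ [P [hP _ <- _]]; apply: hP.
  - exists 0; rewrite size_poly0 coef0 horner0; split=> //; [exact: over0|exact: (ideal0 (iI n))].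
  - move=> _ _ [P [hP sP <- iP]] [Q [hQ sQ <- iQ]]; exists (P + Q); split.
    + exact: overD.
    + by rewrite (leq_trans (size_polyD _ _)) // geq_max sP.
    + by rewrite coefD.
    + by rewrite hornerD; apply: (idealD (iI n)).
  - move=> r _ Rr [P [hP sP <- iP]]; exists (r *: P); split.
    + exact: overZ.
    + exact: leq_trans (size_scale_leq _ _) sP.
    + by rewrite coefZ.
    + by rewrite hornerZ; apply: (idealMl (iI n)) => //; apply: adj_base.
have mLn d m n : (m <= n)%N -> sub (L m d) (L n d).
  by move=> mn c [P [hP sP eP iP]]; exists P; split=> //; apply: mono mn _ iP.
have mLd n : forall d e, (d <= e)%N -> sub (L n d) (L n e).
  apply: chain_le => d _ [P [hP sP <- iP]]; exists (P * 'X); split.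
  - by apply: overM => //; apply: overX.
  - by apply: leq_trans (size_polyMleq _ _) _; rewrite size_polyX addnC.
  - by rewrite coefMX.
  - by rewrite hornerM hornerX; apply: (idealMr (iI n)).
(* The diagonal chain settles all degrees from [N] on at once; the finitely many smaller degrees are
   settled one by one by [f]. *)
have [|N hN] := aR (fun k => L k k) (fun k => iL k k).
  by move=> k c /(mLn _ _ _ (leqnSn k)); apply: mLd.
have /choice[f hf] : forall d, exists M, forall n, (M <= n)%N -> sub (L n d) (L M d).
  by move=> d; apply: aR => // n; apply: mLn.
pose M := maxn N (\max_(d < N) f d).
have hM n d : sub (L n d) (L M d).
  have [dN|Nd] := ltnP d N.
    move=> c /(mLn _ _ _ (leq_maxl n (f d))) /hf h; apply: mLn (h (leq_maxr _ _)).
    rewrite /M leq_max; apply/orP; right.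
    exact: (leq_bigmax (F := fun d : 'I_N => f d) (Ordinal dN)).
  move=> c /(mLn _ _ _ (leq_maxl n d)) /(mLd _ _ _ (leq_maxr n d)) /hN h.
  apply: (mLd _ _ _ Nd); apply: (mLn _ _ _ (leq_maxl _ _)); apply: h.
  by rewrite leq_max Nd orbT.
exists M => n Mn _ /[dup] /(ideal_sub (iI n))[P hP ->].
have [k] := ubnP (size P); elim: k P hP => // k IH P hP sP iP.
have [->|P0] := eqVneq P 0; first by rewrite horner0; apply: (ideal0 (iI M)).
have sP0 : (0 < size P)%N by rewrite size_poly_gt0.
have [Q [hQ sQ eQ iQ]] : L M (size P).-1 P`_(size P).-1.
  by apply: (hM n); exists P; split=> //; rewrite prednK.
rewrite -(subrK Q P) hornerD; apply: (idealD (iI M)) => //; apply: IH.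
- exact: overB.
- apply: (@leq_ltn_trans (size P).-1); last by lia.
  apply/leq_sizeP => j; rewrite leq_eqVlt coefB => /orP[/eqP<-|hj]; first by rewrite eQ subrr.
  have Pj : (size P <= j)%N by rewrite -(prednK sP0).
  by rewrite !nth_default ?subrr // (leq_trans sQ) // prednK.
- rewrite hornerD hornerN; apply: (idealB sA (iI n)) => //.
  exact: mono Mn _ iQ.
Qed.

Lemma monic_div E g P : is_subring E -> polyover E g -> g \is monic -> polyover E P ->
  exists Q S, [/\ polyover E Q, polyover E S, P = Q * g + S,
    (size S < size g)%N & (size Q <= size P - (size g).-1)%N].
Proof.
move=> sE hg mg; have sg : (0 < size g)%N by rewrite size_poly_gt0 monic_neq0.
have [k] := ubnP (size P); elim: k P => // k IH P sP hP.
have [Pg|gP] := ltnP (size P) (size g).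
  by exists 0, P; rewrite mul0r add0r size_poly0; split=> //; apply: over0.
set c := lead_coef P; set j := (size P - size g)%N.
have hc : E c by apply: hP.
have hT : polyover E (c *: 'X^j) by apply: overZ => //; apply: overXn.
have P0 : P != 0 by rewrite -size_poly_gt0; lia.
have sT : size (c *: 'X^j) = j.+1 by rewrite size_scale ?size_polyXn // lead_coef_eq0.
have sTg : size (c *: 'X^j * g) = size P.
  by rewrite size_Mmonic // ?sT -?size_poly_gt0 ?sT // /j; lia.
have lt : (size (P - c *: 'X^j * g)%R < size P)%N.
  apply: (@leq_ltn_trans (size P).-1); last by lia.
  apply/leq_sizeP => i; rewrite leq_eqVlt coefB => /orP[/eqP<-|hi].
    have -> : (c *: 'X^j * g)`_(size P).-1 = c.
      by rewrite -sTg -lead_coefE lead_coef_Mmonic // lead_coefZ lead_coefXn mulr1.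
    by rewrite -lead_coefE subrr.
  have Pi : (size P <= i)%N by lia.
  by rewrite !nth_default ?subrr // sTg.
have [||Q [S [hQ hS e sS sQ]]] := IH (P - c *: 'X^j * g); first by lia.
  by apply: overB => //; apply: overM.
exists (Q + c *: 'X^j), S; split=> //; first exact: overD.
  by rewrite mulrDl addrAC -e subrK.
rewrite (leq_trans (size_polyD _ _)) // geq_max sT; apply/andP; split; last by rewrite /j; lia.
by apply: leq_trans sQ _; lia.
Qed.

(* The localization of [E[t]] at the center of [R]. *)
Definition locq (E : F -> Prop) t (R : F -> Prop) z :=
  exists A B, [/\ polyover E A, polyover E B, unit_in R B.[t] & z = A.[t] / B.[t]].
End Hilbert.

Section Transform.
Variable F : fieldType.
Implicit Types (I : F -> Prop) (a b c z w s : F) (P Q A B : {poly F}).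
Variables (E R : F -> Prop) (x y t : F).
Hypotheses (rE : regular_pair E x y) (qE : quotient_field_of E) (te : t = y / x).
Hypotheses (lR : local_ring R) (dER : dominates E R) (Rt : R t).

Let gE : two_gen E x y. Proof. by case: rE. Qed.
Let lE : local_ring E. Proof. by case: gE. Qed.
Let aE : acc E. Proof. by case: gE. Qed.
Let sE : is_subring E := proj1 lE.
Let mx : max_ideal E x. Proof. by case: gE. Qed.
Let Ex : E x := max_sub mx.
Let x0 : x != 0. Proof. by case: rE. Qed.
Let sR : is_subring R := proj1 lR.
Let sER : sub E R. Proof. by case: dER. Qed.
Let mER a : max_ideal E a -> max_ideal R a. Proof. by case: dER => _; apply. Qed.

Let u1 : unit_in R (1 : {poly F}).[t].
Proof. by rewrite hornerC; split; rewrite ?oner_eq0 ?invr1 //; apply: subring1. Qed.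

Lemma horner_sub P : polyover E P -> R P.[t].
Proof. by move=> hP; apply: over_horner => //; apply: (over_sub sER). Qed.

Lemma mover_max P : mover E P -> max_ideal R P.[t].
Proof.
move=> mP; have [Q hQ ->] := mover_adj rE te mP.
by apply: maxMr => //; [exact: mER|exact: horner_sub].
Qed.

Lemma locq_sub : sub (locq E t R) R.
Proof. by move=> _ [A [B [hA hB [_ _ Rb] ->]]]; apply: subringM => //; apply: horner_sub. Qed.

Lemma locq_adj P : polyover E P -> locq E t R P.[t].
Proof. by move=> hP; exists P, 1; split=> //; [exact: over1|rewrite hornerC divr1]. Qed.

Lemma locq_base : sub E (locq E t R).
Proof. by move=> c Ec; rewrite -(hornerC c t); apply: locq_adj; apply: overC. Qed.

Lemma locq_unit P : polyover E P -> unit_in R P.[t] -> locq E t R (P.[t])^-1.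
Proof. by move=> hP u; exists 1, P; split=> //; [exact: over1|rewrite hornerC div1r]. Qed.

Lemma locq_subring : is_subring (locq E t R).
Proof.
split.
- by apply: locq_base; apply: subring1.
- move=> _ _ [A [B [hA hB uB ->]]] [A' [B' [hA' hB' uB' ->]]].
  exists (A * B' - A' * B), (B * B'); split.
  + by apply: overB => //; apply: overM.
  + exact: overM.
  + by rewrite hornerM; apply: (unitM lR).
  + rewrite hornerD hornerN !hornerM; have [b0 _ _] := uB; have [b0' _ _] := uB'; field.
    by rewrite ?b0 ?b0'.
- move=> _ _ [A [B [hA hB uB ->]]] [A' [B' [hA' hB' uB' ->]]].
  exists (A * A'), (B * B'); split; [exact: overM|exact: overM| |].
  + by rewrite hornerM; apply: (unitM lR).
  + by rewrite !hornerM invfM; ring.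
Qed.

Lemma locq_max z : max_ideal (locq E t R) z <-> locq E t R z /\ max_ideal R z.
Proof.
split=> [[lz nz]|[lz [_ nz]]]; split=> //; last first.
  by case=> z0 _ lz'; apply: nz; split=> //; apply: locq_sub.
split; first exact: locq_sub.
move=> uz; apply: nz; case: (lz) => A [B [hA hB uB ez]].
have [z0 _ _] := uz; split=> //.
have eA : A.[t] = z * B.[t] by rewrite ez divfK //; case: uB.
exists B, A; split=> //; first by rewrite eA; apply: (unitM lR).
by rewrite ez invf_div.
Qed.

Lemma locq_local : local_ring (locq E t R).
Proof.
have sL := locq_subring; split=> //; split.
- by move=> z /locq_max[].
- by apply/locq_max; split; [exact: subring0|exact: max0].
- move=> a b /locq_max[? ?] /locq_max[? ?]; apply/locq_max.
  by split; [exact: subringD|exact: maxD].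
- move=> a b la /locq_max[? ?]; apply/locq_max; split; first exact: subringM.
  by apply: maxMl => //; apply: locq_sub.
Qed.

(** Ideals of the localization are determined by their contractions to [adj E t]. *)
Lemma locq_acc : acc (locq E t R).
Proof.
move=> I iI mI; have sL := locq_subring; have sA := adj_subring t sE.
have iA n : is_ideal (adj E t) (fun z => adj E t z /\ I n z).
  split.
  - by move=> z [].
  - by split; [exact: subring0|exact: (ideal0 (iI n))].
  - by move=> a b [? ?] [? ?]; split; [exact: subringD|exact: (idealD (iI n))].
  - move=> a b [P hP ea] [? ?]; split; first by apply: subringM => //; exists P.
    by apply: (idealMl (iI n)) => //; rewrite ea; apply: locq_adj.
have [n z [? ?]|N hN] := acc_adj sE aE iA; first by split=> //; apply: mI.
exists N => n Nn z Iz; have [A [B [hA hB uB ez]]] := ideal_sub (iI n) Iz.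
have [b0 _ _] := uB.
rewrite ez; apply: (idealMr (iI N)); last exact: locq_unit.
have [] // := hN n Nn A.[t]; split; first by exists A.
have -> : A.[t] = z * B.[t] by rewrite ez divfK.
by apply: (idealMr (iI n)) => //; apply: locq_adj.
Qed.

Lemma dominates_locq : dominates (locq E t R) R.
Proof. by split=> [|a /locq_max[]]; first exact: locq_sub. Qed.

(* [g] is a lift of the minimal polynomial of the residue of [t] in [R] over the residue field
   of [E]. *)
Definition min_monic g := [/\ polyover E g, g \is monic, (1 < size g)%N, max_ideal R g.[t] &
  forall P, polyover E P -> max_ideal R P.[t] -> (size P < size g)%N -> mover E P].

Lemma min_monicP P : polyover E P -> ~ mover E P -> max_ideal R P.[t] -> exists g, min_monic g.
Proof.
move=> hP0 nP0 mP0.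
pose C n := `[<exists P, [/\ polyover E P, ~ mover E P, max_ideal R P.[t] & (size P <= n)%N]>].
have exC : exists n, C n by exists (size P); apply/asboolP; exists P.
case: (ex_minnP exC) => n /asboolP[Q [hQ nQ mQ sQ]] nmin {P hP0 nP0 mP0 exC}.
have n0 : (0 < n)%N.
  rewrite lt0n; apply/eqP => e; apply: nQ; move: sQ; rewrite e leqn0 size_poly_eq0 => /eqP-> i.
  by rewrite coef0; apply: max0.
have low A : polyover E A -> ~ mover E A -> max_ideal R A.[t] -> (n <= size A)%N.
  by move=> hA nA mA; apply: nmin; apply/asboolP; exists A.
(* A nonunit top coefficient could be dropped, leaving a shorter polynomial of the same kind. *)
have [c0 Ec Ec'] : unit_in E Q`_n.-1.
  apply: max_unit => // mc.
  have sc : (size (Q - Q`_n.-1 *: 'X^(n.-1))%R <= n.-1)%N.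
    apply/leq_sizeP => i; rewrite leq_eqVlt coefB coefZ coefXn => /orP[/eqP<-|hi].
      by rewrite eqxx mulr1 subrr.
    have ni : (n <= i)%N by lia.
    by rewrite gtn_eqF // mulr0 subr0 nth_default // (leq_trans sQ).
  have h1 : mover E (Q`_n.-1 *: 'X^(n.-1)).
    by move=> i; rewrite coefZ; apply: maxMr => //; apply: overXn.
  suff : (n <= n.-1)%N by lia.
  apply: leq_trans sc; apply: low.
  - by apply: overB => //; apply: overZ => //; apply: overXn.
  - move=> h; apply: nQ; rewrite -(subrK (Q`_n.-1 *: 'X^(n.-1)) Q).
    exact: (over_idealD (proj2 lE)).
  - by rewrite hornerD hornerN; apply: maxB => //; apply: mover_max.
have sQn : size Q = n.
  apply/eqP; rewrite eqn_leq sQ leqNgt; apply/negP => h.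
  have h' : (size Q <= n.-1)%N by lia.
  by case/eqP: c0; rewrite nth_default.
set c := Q`_n.-1 in c0 Ec Ec'.
have hg : polyover E (c^-1 *: Q) by exact: overZ.
have sg : size (c^-1 *: Q) = n by rewrite size_scale ?invr_eq0.
have mg : (c^-1 *: Q) \is monic by rewrite monicE lead_coefZ lead_coefE sQn -/c mulVf.
have Mg : max_ideal R (c^-1 *: Q).[t] by rewrite hornerZ; apply: maxMl => //; apply: sER.
exists (c^-1 *: Q); split=> //; last first.
  by move=> A hA mA; rewrite sg => lt; apply: contrapT => nA; have := low A hA nA mA; lia.
rewrite sg ltn_neqAle n0 andbT; apply/eqP => n1.
have e1 : c^-1 *: Q = 1.
  have /size1_polyC eq : (size (c^-1 *: Q) <= 1)%N by rewrite sg -n1.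
  by move: mg; rewrite eq monicE lead_coefC => /eqP->.
by move: Mg; rewrite e1 hornerC; apply: max1N.
Qed.

Lemma min_monic_div g P : min_monic g -> polyover E P -> max_ideal R P.[t] ->
  exists Q S, [/\ polyover E Q, mover E S, P = Q * g + S & (size Q <= size P - (size g).-1)%N].
Proof.
move=> [hg mg sg Mg gmin] hP mP; have [Q [S [hQ hS e sS sQ]]] := monic_div sE hg mg hP.
exists Q, S; split=> //; apply: gmin => //.
have -> : S = P - Q * g by rewrite e addrC addKr.
by rewrite hornerD hornerN hornerM; apply: maxB => //; apply: maxMl => //; apply: horner_sub.
Qed.

Lemma monic_notmover g : g \is monic -> ~ mover E g.
Proof. by move=> /monicP mg /(_ (size g).-1); rewrite -lead_coefE mg; apply: max1N. Qed.

(** By Seidenberg's lemma [adj E t] modulo [x] is a polynomial ring over the residue field of [E],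
    in which [g] generates the center of [R]. *)
Lemma locq_regular g : min_monic g -> regular_pair (locq E t R) x g.[t].
Proof.
move=> Hg; have [hg mg sg Mg gmin] := Hg; have sL := locq_subring.
split=> //; last first.
  move=> _ [A [B [hA hB uB ->]]] [_ [A' [B' [hA' hB' uB' ->]]] e].
  have [b0 _ _] := uB; have [b0' _ _] := uB'.
  have h : mover E (g * A * B').
    apply: (mover_mulx rE qE te (Q := A' * B)); [by do ?apply: overM|exact: overM|].
    rewrite !hornerM; apply: (mulIf (mulf_neq0 (invr_neq0 b0) (invr_neq0 b0'))).
    have -> : g.[t] * A.[t] * B'.[t] * (B.[t]^-1 * B'.[t]^-1) = g.[t] * (A.[t] / B.[t]).
      by field; rewrite ?b0 ?b0'.
    by rewrite e; field; rewrite ?b0 ?b0'.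
  have hgA : polyover E (g * A) by exact: overM.
  have mA : mover E A.
    have [h1|h1] := moverM lE hgA hB' h; last by case: (unit_max uB'); apply: mover_max.
    by have [/(monic_notmover mg)|] := moverM lE hg hA h1.
  have [C hC ->] := mover_adj rE te mA.
  by exists (C.[t] / B.[t]); [exists C, B|rewrite mulrA].
split.
- exact: locq_local.
- exact: locq_acc.
- by apply/locq_max; split; [exact: locq_base|exact: mER].
- by apply/locq_max; split; [exact: locq_adj|].
- move=> _ /locq_max[[A [B [hA hB uB ->]]] m].
  have [b0 RB _] := uB.
  have mA : max_ideal R A.[t] by rewrite -(divfK b0 A.[t]); apply: maxMr.
  have [Q [S [hQ mS -> _]]] := min_monic_div Hg hA mA.
  have [C hC eC] := mover_adj rE te mS.
  exists (C.[t] / B.[t]), (Q.[t] / B.[t]); split; [by exists C, B|by exists Q, B|].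
  by rewrite hornerD hornerM eC; field.
Qed.
End Transform.

(** * Transforms along a valuation ring *)

Section Valuation.
Variable F : fieldType.
Implicit Types (I R E V : F -> Prop) (a b c x y z w s t : F) (P Q A B : {poly F}).

Lemma valuation_local V : valuation_ring V -> local_ring V.
Proof.
move=> [sV vV]; split=> //.
have mul a b : V a -> max_ideal V b -> max_ideal V (a * b).
  move=> Va [Vb nb]; split; first exact: subringM.
  move=> [ab0 _ Vab]; apply: nb; split=> //; first by apply: contra_neq ab0 => ->; rewrite mulr0.
  have b0 : b != 0 by apply: contra_neq ab0 => ->; rewrite mulr0.
  have a0 : a != 0 by apply: contra_neq ab0 => ->; rewrite mul0r.
  by have -> : b^-1 = a * (a * b)^-1 by [field; rewrite a0 b0]; apply: subringM.
split=> //; first by move=> a [].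
  by split; [exact: subring0|case; rewrite eqxx].
have add a b : b != 0 -> V (a / b) -> max_ideal V b -> max_ideal V (a + b).
  move=> b0 Vab mb; have -> : a + b = (a / b + 1) * b by field.
  by apply: mul => //; apply: subringD => //; apply: subring1.
move=> a b ma mb; have [->|b0] := eqVneq b 0; first by rewrite addr0.
have [->|a0] := eqVneq a 0; first by rewrite add0r.
case: (vV (a / b)); first by rewrite mulf_neq0 // invr_eq0.
  by move=> h; apply: add.
by rewrite invf_div addrC => h; apply: add.
Qed.

Lemma valuation_notin V z : valuation_ring V -> ~ V z -> max_ideal V z^-1.
Proof.
move=> [sV vV] nz; have z0 : z != 0 by apply: contra_not_neq nz => ->; apply: subring0.
by split; [case: (vV _ z0)|case=> _ _; rewrite invrK].
Qed.

Lemma max_mid R V a : sub R V -> R a -> max_ideal V a -> max_ideal R a.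
Proof. by move=> s Ra [_ nu]; split=> // -[a0 _ Ra']; apply: nu; split=> //; apply: s. Qed.

Lemma dominates_mid E R V : sub E R -> sub R V -> dominates E V -> dominates E R.
Proof. by move=> s1 s2 [_ m]; split=> // a ma; apply: (max_mid s2) => //; auto; apply: s1; case: ma. Qed.

Lemma regular_chart V E x y : valuation_ring V -> regular_pair E x y ->
  exists x y, regular_pair E x y /\ V (y / x).
Proof.
move=> vV rE; have [h|h] := EM (V (y / x)); first by exists x, y.
exists y, x; split; first exact: regular_pairC.
by have /max_sub := valuation_notin vV h; rewrite invf_div.
Qed.

(* The residue of [t] in [R] is transcendental over the residue field of [E]; this means that [R]
   contains the order valuation ring of [E]. *)
Definition residually_trans E t R := forall P, polyover E P -> max_ideal R P.[t] -> mover E P.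

Definition ord_type V E := exists x y, [/\ regular_pair E x y, V (y / x) &
  residually_trans E (y / x) V].

(** The center of [V] on [adj E t] is a maximal ideal, the residue of [t] being algebraic, so its
    inclusion in the center of [R] is an equality. Concretely, [g = h * g'] modulo the maximal ideal
    of [E], and [h] has too low a degree to vanish in the residue field of [V]. *)
Lemma center_max E V R x y t : regular_pair E x y -> t = y / x ->
  local_ring V -> local_ring R -> dominates E V -> dominates E R -> V t -> R t ->
  ~ residually_trans E t V -> (forall P, polyover E P -> max_ideal V P.[t] -> max_ideal R P.[t]) ->
  forall P, polyover E P -> max_ideal R P.[t] -> max_ideal V P.[t].
Proof.
move=> rE te lV lR dV dR Vt Rt ntr imp P hP mP.
have lE : local_ring E by case: rE => -[].
have [P0 [hP0 mP0 nP0]] : exists P0, [/\ polyover E P0, max_ideal V P0.[t] & ~ mover E P0].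
  apply: contrapT => nh; apply: ntr => Q hQ mQ; apply: contrapT => nQ; apply: nh.
  by exists Q.
have [g Hg] := min_monicP rE te lV dV Vt hP0 nP0 mP0; have [hg mg sg Mg gmin] := Hg.
have [g' Hg'] := min_monicP rE te lR dR Rt hP0 nP0 (imp _ hP0 mP0).
have [hg' mg' sg' Mg' _] := Hg'.
have [h [S [hh mS eg sh]]] := min_monic_div rE lR dR Rt Hg' hg (imp _ hg Mg).
have [h2 [S2 [hh2 mS2 -> _]]] := min_monic_div rE lR dR Rt Hg' hP mP.
rewrite hornerD hornerM; apply: maxD => //; last exact: (mover_max rE te).
apply: maxMl => //; first exact: (horner_sub lV dV).
have Vh : V h.[t] by exact: (horner_sub lV dV).
have : max_ideal V (h.[t] * g'.[t]).
  have -> : h.[t] * g'.[t] = g.[t] - S.[t] by rewrite eg hornerD hornerM addrK.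
  by apply: maxB => //; apply: (mover_max rE te).
case/(max_prime lV) => //; first exact: (horner_sub lV dV).
move=> mh; apply: False_ind; apply: (@monic_notmover _ E _ mg); rewrite eg.
apply: (over_idealD (proj2 lE)) => //; rewrite mulrC; apply: (over_idealM (proj2 lE)) => //; apply: gmin => //.
by apply: leq_ltn_trans sh _; lia.
Qed.

(* The immediate quadratic transform of [E] along [V], described without a choice of
   generators of the maximal ideal. *)
Definition qt V E z := forall T, is_subring T -> sub E T ->
  (forall h, max_ideal E h -> (forall c, max_ideal E c -> V (c / h)) ->
    forall c, max_ideal E c -> T (c / h)) ->
  (forall a, T a -> unit_in V a -> T a^-1) -> T z.

Lemma qtE V E x y t : valuation_ring V -> dominates E V -> regular_pair E x y -> t = y / x -> V t ->
  qt V E = locq E t V.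
Proof.
move=> vV dV rE te Vt; have lV := valuation_local vV; have [gE x0 _] := rE.
have [lE _ mx my gen] := gE; have sE := proj1 lE; have sV := proj1 lV.
have xt := chartM rE te; have sL := locq_subring t rE lV.
have Lb := locq_base t rE lV.
apply/predeqP => z; split=> [h|[A [B [hA hB uB ->]]] T sT ET minT invT].
  apply: h => //; last 2 first.
  - move=> h mh minh c mc.
    have adjx d : max_ideal E d -> exists2 P, polyover E P & d = x * P.[t].
      move=> /gen[a [b [Ea Eb ->]]]; exists (b *: 'X + a%:P).
        by apply: overD => //; [apply: overZ => //; apply: overX|apply: overC].
      by rewrite hornerD hornerZ hornerX hornerC -xt; ring.
    have [->|h0] := eqVneq h 0; first by rewrite invr0 mulr0; apply: subring0.
    have [P hP ec] := adjx c mc; have [Q hQ eh] := adjx h mh.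
    have Q0 : Q.[t] != 0 by apply: contra_neq h0 => e; rewrite eh e mulr0.
    exists P, Q; split=> //; last by rewrite ec eh; field; rewrite x0 Q0.
    split=> //; first exact: (horner_sub lV dV).
    by have := minh x mx; rewrite eh invfM mulrA divff // mul1r.
  - move=> _ [A [B [hA hB uB ->]]] u; have [b0 VB _] := uB.
    exists B, A; split=> //; last by rewrite invf_div.
    by rewrite -(divfK b0 A.[t]); apply: (unitM lV).
have Tt : T t.
  rewrite te; apply: minT => // c /gen[a [b [Ea Eb ->]]].
  have -> : (a * x + b * y) / x = a + b * t by rewrite te; field.
  by apply: subringD => //; [apply: dV.1|apply: subringM => //; apply: dV.1].
have Tp P : polyover E P -> T P.[t] by move=> hP; apply: over_horner => //; apply: (over_sub ET).
by apply: subringM; [|exact: Tp|apply: invT => //; exact: Tp].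
Qed.

Definition good R := local_ring R /\ ((exists x y, regular_pair R x y) \/ valuation_ring R).

Lemma good_chart E R x y t : regular_pair E x y -> quotient_field_of E -> t = y / x ->
  good R -> dominates E R -> ~ sub R E -> R t \/ R t^-1.
Proof.
move=> rE qE te [lR [[X [Y rR]]|[_ vR]]] d ns.
  apply: contrapT => /not_orP[h1 h2]; apply: ns.
  exact: (factorization_eq rE qE te rR).
have [gE x0 _] := rE; have [_ y0 _] := regular_pairC rE.
by apply: vR; rewrite te mulf_neq0 // invr_eq0.
Qed.

(** If [R] contains the chart coordinate [y1 / x1], then [center_max] makes the denominators of the
    transform units of [R]. If it contains only the inverse, this is a nonunit of [R], hence of [V]
    by [center_max], although [V] contains [y1 / x1]. *)
Lemma qt_sub_good V E R x y : valuation_ring V -> regular_pair E x y -> quotient_field_of E ->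
  dominates E V -> ~ ord_type V E -> good R -> sub E R -> sub R V -> ~ sub R E -> sub (qt V E) R.
Proof.
move=> vV rE0 qE dV nord gR sER sRV nRE.
have [x1 [y1 [rE Vt]]] := regular_chart vV rE0.
have lV := valuation_local vV; have lR := proj1 gR; have sR := proj1 lR.
have dR := dominates_mid sER sRV dV.
have imp c d : R (d / c) -> forall P, polyover E P ->
    max_ideal V P.[d / c] -> max_ideal R P.[d / c].
  by move=> Rt P hP; apply: (max_mid sRV); apply: (horner_sub lR dR).
have [Rt|nRt] := EM (R (y1 / x1)).
  rewrite (qtE vV dV rE (erefl _) Vt) => _ [A [B [hA hB uB ->]]].
  apply: subringM => //; first exact: (horner_sub lR dR).
  have RB : R B.[y1 / x1] by exact: (horner_sub lR dR).
  suff : ~ max_ideal R B.[y1 / x1] by move/(max_unit RB)=> -[].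
  move=> mB; apply: (unit_max uB).
  apply: (center_max rE (erefl _) lV lR dV dR Vt Rt _ (imp _ _ Rt)) => //.
  by move=> tr; apply: nord; exists x1, y1.
have [//|] := good_chart rE qE (erefl _) gR dR nRE.
rewrite invf_div => Rt'; have rE' := regular_pairC rE.
have mt : max_ideal R (x1 / y1) by split=> // -[_ _]; rewrite invf_div.
have Vt' : V (x1 / y1) by exact: sRV.
have hX : polyover E 'X by apply: overX; case: rE => -[[]].
suff [_ []] : max_ideal V (x1 / y1).
  have [_ x0 _] := rE; have [_ y0 _] := rE'.
  by split=> //; rewrite ?invf_div // mulf_neq0 // invr_eq0.
rewrite -(hornerX (x1 / y1)).
apply: (center_max rE' (erefl _) lV lR dV dR Vt' Rt' _ (imp _ _ Rt')) => //; last by rewrite hornerX.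
by move=> tr; apply: nord; exists y1, x1.
Qed.

Lemma qt_regular V E x y t : valuation_ring V -> regular_pair E x y -> quotient_field_of E ->
  t = y / x -> dominates E V -> V t -> ~ ord_type V E ->
  exists g, min_monic E V t g /\ regular_pair (qt V E) x g.[t].
Proof.
move=> vV rE qE te dV Vt nord; have lV := valuation_local vV.
have [P [hP mP nP]] : exists P, [/\ polyover E P, max_ideal V P.[t] & ~ mover E P].
  apply: contrapT => nh; apply: nord; exists x, y; rewrite -te; split=> // P hP mP.
  by apply: contrapT => nP; apply: nh; exists P.
have [g Hg] := min_monicP rE te lV dV Vt hP nP mP; exists g; split=> //.
rewrite (qtE vV dV rE te Vt); exact: (locq_regular rE qE te lV dV Vt).
Qed.

Lemma mpow_split R x y r w : regular_pair R x y -> mpow R r w ->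
  pair_gen R x (y ^+ r) w.
Proof.
move=> rR; have [[lR _ mx my gen] _ _] := rR; have sR := proj1 lR.
have Rx := max_sub mx; have Ry := max_sub my.
elim: r w => [|r IH] w /=.
  by move=> Rw; exists 0, w; rewrite expr0 mul1r mulr0 add0r; split=> //; apply: subring0.
have Ryr := subringX r.+1 sR Ry.
have iI := pair_ideal sR Rx Ryr.
move=> /(_ _ iI); apply=> _ b /gen[c [d [Rc Rd ->]]] /IH[a [e [Ra Re ->]]].
exists (c * (x * a + y ^+ r * e) + d * y * a), (d * e); split; last by rewrite exprS; ring.
  apply: subringD => //; last by apply: subringM => //; apply: subringM.
  apply: subringM => //; apply: subringD => //; apply: subringM => //; exact: subringX.
exact: subringM.
Qed.

(** Multiplication by [x] raises the order by exactly one, as it does not change the dehomogenized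
    initial form. *)
Lemma mpow_cancel E x y r h : regular_pair E x y -> quotient_field_of E -> E h ->
  mpow E r.+1 (x * h) -> mpow E r h.
Proof.
move=> rE qE Eh hx; pose t := y / x; have te : t = y / x by [].
have [->|h0] := eqVneq h 0; first exact: (ideal0 (mpow_ideal rE te r)).
have [p [P [hP sP nP eh]]] := order_exists rE qE te Eh h0.
have [rp|pr] := leqP r p.
  by apply: (mpow_le rE te rp); apply/(mpowE rE te); exists P.
case: nP; apply/(mpow_lead rE qE te (k := p.+1) hP); first exact: leqW.
rewrite exprS -mulrA -eh; by apply: (mpow_le rE te _ hx).
Qed.

(* The order of an element drops under the quadratic transform unless its initial form is a
   power of a linear form and the transform is taken in the corresponding direction. *)
Lemma strict_transform V E x y t g r B : valuation_ring V -> regular_pair E x y ->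
  quotient_field_of E -> t = y / x -> dominates E V -> V t ->
  min_monic E V t g -> polyover E B -> (size B <= r.+1)%N -> ~ mover E B -> (0 < r)%N ->
  mpow (qt V E) r B.[t] ->
  exists u h, [/\ unit_in E u, qt V E h & B.[t] = u * g.[t] ^+ r + x * h].
Proof.
move=> vV rE qE te dV Vt Hg hB sB nB r0; have lV := valuation_local vV; have sV := proj1 lV.
rewrite (qtE vV dV rE te Vt) => hm.
have [hg mg sg Mg gmin] := Hg.
have rE' := locq_regular rE qE te lV dV Vt Hg.
have [[lE _ mx _ _] x0 _] := rE; have [[lE' _ mx' _ _] _ _] := rE'.
have sE := proj1 lE; have sE' := proj1 lE'.
have sub' := locq_sub lV dV Vt; have adj' := locq_adj t rE lV.
have [a [b [Ea Eb eB]]] := mpow_split rE' hm.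
set d := (size g).-1.
have sz A : ~ mover E A -> (0 < size A)%N.
  move=> nA; rewrite size_poly_gt0; apply: contra_not_neq nA => -> i.
  by rewrite coef0; apply: max0.
(* Modulo [x], factors [g] split off from [B] one at a time, and the degrees satisfy
   [deg C + j * d <= r] with [d] the degree of [g]. At [j = r] this forces [d = 1] and a constant
   unit [C]. *)
have step j : (j <= r)%N -> exists C Q, [/\ polyover E C, polyover E Q, ~ mover E C,
    (size C + j * d <= r.+1)%N & B.[t] = g.[t] ^+ j * C.[t] + x * Q.[t]].
  elim: j => [|j IH] jr.
    exists B, 0; split=> //; [exact: over0|by rewrite mul0n addn0|].
    by rewrite horner0 expr0 mul1r mulr0 addr0.
  have [C [Q [hC hQ nC sC eC]]] := IH (ltnW jr).
  have [e Ee ee] : princ (locq E t V) x (C.[t] - g.[t] ^+ (r - j) * b).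
    apply: (regular_pow (i := j) rE').
      by apply: subringB; [|exact: adj'|apply: subringM => //; apply: subringX => //; exact: adj'].
    exists (a - Q.[t]); first by apply: subringB => //; exact: adj'.
    have -> : g.[t] ^+ j * (C.[t] - g.[t] ^+ (r - j) * b)
      = g.[t] ^+ j * C.[t] - g.[t] ^+ (j + (r - j)) * b by rewrite exprD; ring.
    rewrite subnKC ?(ltnW jr) //.
    have -> : g.[t] ^+ j * C.[t] = B.[t] - x * Q.[t] by rewrite eC; ring.
    by rewrite eB; ring.
  have mC : max_ideal V C.[t].
    rewrite -(subrK (g.[t] ^+ (r - j) * b) C.[t]) ee; apply: maxD => //.
      by apply: maxMr => //; [apply: dV.2|apply: sub'].
    rewrite -subnSK // exprS -mulrA; apply: maxMr => //.
    by apply: subringM; [|apply: subringX; [|case: Mg]|apply: sub'].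
  have [C' [S [hC' mS eC' sC']]] := min_monic_div rE lV dV Vt Hg hC mC.
  have [S' hS' eS'] := mover_adj rE te mS.
  have nC' : ~ mover E C'.
    move=> mC'; apply: nC; rewrite eC' mulrC; apply: (over_idealD (proj2 lE)) => //.
    exact: (over_idealM (proj2 lE)).
  exists C', (g ^+ j * S' + Q); split=> //.
  - by apply: overD => //; apply: overM => //; apply: overE.
  - by have := sz _ nC'; rewrite mulSn; move: sC sC'; rewrite -/d; lia.
  - rewrite eC eC' !(hornerD, hornerM, horner_exp) eS' exprSr; ring.
have [C [Q [hC hQ nC sC eC]]] := step r (leqnn r).
have d0 : (0 < d)%N by rewrite /d; lia.
have d1 : d = 1%N by have := sz _ nC; nia.
have /size1_polyC eC1 : (size C <= 1)%N by move: sC; rewrite d1; lia.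
have uC : unit_in E C`_0.
  apply: max_unit => // m; apply: nC => i; rewrite eC1 coefC; case: ifP => // _; exact: max0.
exists C`_0, Q.[t]; split=> //; first exact: adj'.
by rewrite eC eC1 hornerC coefC eqxx; ring.
Qed.
End Valuation.

(** * The union of the transforms *)

Lemma qt_step (F : fieldType) (V E : F -> Prop) : valuation_ring V ->
  (exists x y, regular_pair E x y) -> quotient_field_of E -> dominates E V -> ~ ord_type V E ->
  [/\ exists x y, regular_pair (qt V E) x y, quotient_field_of (qt V E),
    dominates (qt V E) V & sub E (qt V E)].
Proof.
move=> vV [x0 [y0 rE0]] qE dE no; have [x [y [rE Vt]]] := regular_chart vV rE0.
have lV := valuation_local vV; have [g [_ rg]] := qt_regular vV rE qE (erefl _) dE Vt no.
have s : sub E (qt V E) by rewrite (qtE vV dE rE (erefl _) Vt); apply: (locq_base _ rE).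
split=> //; first by exists x, g.[y / x].
  exact: quotient_field_sub s qE.
by rewrite (qtE vV dE rE (erefl _) Vt); apply: dominates_locq.
Qed.

Section Tower.
Variable F : fieldType.
Implicit Types (I R E : F -> Prop) (a b c x y z w s t : F) (P Q A B : {poly F}).
Variables (V D : F -> Prop).
Hypotheses (vV : valuation_ring V) (qD : quotient_field_of D).
Hypotheses (rD : exists x y, regular_pair D x y) (dD : dominates D V).
Let T n := iter n (qt V) D.
Hypothesis nord : forall n, ~ ord_type V (T n).

Let lV : local_ring V := valuation_local vV.
Let sV : is_subring V := proj1 lV.

Let tower n : [/\ exists x y, regular_pair (T n) x y, dominates (T n) V & quotient_field_of (T n)].
Proof.
elim: n => [|n [rn dn qn]]; first by [].
by have [] := qt_step vV rn qn dn (nord (n := n)).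
Qed.

Lemma tower_mono n : sub (T n) (T n.+1).
Proof. by have [rn dn qn] := tower n; have [] := qt_step vV rn qn dn (nord (n := n)). Qed.

Section Missing.
Variable s : F.
Hypotheses (Vs : V s) (ns : forall n, ~ T n s).

Let s0 : s != 0.
Proof.
have [[x [y [[lD _ _ _ _] _ _]]] _ _] := tower 0%N.
by apply/eqP => e; apply: (ns (n := 0%N)); rewrite e; apply: subring0; case: lD.
Qed.

Let ns' n : ~ T n s^-1.
Proof.
have [[x [y [[lT _ _ _ _] _ _]]] d _] := tower n.
move=> Ts; apply: (ns (n := n)).
suff : ~ max_ideal (T n) s^-1 by move/(max_unit Ts)=> -[_ _]; rewrite invrK.
move=> /d.2; apply: unit_max; split; rewrite ?invr_eq0 ?invrK //; exact: d.1.
Qed.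

Let frac s' := s' = s \/ s' = s^-1.

Let fracN n s' : frac s' -> ~ T n s'. Proof. by case=> ->; [exact: ns|exact: ns']. Qed.

(** The orders of denominators over all levels of the tower, when the numerator has at least the
    same order. Admitting the inverse of [s] lets the term of smaller order be the denominator. *)
Let M r := exists n s' a b, [/\ frac s', mpow (T n) r a, mpow (T n) r b,
  ~ mpow (T n) r.+1 b & s' * b = a].

Let order E a : (exists x y, regular_pair E x y) -> quotient_field_of E -> E a -> a != 0 ->
  exists p, mpow E p a /\ ~ mpow E p.+1 a.
Proof.
move=> [x [y rE]] qE Ea a0; have [p [P [hP sP nP ea]]] := order_exists rE qE (erefl _) Ea a0.
exists p; split; first by apply/(mpowE rE (erefl _)); exists P.
by rewrite ea => /(mpow_lead rE qE (erefl _) hP sP).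
Qed.

Let M_low n s' a b k : frac s' -> T n a -> T n b -> b != 0 -> s' * b = a ->
  ~ mpow (T n) k b \/ ~ mpow (T n) k a -> exists2 r, (r < k)%N & M r.
Proof.
move=> fs Ta Tb b0 e nk; have [rn dn qn] := tower n; have [x [y rT]] := rn.
have s'0 : s' != 0 by case: fs => ->; rewrite ?invr_eq0.
have a0 : a != 0 by rewrite -e mulf_neq0.
have [p [pa npa]] := order rn qn Ta a0; have [q [qb nqb]] := order rn qn Tb b0.
have le := mpow_le rT (erefl _).
have mink : (minn p q < k)%N.
  rewrite ltnNge; apply/negP; rewrite leq_min => /andP[kp kq].
  by case: nk; apply; [apply: le kq _ qb|apply: le kp _ pa].
have [qp|pq] := leqP q p.
  exists q; first by move: mink; lia.
  by exists n, s', a, b; split=> //; apply: le qp _ pa.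
exists p; first by move: mink; lia.
exists n, s'^-1, b, a; split=> //; last by rewrite -e mulKf.
  by case: fs => ->; [right|left; rewrite invrK].
exact: le (ltnW pq) _ qb.
Qed.

(* For a pair of least order, every further transform has the same order, hence the transforms
   are all taken along the same smooth germ, with the same local equation [x] of the exceptional
   divisor; then numerator and denominator lie in the ideal of the elements divisible in [V] by
   all powers of [x], which is principal, so that the fraction can be simplified. *)
Lemma missing_absurd : False.
Proof.
have exM : exists r, `[<M r>].
  have [rn dn qn] := tower 0%N; have [a [b [Ta Tb b0 e]]] := qn s.
  have a0 : a != 0 by apply: contra_neq s0 => h; rewrite e h mul0r.
  have [q [qb nqb]] := order rn qn Tb b0.
  have [||r _ Mr] := @M_low 0%N s a b q.+1 _ Ta Tb b0 _ (or_introl nqb); first by left.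
    by rewrite e divfK.
  by exists r; apply/asboolP.
case: (ex_minnP exM) => r /asboolP[n0 [s' [a [b [fs ma mb nb e]]]]] rmin.
(* Minimality of [r] bounds the orders in every representation of [s'], at every level. *)
have minr n c d : T n c -> T n d -> d != 0 -> s' * d = c -> mpow (T n) r c /\ mpow (T n) r d.
  move=> Tc Td d0 ec; split; apply: contrapT => nm.
    have [q qr /asboolP/rmin] := M_low fs Tc Td d0 ec (or_intror nm); lia.
  have [q qr /asboolP/rmin] := M_low fs Tc Td d0 ec (or_introl nm); lia.
have [rE0 dE qE] := tower n0; have [x00 [y00 rE00]] := rE0.
have [x [y [rE Vt]]] := regular_chart vV rE00.
have [gE x0 _] := rE; have [lE aE mx my _] := gE; have sE := proj1 lE.
have b0 : b != 0.
  by apply: contra_not_neq nb => ->; apply: (ideal0 (mpow_ideal rE (erefl _) _)).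
(* For [r = 0] the denominator would be a unit and [s'] would lie in the tower. *)
have r0 : (0 < r)%N.
  rewrite lt0n; apply/eqP => r0; move: ma mb nb; rewrite r0 /= => Ta Tb nb.
  have [|_ _ Tb'] := max_unit Tb.
    move=> mb; apply: nb => I iI hI; rewrite -[b]mulr1; apply: hI => //; exact: subring1.
  by apply: (fracN fs (n := n0)); rewrite -(mulfK b0 s') e; apply: subringM.
have Ta : T n0 a := ideal_sub (mpow_ideal rE (erefl _) r) ma.
have Tb : T n0 b := ideal_sub (mpow_ideal rE (erefl _) r) mb.
(* Division of both terms by [x ^ r] gives a representation one level higher; by [minr] its
   denominator again has order at least [r], as [strict_transform] requires. *)
have step n w c d : regular_pair (T n) x w -> V (w / x) -> T n c -> T n d -> d != 0 ->
    s' * d = c -> ~ mpow (T n) r.+1 d ->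
    exists w' u h, [/\ regular_pair (T n.+1) x w', unit_in (T n.+1) u, T n.+1 h,
      T n.+1 (c / x ^+ r) & d / x ^+ r = u * w' ^+ r + x * h].
  move=> rn Vw Tc Td d0 ec nd; have [_ dn qn] := tower n.
  have ln : local_ring (T n) by case: rn => -[].
  have [/(mpowE rn (erefl _))[A [hA sA eA]]] := minr _ _ _ Tc Td d0 ec.
  move=> /(mpowE rn (erefl _))[B [hB sB eB]].
  have nB : ~ mover (T n) B.
    by move=> mB; apply: nd; rewrite eB; apply/(mpow_lead rn qn (erefl _) hB sB).
  have xr0 : x ^+ r != 0 by rewrite expf_neq0.
  have [g [Hg rg]] := qt_regular vV rn qn (erefl _) dn Vw (nord (n := n)).
  have qe := qtE vV dn rn (erefl _) Vw.
  have TA : T n.+1 A.[w / x] by rewrite /T iterS -/(T n) qe; apply: locq_adj hA; first exact: rn.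
  have TB : T n.+1 B.[w / x] by rewrite /T iterS -/(T n) qe; apply: locq_adj hB; first exact: rn.
  have eA' : c / x ^+ r = A.[w / x] by rewrite eA mulrC mulKf.
  have eB' : d / x ^+ r = B.[w / x] by rewrite eB mulrC mulKf.
  have [||_ mB] := minr _ _ _ TA TB.
  - by rewrite -eB' mulf_neq0 // invr_eq0.
  - by rewrite -eA' -eB' mulrA ec.
  have [u [h [uu Th eu]]] := strict_transform vV rn qn (erefl _) dn Vw Hg hB sB nB r0 mB.
  exists g.[w / x], u, h; split=> //; rewrite ?eA' ?eB' //.
  case: uu => u0 Tu Tu'; split=> //; exact: tower_mono.
have inv k : exists w u h, [/\ regular_pair (T (n0 + k.+1)) x w, unit_in (T (n0 + k.+1)) u,
    T (n0 + k.+1) h, T (n0 + k.+1) (a / x ^+ (r * k.+1)) &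
    b / x ^+ (r * k.+1) = u * w ^+ r + x * h].
  elim: k => [|k [w [u [h [rw uu Th Ta1 eb]]]]].
    by rewrite muln1 addn1; apply: (step _ _ _ _ rE Vt Ta Tb b0 e nb).
  set n := (n0 + k.+1)%N in rw uu Th Ta1 *.
  set a1 := a / _ in Ta1; set b1 := b / _ in eb.
  have [_ dn qn] := tower n; have [[ln _ mxn mw _] _ _] := rw; have sn := proj1 ln.
  have xk0 : x ^+ (r * k.+1) != 0 by rewrite expf_neq0.
  have Tb1 : T n b1.
    rewrite eb; apply: subringD => //; apply: subringM => //; try by apply: max_sub.
      by case: uu.
    by apply: subringX => //; apply: max_sub.
  have b10 : b1 != 0 by rewrite mulf_neq0 // invr_eq0.
  have e1 : s' * b1 = a1 by rewrite /b1 mulrA e.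
  have [ma1 mb1] := minr _ _ _ Ta1 Tb1 b10 e1.
  (* Modulo [x] the denominator is the unit [u] times [w ^ r], so its order cannot exceed [r]. *)
  have nb1 : ~ mpow (T n) r.+1 b1.
    move=> /(mpow_split rw)[c [d [Tc Td ecd]]].
    have [||f Tf ef] := @regular_pow _ _ _ _ r (u - w * d) rw.
    - by apply: subringB => //; [case: uu|apply: subringM => //; apply: max_sub].
    - exists (c - h); first exact: subringB.
      have -> : w ^+ r * (u - w * d) = (u * w ^+ r + x * h) - (x * c + w ^+ r.+1 * d) + x * (c - h).
        by rewrite exprS; ring.
      by rewrite -eb -ecd subrr add0r.
    - apply: (unit_max uu); rewrite -(subrK (w * d) u) ef; apply: maxD => //; exact: maxMr.
  (* In the other chart [b1 / w ^ r] is [u] plus a multiple of the nonunit [x / w], hence a unit,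
     which would put [s'] in the next transform. *)
  have Vw : V (w / x).
    apply: contrapT => nVw; have mxw := valuation_notin vV nVw; rewrite invf_div in mxw.
    have rw' := regular_pairC rw; have [_ w0 _] := rw'.
    have Vxw := max_sub mxw.
    have /(mpowE rw' (erefl _))[A [hA sA eA]] := ma1.
    have /(mpowE rw' (erefl _))[B [hB sB eB]] := mb1.
    have hxm : mpow (T n) r.-1.+1 (x * h).
      rewrite prednK //; have -> : x * h = b1 - w ^+ r * u by rewrite eb; ring.
      have im := mpow_ideal rw (erefl _) r.
      apply: (idealB sn im) => //; apply/(mpowE rw' (erefl _)); exists u%:P.
      rewrite hornerC size_polyC; split=> //; first by apply: overC => //; case: uu.
      by case: eqP.
    have /(mpowE rw' (erefl _))[H [hH sH eH]] := mpow_cancel rw qn Th hxm.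
    have wr0 : w ^+ r != 0 by rewrite expf_neq0.
    have VB : unit_in V B.[x / w].
      have -> : B.[x / w] = u + x / w * H.[x / w].
        apply: (mulfI wr0); rewrite -eB eb eH; case: (r) r0 => // r' _ /=.
        by rewrite exprS; field.
      apply: unit_addm => //.
        by case: uu => u0 Tu Tu'; split=> //; apply: dn.1.
      by apply: maxMr => //; exact: (horner_sub lV dn Vxw).
    apply: (fracN fs (n := n.+1)); rewrite /T iterS -/(T n) (qtE vV dn rw' (erefl _) Vxw).
    exists A, B; split=> //; case: VB => B0 _ _.
    apply: (mulIf B0); rewrite divfK //; apply: (mulfI wr0); rewrite -eA -e1 eB; ring.
  have [w' [u' [h' [rw' uu' Th' Ta1' eb']]]] := step _ _ _ _ rw Vw Ta1 Tb1 b10 e1 nb1.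
  exists w', u', h'; rewrite addnS -/n mulnS addnC exprD.
  split=> //; first by move: Ta1'; rewrite /a1 invfM mulrA.
  by rewrite invfM mulrA.
pose J z := T n0 z /\ forall k, V (z / x ^+ k).
have Vx : V x by exact: dE.1 (max_sub mx).
have iJ : is_ideal (T n0) J.
  split.
  - by move=> z [].
  - by split; [exact: subring0|move=> k; rewrite mul0r; exact: subring0].
  - by move=> z w [? hz] [? hw]; split; [exact: subringD|move=> k; rewrite mulrDl; exact: subringD].
  - move=> c z Tc [Tz hz]; split; first exact: subringM.
    by move=> k; rewrite -mulrA; apply: subringM => //; apply: dE.1.
have [z Tz [_ hz]|p [[Tp hp] genJ]] := saturated_principal gE iJ (x := x).
  split=> // k; have := hz k.+1; rewrite exprS invfM mulrA [x * z]mulrC mulfK //.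
have xpow k : (k <= r * k.+1)%N by nia.
have Jdiv z : T n0 z -> (forall k, V (z / x ^+ (r * k.+1))) -> J z.
  move=> Tz h; split=> // k.
  have -> : z / x ^+ k = z / x ^+ (r * k.+1) * x ^+ (r * k.+1 - k).
    have -> : x ^+ (r * k.+1) = x ^+ (r * k.+1 - k) * x ^+ k by rewrite -exprD subnK.
    by field; rewrite !expf_neq0.
  by apply: subringM => //; apply: subringX.
have [a1 Ta1 ea] : princ (T n0) p a.
  apply: genJ; apply: Jdiv => // k; have [w [u [h [_ _ _ h1 _]]]] := inv k.
  by have [_ d _] := tower (n0 + k.+1); apply: d.1.
have [b1 Tb1 eb] : princ (T n0) p b.
  apply: genJ; apply: Jdiv => // k; have [w [u [h [rw uu Th _ ->]]]] := inv k.
  have [_ d _] := tower (n0 + k.+1); have [[_ _ _ /max_sub Tw _] _ _] := rw.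
  apply: subringD => //; apply: subringM => //; try exact: d.1.
    by apply: d.1; case: uu.
  by apply: subringX => //; apply: d.1.
have p0 : p != 0 by apply: contra_neq b0 => h; rewrite eb h mul0r.
(* If [p] were a unit, its divisibility by [x] in [V] would make [x] invertible there. Hence
   cancelling [p] brings the order of the denominator below [r]. *)
have mp : max_ideal (T n0) p.
  split=> // -[_ _ Tp']; have : V (1 / x).
    have -> : 1 / x = p^-1 * (p / x ^+ 1) by field; rewrite p0 x0.
    by apply: subringM => //; apply: dE.1.
  by rewrite div1r => Vx'; case: (dE.2 _ mx) => _; apply.
have b10 : b1 != 0 by apply: contra_neq b0 => h; rewrite eb h mulr0.
have nb1 : ~ mpow (T n0) r b1.
  by move=> h; apply: nb; rewrite eb => I iI hI; apply: hI.
have e1 : s' * b1 = a1 by apply: (mulfI p0); rewrite mulrCA -eb e ea.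
have [q qr /asboolP/rmin] := M_low fs Ta1 Tb1 b10 e1 (or_introl nb1); lia.
Qed.

End Missing.

Theorem tower_union s : V s -> exists n, T n s.
Proof.
by move=> Vs; apply: contrapT => h; apply: (missing_absurd Vs) => n Ts; apply: h; exists n.
Qed.

(** Either [R] contains all transforms, hence their union [V], or it equals the one that precedes
    the first transform not contained in it. *)
Lemma tower_good R : good R -> sub D R -> sub R V -> R = V \/ exists n, R = T n.
Proof.
move=> gR sDR sRV.
have [all|/existsNP ex] := EM (forall n, sub (T n) R).
  by left; apply: sub_antisym => // z /tower_union[n]; apply: all.
have ex' : exists n, `[<~ sub (T n) R>] by have [n hn] := ex; exists n; apply/asboolP.
case: (ex_minnP ex') => -[|n] /asboolP nn nmin; first by case: nn.
have sn : sub (T n) R.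
  apply: contrapT => h; have := nmin n; rewrite ltnn => f; suff : false by [].
  by apply: f; apply/asboolP.
right; exists n; apply: sub_antisym => //; apply: contrapT => nsub; apply: nn.
have [[x [y rn]] dn qn] := tower n.
exact: (qt_sub_good vV rn).
Qed.
End Tower.

(** * The rings below a valuation ring *)

Section NoetherianSpace.
Variable F : fieldType.
Implicit Types (X Y : (F -> Prop) -> Prop) (Q R : F -> Prop).

(** Such data witness a strictly increasing sequence of finite unions of basic open sets. *)
Definition bad X (R : nat -> F -> Prop) (xs : nat -> seq F) := forall n,
  [/\ X (R n), basicU (xs n) (R n) & forall m, (m < n)%N -> ~ basicU (xs m) (R n)].

Definition no_bad X := forall (R : nat -> F -> Prop) xs, ~ bad X R xs.

Lemma noetherianP X : noetherian_space X <-> no_bad X.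
Proof.
split=> [nX R xs bX|nb C cC dC].
  pose C n Q := X Q /\ forall m, (m < n)%N -> ~ basicU (xs m) Q.
  have [|n Q [XQ h]|N hN] := nX C.
  - move=> n; split=> [Q []//|]; split=> [Q []//|Q [XQ nC]].
    have [m mn hm] : exists2 m, (m < n)%N & basicU (xs m) Q.
      apply: contrapT => nh; apply: nC; split=> // m mn hm; apply: nh; by exists m.
    by exists (xs m); split=> // Q' XQ' hQ'; split=> // -[_ /(_ m mn)].
  - by split=> // m mn; apply: h; apply: leq_trans mn _.
  have [XR hR nR] := bX N.
  have : C N.+1 (R N) by rewrite (hN N.+1 (leqnSn N)).
  by case=> _ /(_ N (ltnSn N)).
apply: contrapT => /forallNP ns.
have mono m n : (m <= n)%N -> psub (C n) (C m).
  elim: n => [|n IH]; first by rewrite leqn0 => /eqP->.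
  by rewrite leq_eqVlt => /orP[/eqP->//|/IH h Q /dC]; apply: h.
(* If the chain changes after [N], some point of [C N] lies outside a later closed set and has a
   basic neighbourhood avoiding it. *)
have /choice[f hf] : forall N, exists p : nat * (F -> Prop) * seq F,
    [/\ (N <= p.1.1)%N, C N p.1.2, basicU p.2 p.1.2 &
        forall Q, X Q -> basicU p.2 Q -> ~ C p.1.1 Q].
  move=> N; have /existsNP[n /not_implyP[Nn ne]] := ns N.
  have [Q CQ nCQ] : exists2 Q, C N Q & ~ C n Q.
    apply: contrapT => h; apply: ne; apply/predeqP => Q; split; first exact: mono.
    by move=> CQ; apply: contrapT => nC; apply: h; exists Q.
  have [CX [_ op]] := cC n; have [|xs [hxs hop]] := op Q.
    by split=> //; have [CX' _] := cC N; apply: CX'.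
  exists (n, Q, xs); split=> //= Q' XQ' hQ'; by have [] := hop Q' XQ' hQ'.
pose k i := iter i (fun N => (f N).1.1) 0%N.
have km m n : (m <= n)%N -> (k m <= k n)%N.
  elim: n => [|n IH]; first by rewrite leqn0 => /eqP->.
  rewrite leq_eqVlt => /orP[/eqP->//|/IH h]; apply: leq_trans h _.
  by have [] := hf (k n).
apply: (nb (fun i => (f (k i)).1.2) (fun i => (f (k i)).2)) => n.
have [_ h2 h3 _] := hf (k n); have XR : X (f (k n)).1.2 by have [CX _] := cC (k n); apply: CX.
split=> // m mn hb; have [_ _ _ /(_ _ XR hb)] := hf (k m); apply.
exact: (mono _ _ (km m.+1 n mn)).
Qed.

Lemma no_bad_sub X Y : psub X Y -> no_bad Y -> no_bad X.
Proof. by move=> s nY R xs b; apply: (nY R xs) => n; have [? ? ?] := b n; split=> //; apply: s. Qed.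

Lemma increasing_lt (f : nat -> nat) : (forall i, (f i < f i.+1)%N) ->
  forall i j, (i < j)%N -> (f i < f j)%N.
Proof.
move=> h i j; elim: j => // j IH; rewrite ltnS leq_eqVlt => /orP[/eqP->//|/IH hi].
exact: ltn_trans hi (h j).
Qed.

Lemma no_badU X Y : no_bad X -> no_bad Y -> no_bad (fun R => X R \/ Y R).
Proof.
move=> nX nY R xs b.
have subseq Z (f : nat -> nat) : (forall i, (f i < f i.+1)%N) -> (forall i, Z (R (f i))) ->
    bad Z (R \o f) (xs \o f).
  move=> incr hZ n /=; have [_ h1 h2] := b (f n).
  by split=> // m mn; apply: h2; apply: increasing_lt.
have [inf|/existsNP[N hN]] := EM (forall N, exists2 n, (N < n)%N & X (R n)).
  have /choice[g hg] : forall N, exists n, (N < n)%N /\ X (R n).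
    by move=> N; have [n ? ?] := inf N; exists n.
  apply: (nX _ _ (subseq X (fun i => iter i.+1 g 0%N) _ _)) => i.
    by have [] := hg (iter i.+1 g 0%N).
  by have [] := hg (iter i g 0%N).
apply: (nY _ _ (subseq Y (fun i => (N.+1 + i)%N) _ _)) => i; first by rewrite addnS.
have [[Xi|//] _ _] := b (N.+1 + i)%N; case: hN; exists (N.+1 + i)%N => //.
by rewrite addSn ltnS leq_addr.
Qed.

Lemma no_bad_chain (T : nat -> F -> Prop) : (forall n, sub (T n) (T n.+1)) ->
  no_bad (fun R => exists n, R = T n).
Proof.
move=> mT R xs b; have mono := chain_le mT.
have /choice[i hi] : forall n, exists i, R n = T i by move=> n; have [] := b n.
have dec m n : (m < n)%N -> (i n < i m)%N.
  move=> mn; rewrite ltnNge; apply/negP => le; have [_ _ /(_ m mn)] := b n; apply => z.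
  have [_ hm _] := b m; move=> /hm; rewrite !hi; exact: mono.
have : forall n, (i n + n <= i 0)%N.
  by elim=> [|n IH]; [rewrite addn0|have := dec n n.+1 (ltnSn n); lia].
by move/(_ (i 0%N).+1); lia.
Qed.

Lemma no_bad1 (V : F -> Prop) : no_bad (fun R => R = V).
Proof.
move=> R xs b; have [e0 h0 _] := b 0%N; have [e1 _ /(_ 0%N (ltn0Sn 0))] := b 1%N.
by apply; rewrite e1 -e0.
Qed.

(** After its first term a bad sequence stays outside a basic open set, and the complement of that
    set is a finite union of sets of rings omitting one element. *)
Lemma no_bad_cover X : (forall R z, X R -> R z -> no_bad (fun Q => X Q /\ ~ Q z)) -> no_bad X.
Proof.
move=> h R xs b; have [X0 h0 _] := b 0%N.
suff : no_bad (fun Q => X Q /\ ~ basicU (xs 0%N) Q).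
  move=> /(_ (fun n => R n.+1) (fun n => xs n.+1)); apply=> n.
  have [hX hn hm] := b n.+1; split=> //; first by split=> //; apply: hm.
  by move=> m mn; apply: hm.
elim: (xs 0%N) h0 => [|z s IH] h0.
  by move=> R' xs' /(_ 0%N)[[_ []]].
apply: (no_bad_sub (Y := fun Q => (X Q /\ ~ Q z) \/ (X Q /\ ~ basicU s Q))).
  move=> Q [XQ nQ]; have [Qz|nz] := EM (Q z); last by left.
  right; split=> // hs; apply: nQ => w; rewrite inE => /orP[/eqP->//|]; exact: hs.
apply: no_badU; first by apply: (h _ _ X0); apply: h0; rewrite mem_head.
by apply: IH => w ws; apply: h0; rewrite inE ws orbT.
Qed.
End NoetherianSpace.

(** * The rings below an order valuation ring *)

Section OrdCase.
Variable F : fieldType.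
Implicit Types (I R Q : F -> Prop) (a b c z w s v : F) (P A B : {poly F}).
Variables (E V : F -> Prop) (x y t : F).
Hypotheses (vV : valuation_ring V) (rE : regular_pair E x y) (qE : quotient_field_of E).
Hypotheses (te : t = y / x) (dV : dominates E V) (Vt : V t) (tr : residually_trans E t V).

Let lV : local_ring V := valuation_local vV.
Let sV : is_subring V := proj1 lV.
Let gE : two_gen E x y. Proof. by case: rE. Qed.
Let lE : local_ring E. Proof. by case: gE. Qed.
Let sE : is_subring E := proj1 lE.
Let mx : max_ideal E x. Proof. by case: gE. Qed.
Let x0 : x != 0. Proof. by case: rE. Qed.

Let val_rep v : V v -> exists A B, [/\ polyover E A, polyover E B, ~ mover E B & v * B.[t] = A.[t]].
Proof.
move=> Vv; have [||ge0 _] := @ord_ge_dom _ E x y rE qE t te V lV.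
- exact: dV.2.
- move=> z A B mz hA hB e; apply: tr => //; rewrite -e; apply: maxMr => //.
  exact: (horner_sub lV dV Vt).
have [A [B [hA hB nB e]]] := ge0 v Vv.
by exists A, B; split=> //; rewrite e expr0 mul1r.
Qed.

Let Y R := [/\ good R, sub E R, sub R V, R t & ~ sub V R].

Section Center.
Variables (R0 : F -> Prop) (g : {poly F}).
Hypotheses (Y0 : Y R0) (Hg : min_monic E R0 t g).

Let al := locq E t R0.
Let gt := g.[t].
Let lR0 : local_ring R0. Proof. by case: Y0 => -[]. Qed.
Let sR0V : sub R0 V. Proof. by case: Y0. Qed.
Let R0t : R0 t. Proof. by case: Y0. Qed.
Let dR0 : dominates E R0. Proof. by case: Y0 => _ h1 h2 _ _; apply: dominates_mid h1 h2 dV. Qed.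
Let ral : regular_pair al x gt. Proof. exact: (locq_regular rE qE te lR0 dR0 R0t Hg). Qed.
Let gal : two_gen al x gt. Proof. by case: ral. Qed.
Let lal : local_ring al. Proof. by case: gal. Qed.
Let sal : is_subring al := proj1 lal.
Let mgal : max_ideal al gt. Proof. by case: gal. Qed.
Let mxal : max_ideal al x. Proof. by case: gal. Qed.
Let alV : sub al V. Proof. by move=> z h; apply: sR0V; apply: (locq_sub lR0 dR0 R0t). Qed.
Let hg : polyover E g. Proof. by case: Hg. Qed.
Let al_adj P : polyover E P -> al P.[t]. Proof. exact: (locq_adj t rE lR0). Qed.
Let mxV : max_ideal V x. Proof. exact: dV.2. Qed.

Let unit_g : unit_in V gt.
Proof.
apply: max_unit; first exact: (horner_sub lV dV Vt).
by move=> /(tr hg); case: Hg => _ mg _ _ _; apply: monic_notmover.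
Qed.

(** The center of [V] on [al] is [x al], which is smaller than the maximal ideal because [gt] is a
    unit of [V]. *)
Let max_al a : al a -> max_ideal V a -> princ al x a.
Proof.
move=> [A [B [hA hB uB ->]]] ma; have [b0 RB _] := uB.
have mA : max_ideal V A.[t] by rewrite -(divfK b0 A.[t]); apply: maxMr => //; apply: sR0V.
have [C hC ->] := mover_adj rE te (tr hA mA).
by exists (C.[t] / B.[t]); [exists C, B|rewrite mulrA].
Qed.

(** The residue of [v] is a quotient of two elements of [al / x], each a unit times a power of [gt]
    by [modx_form]; the exponents decide the case. *)
Let dichotomy v : V v ->
  (exists2 a, al a & max_ideal V (v - a)) \/ (exists2 b, max_ideal al b & max_ideal V (v * b - 1)).
Proof.
move=> Vv; have [mv|nv] := EM (max_ideal V v).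
  by left; exists 0; [exact: subring0|rewrite subr0].
have [A [B [hA hB nB e]]] := val_rep Vv.
have nB' : ~ max_ideal V B.[t] by move=> /(tr hB).
have uB : unit_in V B.[t] by apply: max_unit => //; apply: (horner_sub lV dV Vt).
have nA' : ~ max_ideal V A.[t].
  by rewrite -e; apply: unit_max; apply: (unitM lV) => //; apply: max_unit.
have alg := max_sub mgal; have alx := max_sub mxal.
have npr c : ~ max_ideal V c -> ~ princ al x c.
  by move=> nc [d ald ec]; apply: nc; rewrite ec; apply: maxMr => //; apply: alV.
have [u [j [c [uu alc eB]]]] := modx_form gal (al_adj hB) (npr _ nB').
have [u' [k [c' [uu' alc' eA]]]] := modx_form gal (al_adj hA) (npr _ nA').
have [u0 alu alui] := uu; have [u0' alu' alui'] := uu'; have [b0 VB VBi] := uB.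
have [jk|kj] := leqP j k.
  left; exists (u' / u * gt ^+ (k - j)).
    by apply: subringM => //; [apply: subringM|apply: subringX].
  set a := u' / u * _.
  have -> : v - a = (B.[t])^-1 * (x * (c' - a * c)).
    have ev : v = A.[t] / B.[t] by rewrite -e mulfK.
    have ek : gt ^+ k = gt ^+ (k - j) * gt ^+ j by rewrite -exprD subnK.
    have ea : a * u * gt ^+ j = u' * gt ^+ k by rewrite /a ek; field.
    have -> : v - a = (B.[t])^-1 * (A.[t] - a * B.[t]) by rewrite ev; field.
    by rewrite eA eB -ea; ring.
  apply: maxMl => //; apply: maxMr => //; apply: subringB => //; first exact: alV.
  apply: subringM => //; last exact: alV.
  apply: alV; apply: subringM => //; [exact: subringM|exact: subringX].
right; exists (u / u' * gt ^+ (j - k)).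
  rewrite -(subnSK kj) exprS mulrCA; apply: maxMr => //.
  by apply: subringM => //; [apply: subringM|apply: subringX].
set b := u / u' * _.
have -> : v * b - 1 = (B.[t])^-1 * (x * (c' * b - c)).
  have ev : v = A.[t] / B.[t] by rewrite -e mulfK.
  have ek : gt ^+ j = gt ^+ (j - k) * gt ^+ k by rewrite -exprD subnK // ltnW.
  have eb : u' * gt ^+ k * b = u * gt ^+ j by rewrite /b ek; field.
  have -> : v * b - 1 = (B.[t])^-1 * (A.[t] * b - B.[t]) by rewrite ev; field.
  by rewrite eA eB -eb; ring.
apply: maxMl => //; apply: maxMr => //; apply: subringB => //; last exact: alV.
apply: subringM => //; first exact: alV.
apply: alV; apply: subringM => //; [exact: subringM|exact: subringX].
Qed.

(* The valuation ring composed of [V] and the discrete valuation ring [al / x] of its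
   residue field. *)
Let W v := V v /\ exists2 a, al a & max_ideal V (v - a).

Let sW : is_subring W.
Proof.
split.
- split; first exact: subring1.
  by exists 1; [exact: subring1|rewrite subrr; exact: max0].
- move=> v v' [Vv [a ala ma]] [Vv' [a' ala' ma']]; split; first exact: subringB.
  exists (a - a'); first exact: subringB.
  have -> : v - v' - (a - a') = (v - a) - (v' - a') by ring.
  exact: maxB.
- move=> v v' [Vv [a ala ma]] [Vv' [a' ala' ma']]; split; first exact: subringM.
  exists (a * a'); first exact: subringM.
  have -> : v * v' - a * a' = v * (v' - a') + a' * (v - a) by ring.
  by apply: maxD => //; apply: maxMl => //; apply: alV.
Qed.

Let vW : valuation_ring W.
Proof.
split=> // z z0; have half v : v != 0 -> V v -> W v \/ W v^-1.
  move=> v0 Vv; have [ha|[b mb mvb]] := dichotomy Vv; first by left.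
  right; have Vb : V b by apply: alV; apply: max_sub.
  have uvb : unit_in V (v * b).
    rewrite -(subrK 1 (v * b)) addrC; apply: unit_addm => //.
    by split; rewrite ?oner_eq0 ?invr1 //; apply: subring1.
  have [vb0 _ Vvb] := uvb; have b0 : b != 0 by apply: contra_neq vb0 => ->; rewrite mulr0.
  have Vvi : V v^-1.
    by have -> : v^-1 = b * (v * b)^-1 by [field; rewrite v0 b0]; apply: subringM.
  split=> //; exists b; first exact: max_sub.
  have -> : v^-1 - b = v^-1 * - (v * b - 1) by field.
  by apply: maxMl => //; apply: maxN.
have [_ /(_ z z0)[/(half _ z0)//|Vz]] := vV.
have zi0 : z^-1 != 0 by rewrite invr_eq0.
by have := half _ zi0 Vz; rewrite invrK orC.
Qed.

Let dW : dominates al W.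
Proof.
split=> [a ala|a ma].
  by split; [exact: alV|exists a; rewrite // subrr; exact: max0].
have ala := max_sub ma; split.
  by split; [exact: alV|exists a; rewrite // subrr; exact: max0].
move=> [a0 _ [_ [b alb mb]]].
have [||c alc ec] := @max_al (1 - a * b).
- by apply: subringB => //; [exact: subring1|exact: subringM].
- have -> : 1 - a * b = a * (a^-1 - b) by field.
  by apply: maxMl => //; apply: alV.
apply: (max1N (R := al)); rewrite -(subrK (a * b) 1) ec; apply: maxD => //; exact: maxMr.
Qed.

(** In [W] the element [x] is divisible by every power of the nonunit [gt], whereas the order
    valuation of [E'] gives [x] a finite order. *)
Let W_not_ord E' : quotient_field_of E' -> dominates E' W -> ~ ord_type W E'.
Proof.
move=> qE' dE' [x' [y' [rE' Wt' tr']]]; have lW := valuation_local vW.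
have [||ge0 ge1] := @ord_ge_dom _ E' x' y' rE' qE' _ (erefl _) W lW.
- exact: dE'.2.
- move=> z A B mz hA hB e; apply: tr' => //; rewrite -e; apply: maxMr => //.
  exact: (horner_sub lW dE' Wt').
have [n []] := ord_ge_sep rE' qE' (erefl _) x0.
have [g0 _ Vgi] := unit_g.
have -> : x = x / gt ^+ n * gt ^+ n by rewrite divfK // expf_neq0.
rewrite -[n in ord_ge _ _ _ n]add0n; apply: (ord_geM rE').
  apply: ge0; have m : max_ideal V (x / gt ^+ n).
    by apply: maxMr => //; rewrite -exprVn; apply: subringX.
  by split; [case: m|exists 0; [exact: subring0|rewrite subr0]].
elim: n => [|n IH]; first by apply: ge0; rewrite expr0; apply: subring1.
rewrite exprS -add1n; apply: (ord_geM rE') => //; apply: ge1; exact: dW.2.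
Qed.

(** All rings of the fibre have the same center on [adj E t]. An [r] in [R] outside [W] would
    satisfy [r * b = 1] modulo the maximal ideal of [V] for a nonunit [b] of [al]; as [b] is a
    nonunit of [R] too, [1] would be one. *)
Let fiber_sub R : Y R -> max_ideal R gt -> sub al R /\ sub R W.
Proof.
move=> [gR sER sRV Rt _] mg; have [lR _] := gR; have sR := proj1 lR.
have dR := dominates_mid sER sRV dV.
have imp P : polyover E P -> max_ideal R0 P.[t] -> max_ideal R P.[t].
  move=> hP mP; have [Q [S [hQ mS -> _]]] := min_monic_div rE lR0 dR0 R0t Hg hP mP.
  rewrite hornerD hornerM; apply: maxD => //; last exact: (mover_max rE te).
  by apply: maxMl => //; apply: (horner_sub lR dR).
have ntr : ~ residually_trans E t R0.
  by case: Hg => _ mg' _ Mg _ /(_ g hg Mg); apply: monic_notmover.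
have cm := center_max rE te lR0 lR dR0 dR R0t Rt ntr imp.
have RBi B : polyover E B -> unit_in R0 B.[t] -> R (B.[t])^-1.
  move=> hB uB; have RB : R B.[t] by apply: (horner_sub lR dR).
  suff : ~ max_ideal R B.[t] by move/(max_unit RB)=> -[].
  by move=> /(cm _ hB); apply: unit_max.
have alR : sub al R.
  move=> _ [A [B [hA hB uB ->]]]; apply: subringM => //; last exact: RBi.
  exact: (horner_sub lR dR).
have malR b : max_ideal al b -> max_ideal R b.
  move=> /(locq_max lR0 dR0 R0t)[[A [B [hA hB uB eb]]] mb].
  have [b0 R0B _] := uB; rewrite eb; apply: maxMr => //; last exact: RBi.
  apply: imp => //; rewrite -(divfK b0 A.[t]) -eb; exact: maxMr.
split=> // r Rr; split; first exact: sRV.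
have [//|[b mb m]] := dichotomy (sRV _ Rr).
have Rb := malR _ mb; case: (max1N (R := R)).
have -> : 1 = r * b - (r * b - 1) by ring.
apply: maxB => //; first exact: maxMl.
apply: (max_mid sRV) => //; apply: subringB => //; last exact: subring1.
by apply: subringM => //; case: Rb.
Qed.

Lemma no_bad_center : no_bad (fun R => Y R /\ max_ideal R gt).
Proof.
have tow n : [/\ exists x y, regular_pair (iter n (qt W) al) x y,
    quotient_field_of (iter n (qt W) al) & dominates (iter n (qt W) al) W].
  elim: n => [|n [rn qn dn]].
    split=> //; first by exists x, gt.
    exact: (quotient_field_sub (locq_base t rE lR0) qE).
  by have [] := qt_step vW rn qn dn (W_not_ord qn dn).
have nord n : ~ ord_type W (iter n (qt W) al).
  by have [_ qn dn] := tow n; apply: W_not_ord.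
have [r0 q0 d0] := tow 0%N.
apply: (no_bad_sub (Y := fun R => R = W \/ exists n, R = iter n (qt W) al)).
  move=> R [YR mg]; have [s1 s2] := fiber_sub YR mg; case: YR => gR _ _ _ _.
  exact: (tower_good vW q0 r0 d0 nord).
apply: no_badU; first exact: no_bad1.
by apply: no_bad_chain => n; apply: (tower_mono vW q0 r0 d0 nord).
Qed.
End Center.

(** Splitting off a minimal polynomial lowers the degree of [B], so only finitely many fibres occur,
    each treated by [no_bad_center]. *)
Let no_bad_root n B : (size B <= n)%N -> polyover E B -> ~ mover E B ->
  no_bad (fun R => Y R /\ max_ideal R B.[t]).
Proof.
elim: n B => [|n IH] B sB hB nB.
  case: nB => i; move: sB; rewrite leqn0 size_poly_eq0 => /eqP->.
  by rewrite coef0; apply: max0.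
have [[R0 [Y0 m0]]|nex] := EM (exists R, Y R /\ max_ideal R B.[t]); last first.
  by move=> R xs /(_ 0%N)[h _ _]; apply: nex; exists (R 0%N).
have [gR0 sER0 sR0V R0t _] := Y0; have lR0 := proj1 gR0.
have dR0 := dominates_mid sER0 sR0V dV.
have [g Hg] := min_monicP rE te lR0 dR0 R0t hB nB m0; have [hg mg sg _ _] := Hg.
have [Q [S [hQ mS eB sQ]]] := min_monic_div rE lR0 dR0 R0t Hg hB m0.
have nQ : ~ mover E Q.
  move=> mQ; apply: nB; rewrite eB mulrC; apply: (over_idealD (proj2 lE)) => //.
  exact: (over_idealM (proj2 lE)).
apply: (no_bad_sub (Y := fun R => (Y R /\ max_ideal R g.[t]) \/ (Y R /\ max_ideal R Q.[t]))).
  move=> R [YR mB]; have [[lR _] sER sRV Rt _] := YR; have dR := dominates_mid sER sRV dV.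
  have hR P : polyover E P -> R P.[t] by apply: (horner_sub lR dR Rt).
  have : max_ideal R (Q.[t] * g.[t]).
    have -> : Q.[t] * g.[t] = B.[t] - S.[t] by rewrite eB hornerD hornerM addrK.
    by apply: maxB => //; apply: (mover_max rE te).
  by case/(max_prime lR (hR _ hQ) (hR _ hg)); [right|left].
apply: no_badU; first exact: (no_bad_center Y0 Hg).
apply: IH => //; apply: leq_trans sQ _.
have : (0 < size B)%N.
  by rewrite lt0n size_poly_eq0; apply: contra_not_neq nB => -> i; rewrite coef0; apply: max0.
by move: sB sg; lia.
Qed.

(** For [z = A.[t] / B.[t]], a ring of the chart that omits [z] has [B.[t]] as a nonunit. *)
Lemma no_bad_chart : no_bad (fun R => [/\ good R, sub E R, sub R V, R t & ~ sub V R]).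
Proof.
apply: no_bad_cover => R z [_ _ sRV _ _] Rz.
have [A [B [hA hB nB e]]] := val_rep (sRV _ Rz).
apply: (no_bad_sub _ (no_bad_root (leqnn _) hB nB)) => Q [YQ nQz]; split=> //.
apply: contrapT => nm; apply: nQz; have [[lQ _] sEQ sQV Qt _] := YQ.
have dQ := dominates_mid sEQ sQV dV; have sQ := proj1 lQ.
have QB : Q B.[t] by apply: (horner_sub lQ dQ).
have [b0 _ QBi] := max_unit QB nm.
have -> : z = A.[t] * (B.[t])^-1 by rewrite -e mulfK.
by apply: subringM => //; apply: (horner_sub lQ dQ).
Qed.
End OrdCase.

Section BelowValuation.
Variable F : fieldType.
Implicit Types (E V R : F -> Prop).

Lemma transC E V x y : valuation_ring V -> regular_pair E x y -> quotient_field_of E ->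
  dominates E V -> V (y / x) -> residually_trans E (y / x) V ->
  V (x / y) /\ residually_trans E (x / y) V.
Proof.
move=> vV rE qE dV Vt tr; have lV := valuation_local vV; have sV := proj1 lV.
have rE' := regular_pairC rE; have [[lE _ _ _ _] x0 _] := rE; have [_ y0 _] := rE'.
have sE := proj1 lE.
have [t0 _] : unit_in V (y / x).
  apply: max_unit => // m; have /(_ 1%N) : mover E 'X by apply: tr; [apply: overX|rewrite hornerX].
  by rewrite coefX eqxx; apply: max1N.
rewrite invf_div => Vt'; split=> // P hP mP.
have sP := leqnSn (size P).
(* [Q] plays the role of the reversed polynomial; it arises by reading one element of a power of the
   maximal ideal in both charts. *)
have [Q [hQ sQ eQ]] : exists Q, [/\ polyover E Q, (size Q <= (size P).+1)%N &
    y ^+ size P * P.[x / y] = x ^+ size P * Q.[y / x]].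
  by apply/(mpowE rE (erefl _)); apply/(mpowE rE' (erefl _)); exists P.
apply/(mpow_lead rE' qE (erefl _) hP sP); rewrite eQ; apply/(mpow_lead rE qE (erefl _) hQ sQ).
apply: tr => //.
have -> : Q.[y / x] = (y / x) ^+ size P * P.[x / y].
  apply: (mulfI (expf_neq0 (size P) x0)); rewrite -eQ mulrA -exprMn; congr (_ ^+ _ * _).
  by rewrite mulrC divfK.
by apply: maxMl => //; apply: subringX.
Qed.

Lemma no_bad_ord E V : valuation_ring V -> quotient_field_of E -> dominates E V -> ord_type V E ->
  no_bad (fun R => [/\ good R, sub E R & sub R V]).
Proof.
move=> vV qE dV [x [y [rE Vt tr]]]; have [Vt' tr'] := transC vV rE qE dV Vt tr.
have rE' := regular_pairC rE.
have N1 := no_bad_chart vV rE qE (erefl _) dV Vt tr.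
have N2 := no_bad_chart vV rE' qE (erefl _) dV Vt' tr'.
apply: (no_bad_sub _ (no_badU (no_badU (no_bad1 (V := E)) (no_bad1 (V := V))) (no_badU N1 N2))).
move=> R [gR sER sRV]; have [sVR|nVR] := EM (sub V R); first by left; right; apply: sub_antisym.
have [sRE|nRE] := EM (sub R E); first by left; left; apply: sub_antisym.
right; have [Rt|Rt] := good_chart rE qE (erefl _) gR (dominates_mid sER sRV dV) nRE.
  by left.
by right; split=> //; rewrite invf_div in Rt.
Qed.

Theorem no_bad_below V D : valuation_ring V -> (exists x y, regular_pair D x y) ->
  quotient_field_of D -> dominates D V -> no_bad (fun R => [/\ good R, sub D R & sub R V]).
Proof.
move=> vV rD qD dD; have [[n hn]|nord] := EM (exists n, ord_type V (iter n (qt V) D)); last first.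
  have nord' n : ~ ord_type V (iter n (qt V) D) by move=> h; apply: nord; exists n.
  apply: (no_bad_sub (Y := fun R => R = V \/ exists n, R = iter n (qt V) D)).
    by move=> R [gR s1 s2]; apply: (tower_good vV qD rD dD nord').
  apply: no_badU; first exact: no_bad1.
  by apply: no_bad_chain => n; apply: (tower_mono vV qD rD dD nord').
elim: n D rD qD dD hn => [|n IH] D rD qD dD hn; first exact: no_bad_ord.
have [oD|nD] := EM (ord_type V D); first exact: no_bad_ord.
have [r' q' d' s'] := qt_step vV rD qD dD nD.
rewrite iterSr in hn.
apply: (no_bad_sub _ (no_badU (no_bad1 (V := D)) (IH _ r' q' d' hn))) => R [gR sDR sRV].
have [sRD|nRD] := EM (sub R D).
  by left; apply: sub_antisym => //; apply: sDR.
right; split=> //; have [x [y rD']] := rD; exact: (qt_sub_good vV rD').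
Qed.
End BelowValuation.

(** * Chevalley's theorem and irreducible components *)

Lemma Zorn_above (T : Type) (P : (T -> Prop) -> Prop) (A0 : T -> Prop) : P A0 ->
  (forall C : (T -> Prop) -> Prop, (exists A, C A) ->
    (forall A, C A -> P A) -> (forall A B, C A -> C B ->
      (forall z, A z -> B z) \/ (forall z, B z -> A z)) -> P (fun z => exists2 A, C A & A z)) ->
  exists A, [/\ P A, forall z, A0 z -> A z &
    forall B, P B -> (forall z, A z -> B z) -> forall z, B z -> A z].
Proof.
move=> P0 chain; pose P' (A : set T) := A = set0 \/ (P A /\ forall z, A0 z -> A z).
have [|A [PA Amax]] := @Zorn_bigcup T P'.
  move=> C CP tot.
  pose C' A := C A /\ A <> set0.
  have eC : (\bigcup_(X in C) X = \bigcup_(X in C') X)%classic.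
    apply/seteqP; split=> z [X CX Xz]; exists X => //; last by case: CX.
    by split=> // e; rewrite e in Xz.
  have [[X0 C'X0]|nex] := EM (exists A, C' A); last first.
    left; rewrite eC; apply/seteqP; split=> // z [X C'X _]; by case: nex; exists X.
  have C'P X : C' X -> P X /\ forall z, A0 z -> X z by move=> [/CP[]].
  right; rewrite eC; split.
    apply: (chain C'); first by exists X0.
      by move=> X /C'P[].
    by move=> X Y [CX _] [CY _]; apply: tot.
  by move=> z A0z; exists X0 => //; have [_] := C'P _ C'X0; apply.
have {PA} [PA A0A] : P A /\ forall z, A0 z -> A z.
  case: PA => // A_0; have [e0|n0] := EM (A0 = set0).
    by split; [rewrite A_0 -e0|rewrite A_0 e0].
  case: (Amax A0); last by right.
  by rewrite A_0; split=> // h; apply: n0; apply/seteqP; split=> // z /h.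
exists A; split=> // B PB AB z Bz; apply: contrapT => nAz; apply: (Amax B).
  by split=> // /(_ z Bz).
by right; split=> // w /A0A /AB.
Qed.

Section Chevalley.
Variable F : fieldType.
Implicit Types (A R I : F -> Prop).

Definition ext_max A R z := forall I, is_ideal R I -> sub (max_ideal A) I -> I z.

Lemma ext_max_ideal A R : is_subring R -> sub A R -> is_ideal R (ext_max A R).
Proof.
move=> sR sAR; split.
- move=> z h; apply: h; last by move=> a [/sAR].
  by split=> //; [exact: subring0|move=> *; exact: subringD|move=> *; exact: subringM].
- by move=> I iI _; apply: (ideal0 iI).
- by move=> a b ha hb I iI sI; apply: (idealD iI); [apply: ha|apply: hb].
- by move=> r a Rr ha I iI sI; apply: (idealMl iI) => //; apply: ha.
Qed.

Lemma ext_max_mono A R R' : is_subring R -> sub R R' -> sub A R ->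
  sub (ext_max A R) (ext_max A R').
Proof.
move=> sR s sA z h I iI sI; suff [] : R z /\ I z by [].
apply: (h (fun z => R z /\ I z)); last first.
  by move=> a ma; split; [apply: sA; case: ma|apply: sI].
split.
- by move=> w [].
- by split; [exact: subring0|exact: (ideal0 iI)].
- by move=> a b [? ?] [? ?]; split; [exact: subringD|exact: (idealD iI)].
- by move=> a b Ra [? ?]; split; [exact: subringM|apply: (idealMl iI) => //; exact: s].
Qed.

Definition proper_ext A R := [/\ is_subring R, sub A R & ~ ext_max A R 1].

Section Maximal.
Variables (A R : F -> Prop).
Hypotheses (pR : proper_ext A R).
Hypothesis Rmax : forall R', proper_ext A R' -> sub R R' -> sub R' R.
Let sR : is_subring R. Proof. by case: pR. Qed.
Let sAR : sub A R. Proof. by case: pR. Qed.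
Let M := ext_max A R.
Let iM : is_ideal R M := ext_max_ideal sR sAR.
Let M1 : ~ M 1. Proof. by case: pR. Qed.
Let mM : sub (max_ideal A) M. Proof. by move=> a ma I _; apply. Qed.

Let grow R' I : is_subring R' -> sub R R' -> is_ideal R' I -> sub (max_ideal A) I -> ~ I 1 ->
  sub R' R.
Proof.
move=> sR' s iI mI nI; apply: Rmax => //; split=> //; first by move=> a /sAR /s.
by move=> h; apply: nI; apply: h.
Qed.

(** Otherwise [R] could be enlarged by inverting [u = 1 - i]: since [u] is [1] modulo [M], the
    extension of [M] stays proper. *)
Let inv1B i : M i -> 1 - i != 0 /\ R (1 - i)^-1.
Proof.
move=> Mi; set u := 1 - i; have u0 : u != 0.
  by apply: contra_not_neq M1 => /eqP; rewrite subr_eq0 => /eqP->.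
split=> //; have Ru : R u by apply: subringB => //; [exact: subring1|exact: (ideal_sub iM)].
have Run n : R (u ^+ n) by exact: subringX.
have Mun n : M (1 - u ^+ n).
  elim: n => [|n IH]; first by rewrite expr0 subrr; exact: (ideal0 iM).
  have -> : 1 - u ^+ n.+1 = (1 - u ^+ n) + i * u ^+ n by rewrite exprS /u; ring.
  by apply: (idealD iM) => //; apply: (idealMr iM).
have frac (K : F -> Prop) : is_ideal R K -> forall a b n m, K a -> K b ->
    K (a * u ^+ m + b * u ^+ n).
  by move=> iK a b n m Ka Kb; apply: (idealD iK); apply: (idealMr iK).
pose L (K : F -> Prop) z := exists a n, K a /\ z = a / u ^+ n.
have sL : is_subring (L R).
  split.
  - by exists 1, 0%N; rewrite expr0 divr1; split=> //; exact: subring1.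
  - move=> _ _ [a [n [Ra ->]]] [b [m [Rb ->]]].
    exists (a * u ^+ m - b * u ^+ n), (n + m)%N; split.
      by apply: subringB => //; apply: subringM.
    by rewrite exprD; field; rewrite !expf_neq0.
  - move=> _ _ [a [n [Ra ->]]] [b [m [Rb ->]]]; exists (a * b), (n + m)%N.
    by split; [exact: subringM|rewrite exprD; field; rewrite !expf_neq0].
apply: (@grow (L R) (L M)) => //.
- by move=> a Ra; exists a, 0%N; rewrite expr0 divr1.
- split.
  + by move=> _ [a [n [Ma ->]]]; exists a, n; split=> //; exact: (ideal_sub iM).
  + by exists 0, 0%N; rewrite mul0r; split=> //; exact: (ideal0 iM).
  + move=> _ _ [a [n [Ma ->]]] [b [m [Mb ->]]].
    exists (a * u ^+ m + b * u ^+ n), (n + m)%N; split; first exact: (frac M iM).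
    by rewrite exprD; field; rewrite !expf_neq0.
  + move=> _ _ [a [n [Ra ->]]] [b [m [Mb ->]]]; exists (a * b), (n + m)%N.
    by split; [exact: (idealMl iM)|rewrite exprD; field; rewrite !expf_neq0].
- by move=> a ma; exists a, 0%N; rewrite expr0 divr1; split=> //; exact: (mM ma).
- move=> [a [n [Ma e]]]; apply: M1; rewrite -(subrK (u ^+ n) 1); apply: (idealD iM) => //.
  suff -> : u ^+ n = a by [].
  by have := congr1 ( *%R^~ (u ^+ n)) e; rewrite /= mul1r divfK // expf_neq0.
- by exists 1, 1%N; rewrite expr1 div1r; split=> //; exact: subring1.
Qed.

Let eq1 z : ~ R z -> exists2 P, polyover M P & P.[z] = 1.
Proof.
move=> nz; apply: contrapT => nh; apply: nz.
apply: (@grow (adj R z) (fun w => exists2 P, polyover M P & w = P.[z])).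
- exact: adj_subring.
- exact: adj_base.
- split.
  + by move=> _ [P hP ->]; exists P => // i; apply: (ideal_sub iM).
  + by exists 0; rewrite ?horner0 // => i; rewrite coef0; apply: (ideal0 iM).
  + move=> _ _ [P hP ->] [Q hQ ->]; exists (P + Q); last by rewrite hornerD.
    exact: (over_idealD iM).
  + move=> _ _ [Q hQ ->] [P hP ->]; exists (Q * P); last by rewrite hornerM.
    exact: (over_idealM iM).
- move=> a ma; exists a%:P; last by rewrite hornerC.
  by move=> i; rewrite coefC; case: ifP => _; [exact: (mM ma)|exact: (ideal0 iM)].
- by move=> [P hP e]; apply: nh; exists P.
- exact: adj_gen.
Qed.

(** If [z] and its inverse were both outside [R], each would have by [eq1] a relation of least
    degree; the relation of smaller or equal degree would shorten the other one. *)
Lemma maximal_valuation : valuation_ring R.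
Proof.
split=> // z z0; apply: contrapT => /not_orP[nz nz'].
pose L w n := `[<exists P, [/\ polyover M P, (size P <= n)%N & P.[w] = 1]>].
have exL w : ~ R w -> exists n, L w n.
  by move=> /eq1[P hP e]; exists (size P); apply/asboolP; exists P.
have key w n k : w != 0 -> L w n -> L w^-1 k -> (k <= n)%N -> exists2 n', (n' < n)%N & L w n'.
  move=> w0 /asboolP[P [hP sP eP]] /asboolP[Q [hQ sQ eQ]].
  case: n sP => [|n] sP.
    move: sP; rewrite leqn0 size_poly_eq0 => /eqP P0; move/eqP: eP.
    by rewrite P0 horner0 eq_sym oner_eq0.
  move=> kn; exists n => //; apply/asboolP.
  have [u0 Ru] := inv1B (hQ 0%N); set u := 1 - Q`_0 in u0 Ru.
  pose c := P`_n.
  (* Multiplying the relation for [w^-1] by [w ^ n] expresses [u * w ^ n] through lower powers of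
     [w], and [u] is invertible by [inv1B]. *)
  pose S := \sum_(j < n) Q`_j.+1 *: 'X^(n - j.+1).
  have eS : S.[w] = u * w ^+ n.
    move: eQ; rewrite (@horner_coef_wide _ n.+1) ?(leq_trans sQ) // big_ord_recl /= expr0 mulr1.
    move=> eQ; have {}eQ : \sum_(j < n) Q`_j.+1 * w^-1 ^+ j.+1 = u.
      by rewrite /u -eQ addrC addKr.
    rewrite -eQ horner_sum mulr_suml; apply: eq_bigr => j _.
    rewrite hornerZ hornerXn -mulrA; congr (_ * _).
    have hj : (j.+1 <= n)%N := ltn_ord j.
    have -> : w ^+ n = w ^+ j.+1 * w ^+ (n - j.+1) by rewrite -exprD subnKC.
    by rewrite exprVn mulKf // expf_neq0.
  have hS : polyover M S.
    rewrite /S; apply: big_ind => [i|? ? ? ?|j _ i]; first by rewrite coef0; exact: (ideal0 iM).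
      exact: (over_idealD iM).
    by rewrite coefZ; apply: (idealMr iM) => //; apply: overXn.
  have sS : (size S <= n)%N.
    rewrite /S; apply: (big_ind (fun T : {poly F} => (size T <= n)%N)) => [|A1 A2 h1 h2|j _].
      by rewrite size_poly0.
      by rewrite (leq_trans (size_polyD _ _)) // geq_max h1.
    apply: leq_trans (size_scale_leq _ _) _; rewrite size_polyXn.
    by have := ltn_ord j; lia.
  exists (P - c *: 'X^n + c / u *: S); split.
  - apply: (over_idealD iM).
      apply: (over_idealB sR iM) => // i; rewrite coefZ; apply: (idealMr iM); [exact: hP|].
      exact: (overXn sR).
    move=> i; rewrite coefZ mulrAC; apply: (idealMr iM) => //; apply: (idealMl iM) => //.
    exact: (ideal_sub iM (hP n)).
  - rewrite (leq_trans (size_polyD _ _)) // geq_max; apply/andP; split; last first.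
      exact: leq_trans (size_scale_leq _ _) sS.
    apply/leq_sizeP => i; rewrite leq_eqVlt coefB coefZ coefXn => /orP[/eqP<-|hi].
      by rewrite eqxx mulr1 subrr.
    by rewrite gtn_eqF // mulr0 subr0 nth_default // (leq_trans sP).
  - rewrite !hornerD hornerN !hornerZ hornerXn eS eP.
    have -> : c / u * (u * w ^+ n) = c * w ^+ n by field.
    by rewrite subrK.
case: (ex_minnP (exL _ nz)) => n Ln nmin; case: (ex_minnP (exL _ nz')) => k Lk kmin.
have [kn|nk] := leqP k n.
  by have [n' lt /nmin] := key _ _ _ z0 Ln Lk kn; lia.
have zi0 : z^-1 != 0 by rewrite invr_eq0.
rewrite -[z in L z n]invrK in Ln.
by have [n' lt /kmin] := key _ _ _ zi0 Lk Ln (ltnW nk); lia.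
Qed.

Lemma maximal_dominates : dominates A R.
Proof.
split=> // a ma; split; first by apply: sAR; case: ma.
by move=> [a0 _ Rai]; apply: M1; rewrite -(mulVf a0); apply: (idealMl iM) => //; apply: (mM ma).
Qed.
End Maximal.

Theorem exists_valuation A : local_ring A -> exists V, valuation_ring V /\ dominates A V.
Proof.
move=> lA; have sA := proj1 lA.
have pA : proper_ext A A.
  by split=> // /(_ _ (proj2 lA)) h; apply: (max1N (R := A)); apply: h.
have [|V [pV sAV Vmax]] := Zorn_above pA.
  move=> C [R0 CR0] CP tot; split.
  - split.
    + by exists R0 => //; apply: subring1; case: (CP _ CR0).
    + move=> a b [R1 C1 h1] [R2 C2 h2]; have [s|s] := tot _ _ C1 C2.
        by exists R2 => //; apply: subringB => //; [case: (CP _ C2)|exact: s].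
      by exists R1 => //; apply: subringB => //; [case: (CP _ C1)|exact: s].
    + move=> a b [R1 C1 h1] [R2 C2 h2]; have [s|s] := tot _ _ C1 C2.
        by exists R2 => //; apply: subringM => //; [case: (CP _ C2)|exact: s].
      by exists R1 => //; apply: subringM => //; [case: (CP _ C1)|exact: s].
  - by move=> a Aa; exists R0 => //; case: (CP _ CR0) => _ + _; apply.
  (* The extensions of the maximal ideal along the chain form an ideal of the union, so [1] could
     enter only at some member. *)
  - pose U z := exists2 R, C R & ext_max A R z.
    have iE R : C R -> is_ideal R (ext_max A R).
      by move=> CR; have [sR sAR _] := CP _ CR; apply: ext_max_ideal.
    have up R R' : C R -> (forall z, R z -> R' z) -> sub (ext_max A R) (ext_max A R').
      by move=> CR s; have [sR sAR _] := CP _ CR; apply: ext_max_mono.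
    suff h : ~ U 1.
      move=> /(_ U) e; apply: h; apply: e; last by move=> a ma; exists R0 => // I _; apply.
      split.
      + by move=> z [R CR /(ideal_sub (iE _ CR))]; exists R.
      + by exists R0 => //; apply: (ideal0 (iE _ CR0)).
      + move=> a b [R1 C1 h1] [R2 C2 h2]; have [s|s] := tot _ _ C1 C2.
          by exists R2 => //; apply: (idealD (iE _ C2)) => //; apply: (up R1).
        by exists R1 => //; apply: (idealD (iE _ C1)) => //; apply: (up R2).
      + move=> a b [R1 C1 h1] [R2 C2 h2]; have [s|s] := tot _ _ C1 C2.
          by exists R2 => //; apply: (idealMl (iE _ C2)) => //; apply: s.
        by exists R1 => //; apply: (idealMl (iE _ C1)) => //; apply: (up R2).
    by move=> [R CR]; case: (CP _ CR).
exists V; split; [exact: (maximal_valuation pV Vmax)|exact: (maximal_dominates pV)].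
Qed.
End Chevalley.

(** * Irreducible components of a Noetherian space *)

Section Components.
Variable F : fieldType.
Implicit Types (X Z O C : (F -> Prop) -> Prop) (R : F -> Prop).

Lemma open_basic X xs : open_in X (fun R => X R /\ basicU xs R).
Proof. by split=> [R []//|R [XR hR]]; exists xs. Qed.

Lemma openI X O1 O2 : open_in X O1 -> open_in X O2 -> open_in X (fun R => O1 R /\ O2 R).
Proof.
move=> [s1 h1] [s2 h2]; split=> [R [/s1]//|R [/h1[xs [hxs hx]] /h2[ys [hys hy]]]].
exists (xs ++ ys); split=> [z|R' XR' h].
  by rewrite mem_cat => /orP[/hxs|/hys].
by split; [apply: hx|apply: hy] => // z hz; apply: h; rewrite mem_cat hz ?orbT.
Qed.

Lemma closedD X C O : closed_in X C -> open_in X O -> closed_in X (fun R => C R /\ ~ O R).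
Proof.
move=> [sC [_ oC]] [sO oO]; split=> [R [/sC]//|]; split=> [R []//|R [XR nR]].
have [OR|nO] := EM (O R).
  have [xs [hxs h]] := oO _ OR; exists xs; split=> // R' XR' hR'; split=> // -[_]; apply.
  exact: h.
have [|xs [hxs h]] := oC R; first by split=> // CR; apply: nR.
by exists xs; split=> // R' XR' hR'; split=> // -[CR' _]; case: (h _ XR' hR').
Qed.

Lemma mem_component X R : X R -> exists2 Z, irreducible_component X Z & Z R.
Proof.
move=> XR; have P0 : irreducible_in X (fun R' => R' = R).
  split=> [R' -> //|| O1 O2 _ _ [_ [-> h1]] [_ [-> h2]]]; first by exists R.
  by exists R.
have [|Z [iZ RZ Zmax]] := Zorn_above P0.
  move=> C [Z0 C0] CP tot; split.
  - by move=> R' [Z CZ]; have [+ _ _] := CP _ CZ; apply.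
  - by have [_ [R' ZR'] _] := CP _ C0; exists R', Z0.
  - move=> O1 O2 o1 o2 [R1 [[Z1 C1 h1] O1R]] [R2 [[Z2 C2 h2] O2R]].
    have [s|s] := tot _ _ C1 C2.
      have [_ _ /(_ O1 O2 o1 o2)[||R' [? ? ?]]] := CP _ C2.
      + by exists R1; split=> //; apply: s.
      + by exists R2.
      + by exists R'; split=> //; exists Z2.
    have [_ _ /(_ O1 O2 o1 o2)[||R' [? ? ?]]] := CP _ C1.
    + by exists R1.
    + by exists R2; split=> //; apply: s.
    + by exists R'; split=> //; exists Z1.
exists Z; last exact: RZ.
by split=> // Z' iZ' s; apply: Zmax.
Qed.

(** The pieces cover [C] and are allowed to exceed it; the notion is finally used with [C = X]. *)
Definition decomposable X C := exists n (c : nat -> (F -> Prop) -> Prop),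
  (forall i, (i < n)%N -> irreducible_in X (c i) /\ closed_in X (c i)) /\
  (forall R, C R -> exists i, (i < n)%N /\ c i R).

Lemma decomposableU X C1 C2 : decomposable X C1 -> decomposable X C2 ->
  decomposable X (fun R => C1 R \/ C2 R).
Proof.
move=> [n1 [c1 [h1 g1]]] [n2 [c2 [h2 g2]]].
exists (n1 + n2)%N, (fun i => if (i < n1)%N then c1 i else c2 (i - n1)%N); split.
  move=> i hi; case: ltnP => hi1; first exact: h1.
  by apply: h2; lia.
move=> R [/g1[i [hi ci]]|/g2[i [hi ci]]].
  by exists i; split; [lia|rewrite hi].
by exists (n1 + i)%N; split; [lia|rewrite ltnNge leq_addr /= addKn].
Qed.

Lemma noetherian_decomposable X C : noetherian_space X -> closed_in X C -> decomposable X C.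
Proof.
move=> nX cC; apply: contrapT => nC.
(* Noetherian induction by choice: [f] sends an indecomposable closed set to a strictly smaller one,
   and its iterates never become stationary. *)
have /choice[f hf] : forall C, exists C', closed_in X C -> ~ decomposable X C ->
    [/\ closed_in X C', ~ decomposable X C', psub C' C & C' <> C].
  move=> {cC nC}C; have [[cC nC]|h] := EM (closed_in X C /\ ~ decomposable X C); last first.
    by exists C => h1 h2; case: h.
  have [R0 CR0] : exists R, C R.
    apply: contrapT => ne; apply: nC; exists 0%N, (fun _ => C).
    by split=> // R CR; case: ne; exists R.
  have [O1 [O2 [o1 o2 [R1 [C1 h1]] [R2 [C2 h2]] no]]] : exists O1 O2, [/\ open_in X O1, open_in X O2,
      exists R, C R /\ O1 R, exists R, C R /\ O2 R & ~ exists R, [/\ C R, O1 R & O2 R]].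
    apply: contrapT => nh; apply: nC; exists 1%N, (fun _ => C).
    split=> [i _|R CR]; last by exists 0%N.
    split=> //; split; [by case: cC|by exists R0|].
    move=> O1 O2 o1 o2 m1 m2; apply: contrapT => no; apply: nh.
    by exists O1, O2.
  have [d1|nd1] := EM (decomposable X (fun R => C R /\ ~ O1 R)); last first.
    exists (fun R => C R /\ ~ O1 R) => _ _; split=> //; [exact: closedD|by move=> R []|].
    by move/predeqP => /(_ R1)[_ /(_ C1)[_]].
  exists (fun R => C R /\ ~ O2 R) => _ _; split; [exact: closedD| |by move=> R []|]; last first.
    by move/predeqP => /(_ R2)[_ /(_ C2)[_]].
  move=> d2; apply: nC; have [n [c [hc gc]]] := decomposableU d1 d2.
  exists n, c; split=> // R CR; apply: gc.
  have [O1R|] := EM (O1 R); last by left.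
  by right; split=> // O2R; apply: no; exists R.
have hn n : closed_in X (iter n f C) /\ ~ decomposable X (iter n f C).
  by elim: n => [//|n [h1 h2]]; have [] := hf _ h1 h2.
have [|n|N hN] := nX (fun n => iter n f C); first by move=> n; case: (hn n).
  by case: (hn n) => h1 h2; have [] := hf _ h1 h2.
by have [h1 h2] := hn N; have [_ _ _] := hf _ h1 h2; apply; apply: (hN N.+1).
Qed.

Lemma noetherian_components X : noetherian_space X -> finitely_many_components X.
Proof.
move=> nX; have cX : closed_in X X by split=> [R //|]; split=> [R []//|R []].
have [n [c [hc gc]]] := noetherian_decomposable nX cX.
exists n, c => Z [iZ Zmax]; have [sZ [R0 ZR0] irr] := iZ.
(* If [Z] lay in no [c i], the complements of the [c i] would all meet [Z], and by irreducibility so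
   would their intersection, which is empty. *)
have [i [hi Zi]] : exists i, (i < n)%N /\ psub Z (c i).
  apply: contrapT => nh.
  suff /(_ n (leqnn n))[O [oO [R [ZR OR]] hO]] : forall k, (k <= n)%N -> exists O,
      [/\ open_in X O, exists R, Z R /\ O R & forall R, O R -> forall i, (i < k)%N -> ~ c i R].
    by have [i [hi ci]] := gc R (sZ _ ZR); apply: (hO R OR i hi).
  elim=> [|k IH] hk.
    by exists X; split=> //; [split=> // R XR; exists [::]|exists R0; split=> //; apply: sZ].
  have [O [oO mO hO]] := IH (ltnW hk); have [_ [_ ok]] := hc k hk.
  exists (fun R => O R /\ (X R /\ ~ c k R)); split; first exact: openI.
    have [R [CR nR]] : exists R, Z R /\ ~ c k R.
      apply: contrapT => ne; apply: nh; exists k; split=> // R ZR.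
      by apply: contrapT => nc; apply: ne; exists R.
    have [|R' [? ? ?]] := irr O _ oO ok mO; last by exists R'.
    by exists R; split=> //; split=> //; apply: sZ.
  move=> R [OR [_ nR]] i; rewrite ltnS leq_eqVlt => /orP[/eqP->//|]; exact: hO.
exists i; split=> //; have [ic _] := hc i hi; apply/predeqP => R; split; first exact: Zi.
exact: (Zmax _ ic Zi).
Qed.
End Components.

(** * The theorem *)

Section Main.
Variables (F : fieldType) (D : F -> Prop).
Implicit Types (R V : F -> Prop) (S : (F -> Prop) -> Prop).
Hypotheses (hD : regular_local2 D) (qD : quotient_field_of D).

Let rD : exists x y, regular_pair D x y := regular_local2_pair hD.
Let lD : local_ring D. Proof. by case: hD. Qed.
Let sD : is_subring D := proj1 lD.

(* Otherwise the center of [R] on [D] is a principal prime [p D], and [R] contains the discrete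
   valuation ring of fractions with denominator prime to [p]. *)
Lemma in_Q_dominates R : in_Q D R -> dominates D R.
Proof.
move=> [rR sDR]; have lR : local_ring R by case: rR.
have [X [Y rp]] := regular_local2_pair rR; have sR := proj1 lR.
split=> // a ma; apply: contrapT => nma; pose C z := D z /\ max_ideal R z.
have wl x y : regular_pair D x y -> ~ C x -> False.
  move=> rp' nCx; have [gD _ _] := rp'; have [_ _ mx _ _] := gD; have Dx := max_sub mx.
  have iC : is_ideal D C.
    split.
    - by move=> z [].
    - by split; [exact: subring0|exact: max0].
    - by move=> z w [? ?] [? ?]; split; [exact: subringD|exact: maxD].
    - by move=> z w Dz [? ?]; split; [exact: subringM|apply: maxMl => //; exact: sDR].
  have [z Dz [_ m]|p [[Dp mp] gC]] := saturated_principal gD iC (x := x).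
    have [mx'|//] := max_prime lR (sDR _ Dx) (sDR _ Dz) m.
    by case: nCx.
  have mDp : max_ideal D p.
    split=> // -[p0 _ Dpi]; apply: (unit_max _ mp); split=> //; exact: sDR.
  have unit f : D f -> ~ princ D p f -> unit_in R f.
    move=> Df nf; apply: max_unit; first exact: sDR.
    by move=> m; apply: nf; apply: gC.
  have Rp := sDR _ Dp.
  have vR z : z != 0 -> R z \/ R z^-1.
    have [f [g [Df Dg g0 ->]]] := qD z => fg0.
    have f0 : f != 0 by apply: contra_neq fg0 => ->; rewrite mul0r.
    have [i [f' [Df' nf ef]]] := regular_factor rp' mDp Df f0.
    have [j [g' [Dg' ng eg]]] := regular_factor rp' mDp Dg g0.
    have [f0' Rf Rfi] := unit _ Df' nf; have [g0' Rg Rgi] := unit _ Dg' ng.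
    have [ji|ij] := leqP j i.
      left; have -> : f / g = p ^+ (i - j) * f' * g'^-1.
        have pj0 : p ^+ j != 0 by apply: contra_neq g0 => e; rewrite eg e mul0r.
        have -> : f = p ^+ (i - j) * p ^+ j * f' by rewrite ef -exprD subnK.
        by rewrite eg; field; rewrite ?g0' ?pj0.
      by apply: subringM => //; apply: subringM => //; apply: subringX.
    right; rewrite invf_div; have -> : g / f = p ^+ (j - i) * g' * f'^-1.
      have pi0 : p ^+ i != 0 by apply: contra_neq f0 => e; rewrite ef e mul0r.
      have -> : g = p ^+ (j - i) * p ^+ i * g' by rewrite eg -exprD subnK // ltnW.
      by rewrite ef; field; rewrite ?f0' ?pi0.
    by apply: subringM => //; apply: subringM => //; apply: subringX.
  (* [R] would be a valuation ring, but it contains neither [Y / X] nor its inverse. *)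
  have rp2 := regular_pairC rp; have [_ X0 _] := rp; have [_ Y0 _] := rp2.
  case: (vR (Y / X)); first by rewrite mulf_neq0 // invr_eq0.
    exact: (chart_notin rp (erefl _)).
  by rewrite invf_div; exact: (chart_notin rp2 (erefl _)).
have [x [y rxy]] := rD; have [[_ _ _ _ gen] _ _] := rxy.
have [Cx|] := EM (C x); last exact: wl rxy.
have [Cy|] := EM (C y); last exact: wl (regular_pairC rxy).
have [c [d [Dc Dd e]]] := gen _ ma; apply: nma; rewrite e.
by apply: maxD => //; apply: maxMl => //; [exact: sDR|case: Cx|exact: sDR|case: Cy].
Qed.

Lemma in_Qstar_good R : in_Qstar D R -> good R /\ dominates D R.
Proof.
case=> [hR|[[lR sDR mR] vR]].
  split; last exact: in_Q_dominates.
  by have [rR _] := hR; split; [case: rR|left; exact: regular_local2_pair].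
split; first by split=> //; right.
by split=> // a ma; apply/mR => //; apply: max_sub ma.
Qed.

Lemma dominates_in_L V : valuation_ring V -> dominates D V -> in_L D V.
Proof.
move=> vV dV; split; [exact: valuation_local|exact: dV.1|].
by move=> x Dx; split; [exact: (dominates_max lD dV)|exact: dV.2].
Qed.

Lemma no_bad_downstar V : in_L D V -> valuation_ring V ->
  no_bad (fun R => in_Qstar D R /\ sub R V).
Proof.
move=> [lV sDV mV] vV; have dV : dominates D V.
  by split=> // a ma; apply/mV => //; apply: max_sub ma.
apply: (no_bad_sub _ (no_bad_below vV rD qD dV)) => R [/in_Qstar_good[gR dR] sRV].
by split=> //; apply: dR.1.
Qed.

(** Irreducibility makes [Z] directed: finitely many elements, each in some member, lie together in
    one member. Hence the union [A] inherits the properties of a local ring dominating [D]. *)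
Lemma irreducible_below S Z : psub S (in_Qstar D) -> irreducible_in S Z ->
  exists V, [/\ in_L D V, valuation_ring V & forall R, Z R -> sub R V].
Proof.
move=> SQ [ZS [R0 ZR0] irr].
have good R : Z R -> local_ring R /\ dominates D R.
  by move=> /ZS /SQ /in_Qstar_good[[]].
have dir R1 R2 xs ys : Z R1 -> Z R2 -> basicU xs R1 -> basicU ys R2 ->
    exists R, [/\ Z R, basicU xs R & basicU ys R].
  move=> Z1 Z2 h1 h2; have [||R [ZR [_ ?] [_ ?]]] := irr _ _ (open_basic S xs) (open_basic S ys).
  - by exists R1; split=> //; split=> //; apply: ZS.
  - by exists R2; split=> //; split=> //; apply: ZS.
  - by exists R.
have b1 a (R : F -> Prop) : R a -> basicU [:: a] R by move=> Ra z; rewrite inE => /eqP->.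
pose A a := exists2 R, Z R & R a.
have dir2 a b : A a -> A b -> exists R, [/\ Z R, R a & R b].
  move=> [R1 Z1 h1] [R2 Z2 h2]; have [R [ZR ha hb]] := dir _ _ _ _ Z1 Z2 (b1 _ _ h1) (b1 _ _ h2).
  by exists R; split=> //; [apply: ha|apply: hb]; rewrite inE.
have dir3 a b c : A a -> A b -> A c -> exists R, [/\ Z R, R a, R b & R c].
  move=> Aa Ab [R2 Z2 h2]; have [R1 [Z1 ha hb]] := dir2 _ _ Aa Ab.
  have [|R [ZR hab hc]] := dir _ _ [:: a; b] [:: c] Z1 Z2 _ (b1 _ _ h2).
    by move=> z; rewrite !inE => /orP[] /eqP->.
  by exists R; split=> //; [apply: hab|apply: hab|apply: hc]; rewrite !inE eqxx ?orbT.
have sA : is_subring A.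
  split.
  - by exists R0 => //; apply: subring1; case: (good _ ZR0) => -[].
  - move=> a b Aa Ab; have [R [ZR Ra Rb]] := dir2 _ _ Aa Ab; exists R => //.
    by apply: subringB => //; case: (good _ ZR) => -[].
  - move=> a b Aa Ab; have [R [ZR Ra Rb]] := dir2 _ _ Aa Ab; exists R => //.
    by apply: subringM => //; case: (good _ ZR) => -[].
have lA : local_ring A.
  split=> //; split.
  - by move=> a [].
  - by split; [exact: subring0|case; rewrite eqxx].
  - move=> a b [Aa na] [Ab nb]; split; first exact: subringD.
    move=> [ab0 _ Aab]; have [R [ZR Ra Rb Rab]] := dir3 _ _ _ Aa Ab Aab.
    have [lR _] := good _ ZR; have sR := proj1 lR.
    have u : unit_in R (a + b) by split=> //; apply: subringD.
    apply: (unit_max u); apply: maxD => //; split=> // -[c0 _ Rc].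
      by apply: na; split=> //; exists R.
    by apply: nb; split=> //; exists R.
  - move=> r a Ar [Aa na]; split; first exact: subringM.
    move=> [ra0 _ Ara]; apply: na.
    have r0 : r != 0 by apply: contra_neq ra0 => ->; rewrite mul0r.
    have a0 : a != 0 by apply: contra_neq ra0 => ->; rewrite mulr0.
    split=> //; have -> : a^-1 = r * (r * a)^-1 by field; rewrite a0 r0.
    exact: subringM.
have dA : dominates D A.
  split=> [a Da|a ma]; first by exists R0 => //; case: (good _ ZR0) => _ [+ _]; apply.
  split; first by exists R0 => //; case: (good _ ZR0) => _ [+ _]; apply; apply: max_sub ma.
  move=> [a0 _ [R ZR Ra]]; case: (good _ ZR) => _ [sDR /(_ _ ma)[Ra' []]]; split=> //.
have [V [vV dV]] := exists_valuation lA; exists V; split=> //.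
  apply: dominates_in_L => //; split=> [a /dA.1 /dV.1 //|a /dA.2 /dV.2 //].
by move=> R ZR a Ra; apply: dV.1; exists R.
Qed.

Lemma components_below S : psub S (in_Qstar D) -> finitely_many_components S ->
  exists (n : nat) (V : nat -> (F -> Prop)),
    (forall i, (i < n)%N -> in_L D (V i) /\ valuation_ring (V i)) /\
    psub S (downstar D (fun b => exists i, (i < n)%N /\ b = V i)).
Proof.
move=> SQ [n [c hc]]; have [V0 [vV0 dV0]] := exists_valuation lD.
(* Indices whose [c i] is not irreducible receive the default [V0]. *)
have /choice[V hV] : forall i, exists V, [/\ in_L D V, valuation_ring V &
    irreducible_in S (c i) -> forall R, c i R -> sub R V].
  move=> i; have [/(irreducible_below SQ)[V [h1 h2 h3]]|ni] := EM (irreducible_in S (c i)).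
    by exists V.
  by exists V0; split=> //; apply: dominates_in_L.
exists n, V; split=> [i _|R SR]; first by have [] := hV i.
split; first exact: SQ.
have [Z cZ ZR] := mem_component SR; have [i [hi eZ]] := hc _ cZ; rewrite eZ in cZ ZR.
exists (V i); split; first by exists i.
by have [_ _ /(_ cZ.1 R ZR)] := hV i.
Qed.

Lemma closure_no_bad S : (exists (n : nat) (V : nat -> (F -> Prop)),
    (forall i, (i < n)%N -> in_L D (V i) /\ valuation_ring (V i)) /\
    psub S (downstar D (fun b => exists i, (i < n)%N /\ b = V i))) ->
  no_bad (closure_in (in_Qstar D) S).
Proof.
move=> [n [V [hV hS]]].
have nb k : (k <= n)%N -> no_bad (fun R => in_Qstar D R /\ exists i, (i < k)%N /\ sub R (V i)).
  elim: k => [|k IH] hk; first by move=> R xs /(_ 0%N)[[_ [i []]]].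
  have [iL vV] := hV k hk.
  apply: (no_bad_sub _ (no_badU (IH (ltnW hk)) (no_bad_downstar iL vV))).
  move=> R [QR [i [+ s]]]; rewrite ltnS leq_eqVlt => /orP[/eqP e|hi]; last first.
    by left; split=> //; exists i.
  by right; rewrite -e.
apply: (no_bad_sub _ (nb n (leqnn n))) => R [QR hR]; split=> //; apply: contrapT => ne.
(* The closure stays below the same valuation rings: if [R] lies below no [V i], the chosen [x i]
   define a neighbourhood of [R], and a point of [S] in it cannot lie below any [V i]. *)
have /choice[x hx] : forall i, exists x, (i < n)%N -> R x /\ ~ V i x.
  move=> i; have [hi|hi] := EM (i < n)%N; last by exists 0.
  have [x /not_implyP[Rx nx]] : exists x, ~ (R x -> V i x).
    by apply/existsNP => s; apply: ne; exists i.
  by exists x.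
have [|R' [/hS[_ [_ [[i [hi ->]] s]]] hR']] := hR [seq x i | i <- iota 0 n].
  by move=> z /mapP[i]; rewrite mem_iota add0n /= => hi ->; case: (hx i hi).
have [_ []] := hx i hi; apply: s; apply: hR'; apply: map_f.
by rewrite mem_iota add0n.
Qed.
End Main.

Lemma closure_sub (F : fieldType) (Y S : (F -> Prop) -> Prop) : psub S Y -> psub S (closure_in Y S).
Proof. by move=> SY R SR; split; [exact: SY|move=> xs h; exists R]. Qed.

Theorem theorem5p6 (F : fieldType) (D : F -> Prop)
  (S : (F -> Prop) -> Prop) :
  regular_local2 D -> quotient_field_of D ->
  (exists R, S R) -> psub S (in_Qstar D) ->
  [/\ noetherian_space S <-> finitely_many_components S,
      noetherian_space S <->
        (exists (n : nat) (V : nat -> (F -> Prop)),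
          (forall i, (i < n)%N -> in_L D (V i) /\ valuation_ring (V i)) /\
          psub S (downstar D (fun b => exists i, (i < n)%N /\ b = V i))),
      noetherian_space S <-> noetherian_space (closure_in (in_Qstar D) S)
    & psub S (in_Q D) ->
      (noetherian_space S <-> noetherian_space (closure_in (in_Q D) S))].
Proof.
move=> hD qD _ SQ; have nE X : noetherian_space X = no_bad X by apply/propext/noetherianP.
rewrite !nE.
have h12 : no_bad S -> finitely_many_components S.
  by rewrite -nE; exact: noetherian_components.
have h23 := components_below hD qD SQ.
have h34 := @closure_no_bad F D hD qD S.
have h41 := no_bad_sub (closure_sub SQ).
split; try (by split; auto).
move=> SQ'; split=> [h|]; last exact: (no_bad_sub (closure_sub SQ')).
by apply: (no_bad_sub _ (h34 (h23 (h12 h)))) => R [QR hR]; split=> //; left.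
Qed.
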